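(* Let $0<a<b$, let $A,B\in\mathbb C^{n\times n}$ be such that $A$ and $-B$ are Hermitian positive definite with spectra contained in $[a,b]$, let $F=U_FV_F^T$ with $U_F,V_F\in\mathbb C^{n\times k}$, and let $f$ be a Laplace-Stieltjes function. Let $\mathcal M=I\otimes A-B^T\otimes I$ and $X=\mathrm{vec}^{-1}(f(\mathcal M)\,\mathrm{vec}(F))$. Let $\ell\ge1$, let $U$ be an orthonormal basis of $\mathcal{RK}_\ell(A,U_F,\Psi_\ell^{[a,b]})$, let $V$ be such that $\overline V$ is an orthonormal basis of $\mathcal{RK}_\ell(B^T,V_F,-\Psi_\ell^{[a,b]})$, and let $X_\ell$ be the tensorized projection approximation of $X$ associated with $f,U,V$. Then $$\|X-X_\ell\|_2\le 16\,\gamma_{\ell,\kappa}\,f(0^+)\,\rho_{[a,b]}^{\ell/2}\,\|F\|_2,$$ where $\kappa=b/a$ and $f(0^+):=\lim_{z\to0^+}f(z)$.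
   Context: A function $f$ on $(0,\infty)$ is Laplace-Stieltjes if $f(z)=\int_0^\infty e^{-tz}\mu(t)\,dt$ for all $z>0$, where $\mu(t)\,dt$ is a non-negative measure on $[0,\infty)$ ($\mu$ may be a distribution such as a Dirac delta). The value $f(0^+)$ may be $+\infty$, in which case the bound is vacuous. $\|\cdot\|_2$ is the spectral norm; $\mathrm{vec}$ stacks the columns of a matrix and $\mathrm{vec}^{-1}$ is its inverse; $\otimes$ is the Kronecker product; $\overline V$ is the entrywise complex conjugate. Rational Krylov subspace: for a square matrix $C$, a block vector $w$ and $\Psi=\{\psi_1,\dots,\psi_\ell\}\subset\mathbb C\cup\{\infty\}$ (counted with multiplicity), $\mathcal{RK}_\ell(C,w,\Psi)$ is the span of all columns of $q_\ell(C)^{-1}w, q_\ell(C)^{-1}Cw,\dots,q_\ell(C)^{-1}C^\ell w$, where $q_\ell(z)=\prod_{\psi_j\ne\infty}(z-\psi_j)$ and $q_\ell(C)$ is invertible. An orthonormal basis of a subspace means a matrix whose columns form an orthonormal basis of it. Tensorized projection approximation associated with $f,U,V$ (matrices $U,V$ with orthonormal columns): set $A_\ell=U^*AU$, $B_\ell=V^*BV$, $Y=\mathrm{vec}^{-1}\left(f(I\otimes A_\ell-B_\ell^T\otimes I)\,\mathrm{vec}(U^*U_F\,V_F^TV)\right)$, and $X_\ell=UYV^*$. Constants: $\rho_{[a,b]}:=\exp\left(-\frac{\pi^2}{\log(4b/a)}\right)$ and $\gamma_{\ell,\kappa}:=2.23+\frac2\pi\log\left(4\ell\sqrt{\kappa/\pi}\right)$.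 Zolotarev poles: $\Psi_\ell^{[a,b]}=\{\psi_1,\dots,\psi_\ell\}\subset[-b,-a]$ denotes the set of poles of the rational function $r(z)=\prod_{j=1}^\ell\frac{z+\psi_j}{-z+\psi_j}$ which attains the minimum of $\frac{\max_{z\in[a,b]}|r(z)|}{\min_{z\in[-b,-a]}|r(z)|}$ over all rational functions $r=g/l$ with $g,l$ polynomials of degree at most $\ell$ (by a classical theorem of Zolotarev the minimum is attained by a function of this form). *)

(* Defs.v *)
From HB Require Import structures.
From mathcomp Require Import all_boot all_order all_algebra.
From mathcomp Require Import spectral sesquilinear.
From mathcomp Require Import all_classical all_reals all_analysis.
From mathcomp.real_closed Require Import complex mxtens.
From mathcomp Require Import ring.

Set Implicit Arguments.
Unset Strict Implicit.
Unset Printing Implicit Defensive.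

Import Order.TTheory GRing.Theory Num.Theory.
Import numFieldNormedType.Exports.

Local Open Scope classical_set_scope.
Local Open Scope ring_scope.
Local Open Scope sesquilinear_scope.
Local Open Scope complex_scope.

(* Complex matrices have entries in R[i]; [M ^t*] is the conjugate transpose,
   [map_mx Num.conj M] the entrywise conjugate, [A *t B] the Kronecker product. *)
Notation "A *t B" := (tensmx A B)
  (at level 40, left associativity, format "A  *t  B") : ring_scope.

(* [mxvec] lists the entries row by row, hence the inner transposition. *)
Definition vec (T : Type) (m n : nat) (X : 'M[T]_(m, n)) : 'cV[T]_(n * m) :=
  (mxvec X^T)^T.

Definition unvec (T : Type) (m n : nat) (v : 'cV[T]_(n * m)) : 'M[T]_(m, n) :=
  (vec_mx v^T)^T.

Lemma vecK (T : Type) (m n : nat) : cancel (@vec T m n) (@unvec T m n).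
Proof. by move=> X; rewrite /unvec /vec trmxK mxvecK trmxK. Qed.

Lemma unvecK (T : Type) (m n : nat) : cancel (@unvec T m n) (@vec T m n).
Proof. by move=> v; rewrite /unvec /vec trmxK vec_mxK trmxK. Qed.

Lemma index_pair (S T : eqType) (s : seq S) (t : seq T) (x : S) (y : T) :
  x \in s -> y \in t ->
  index (x, y) [seq (u, v) | u <- s, v <- t]
  = (index x s * size t + index y t)%N.
Proof.
elim: s => [//|u s IH] xs yt; rewrite allpairs_cons index_cat /=.
have [ux|ux] := eqVneq u x.
  rewrite mul0n add0n ux mem_map ?yt; last by move=> ? ? [].
  by rewrite index_map // => ? ? [].
rewrite (_ : _ \in _ = false); last first.
  by apply/negbTE/negP => /mapP[v _ [xu _]]; rewrite xu eqxx in ux.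
move: xs; rewrite inE eq_sym (negbTE ux) /= => xs.
by rewrite IH // size_map mulSn addnA.
Qed.

(* The indexing of [mxvec] agrees with that of the Kronecker product. *)
Lemma mxvec_index_tens (m n : nat) (i : 'I_m) (j : 'I_n) :
  mxvec_index i j = mxtens_index (i, j).
Proof.
apply: val_inj => /=.
have -> : enum_rank (i, j) = index (i, j) (enum {: 'I_m * 'I_n}) :> nat.
  rewrite -[in RHS](nth_enum_rank (i, j) (i, j)) index_uniq ?enum_uniq //.
  by rewrite -cardE.
rewrite enumT unlock /= /prod_enum index_pair ?mem_enum //.
by rewrite size_enum_ord !index_enum_ord.
Qed.

Lemma vec_kronecker (R : comNzRingType) (m n p q : nat)
    (A : 'M[R]_(p, m)) (X : 'M[R]_(m, n)) (B : 'M[R]_(n, q)) :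
  vec (A *m X *m B) = (B^T *t A) *m vec X.
Proof.
have vecE u v (Y : 'M[R]_(u, v)) i j : vec Y (mxtens_index (j, i)) 0 = Y i j.
  by rewrite mxE -mxvec_index_tens mxvecE mxE.
apply/colP => ji; case: (mxtens_indexP ji) => j i; rewrite vecE.
rewrite [RHS]mxE (reindex (@mxtens_index n m)) /=; last first.
  by exists (@mxtens_unindex n m) => ? _;
    rewrite (mxtens_indexK, mxtens_unindexK).
transitivity (\sum_(h < n) \sum_(g < m) B^T j h * A i g * X g h).
  rewrite mxE; apply: eq_bigr => h _; rewrite mxE big_distrl /=.
  by apply: eq_bigr => g _; rewrite mxE; ring.
rewrite (pair_bigA _ (fun h g => B^T j h * A i g * X g h)) /=.
by apply: eq_bigr => -[h g] _; rewrite tensmxE vecE.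
Qed.

Section ComplexMatrices.
Variable R : realType.
Local Notation C := R[i].

Definition enorm (n : nat) (x : 'cV[C]_n) : R :=
  Num.sqrt (\sum_(i < n) Normc.normc (x i 0) ^+ 2).

Definition spectral_norm (m n : nat) (M : 'M[C]_(m, n)) : R :=
  sup [set enorm (M *m x) | x in [set x : 'cV[C]_n | enorm x <= 1]].

Definition hermitian_posdef (n : nat) (A : 'M[C]_n) : Prop :=
  A \is hermsymmx /\
  forall x : 'cV[C]_n, x != 0 -> 0 < (x ^t* *m A *m x) 0 0.

Definition spectrum_in (n : nat) (A : 'M[C]_n) (a b : R) : Prop :=
  forall z : C, eigenvalue A z -> a%:C <= z <= b%:C.

(* [f(A)] for [A] Hermitian, by unitary diagonalization; the eigenvalues are
   real, so that taking their real part loses nothing. *)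
Definition mxfun (f : R -> R) (n : nat) (A : 'M[C]_n) : 'M[C]_n :=
  invmx (spectralmx A)
  *m diag_mx (map_mx (fun z : C => (f (complex.Re z))%:C) (spectral_diag A))
  *m spectralmx A.

Definition kron_diff (p q : nat) (A : 'M[C]_p) (B : 'M[C]_q) : 'M[C]_(q * p) :=
  1%:M *t A - B^T *t 1%:M.

(* [None] is the pole at infinity. *)
Definition rk_den (n : nat) (M : 'M[C]_n) (Psi : seq (option C)) : 'M[C]_n :=
  \prod_(psi <- pmap id Psi) (M - psi%:M).

(* The columns spanning the space are transposed, so that it is represented,
   as usual in [mxalgebra], by the row space of a matrix. *)
Definition rat_krylov (n k : nat) (M : 'M[C]_n) (w : 'M[C]_(n, k))
    (Psi : seq (option C)) : 'M[C]_n :=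
  (\sum_(j < (size Psi).+1) <<(invmx (rk_den M Psi) *m M ^+ j *m w)^T>>)%MS.

(* The columns of [U] are an orthonormal basis of the space represented by the
   row space of [S]. *)
Definition orthonormal_basis (n p : nat) (U : 'M[C]_(n, p)) (S : 'M[C]_n) :
    Prop :=
  U ^t* *m U = 1%:M /\ (U^T == S)%MS.

Definition real_poles (s : seq R) : seq (option C) := [seq Some x%:C | x <- s].

Definition tensor_projection (f : R -> R) (n k p q : nat) (A B : 'M[C]_n)
    (UF VF : 'M[C]_(n, k)) (U : 'M[C]_(n, p)) (V : 'M[C]_(n, q)) : 'M[C]_n :=
  let Al := U ^t* *m A *m U in
  let Bl := V ^t* *m B *m V in
  let Y : 'M[C]_(p, q) :=
    unvec (mxfun f (kron_diff Al Bl) *m vec (U ^t* *m UF *m (VF^T *m V))) in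
  U *m Y *m V ^t*.

(* [|g(x) / d(x)|] for coprime [g] and [d], infinite at the poles. *)
Definition abs_ratfun (g d : {poly C}) (x : R) : \bar R :=
  if d.[x%:C] == 0 then +oo%E else (Normc.normc (g.[x%:C] / d.[x%:C]))%:E.

Definition zolotarev_ratio (a b : R) (g d : {poly C}) : \bar R :=
  mule (ereal_sup [set abs_ratfun g d x | x in `[a, b]])
       (inve (ereal_inf [set abs_ratfun g d x | x in `[- b, - a]])).

(* Rational functions are written in lowest terms; the zero function is
   excluded, its ratio being [0 / 0]. *)
Definition zolotarev_poles (a b : R) (l : nat) (psi : l.-tuple R) : Prop :=
  {in psi, forall x, - b <= x <= - a} /\
  forall g d : {poly C},
    (size g <= l.+1)%N -> (size d <= l.+1)%N ->
    g != 0 -> d != 0 -> coprimep g d ->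
    (zolotarev_ratio a b (\prod_(x <- psi) ('X + (x%:C)%:P))
                         (\prod_(x <- psi) (- 'X + (x%:C)%:P))
     <= zolotarev_ratio a b g d)%E.

(* Only the restriction of [f] to the positive reals is relevant. *)
Definition laplace_stieltjes (f : R -> R) : Prop :=
  exists mu : {measure set (measurableTypeR R) -> \bar R},
    forall z : R, 0 < z ->
      (f z)%:E = (\int[mu]_(t in `[0%R, +oo[) (expR (- t * z))%:E)%E.

(* The limit is taken in the extended reals as it may be infinite. *)
Definition lim_at0 (f : R -> R) : \bar R := lim ((f z)%:E @[z --> 0^'+]).

Definition rho (a b : R) : R := expR (- (pi ^+ 2 / ln (4 * b / a))).

Definition gamma (l : nat) (kappa : R) : R :=
  223 / 100 + 2 / pi * ln (4 * l%:R * Num.sqrt (kappa / pi)).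

End ComplexMatrices.

(* Main.v *)
(* Write [X(f)] and [X_l(f)] for [X] and [X_l] as functions of [f]. For fixed [x]
   and [v], Re <v, (X(f) - X_l(f)) x> is a real combination of values of [f] at
   points above [a] whose coefficients do not depend on [f], so the
   Laplace-Stieltjes representation reduces the claim to a bound for
   [f = exp (- t z)] that is uniform in [t >= 0] up to the factor [exp (- t a)].
   In that case [X = exp (- t A) F exp (t B)]; since the projections are exact on
   rational functions [N / \prod_j (z - psi_j)], the error is controlled by the
   distance on [[a, b]] of [exp (- t z)] to such functions.

   Interpolating [exp (- t z)] at the points [- psi_j], the remainder is
   [r(z) E(z, t)], where [r(z) = \prod_j (z + psi_j) / (z - psi_j)] and [E] is the
   response of a cascade of all-pass filters to the input [exp (- t z)].
   An energy estimate gives [E = O(1 + log (l ^ 2 b / a))].  By optimality, [|r|]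
   is at most the value reached with the poles [- c / D(v_j)], where [D] is a
   quotient of two theta functions, [v_j = (j + 1/2) h] and
   [h = log (4 b / a) / l]; the addition formula for theta functions and the
   Jacobi triple product turn it into a product of hyperbolic tangents, which is
   estimated through [\sum_k 1 / (2 k + 1) ^ 2 = pi ^ 2 / 8]. *)

Require Import Defs.
From mathcomp Require Import all_boot all_order all_algebra.
From mathcomp Require Import spectral sesquilinear.
From mathcomp Require Import all_classical all_reals all_analysis.
From mathcomp.real_closed Require Import complex mxtens.
From mathcomp Require Import measurable_realfun.
From mathcomp Require Import ring lra zify.
Import Order.TTheory GRing.Theory Num.Theory.
Import numFieldNormedType.Exports.
Set Implicit Arguments.
Unset Strict Implicit.
Unset Printing Implicit Defensive.
Local Open Scope classical_set_scope.
Local Open Scope ring_scope.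
Local Open Scope sesquilinear_scope.
Local Open Scope complex_scope.

(** Since [r (- x) = 1 / r x], the Zolotarev ratio of a symmetric [r] is the square of its maximum
    on [[a, b]], so a pointwise bound for one competitor passes to the optimal poles. After the
    substitution [x = c * D u], a factor of [r] depends only on [D u * D v_j]. As the [v_j] have
    step [h = L / l] with [L = log (4 b / a)], the infinite products of all factors merge into one
    grid of step [h].

    The energy of the derivative stays controlled only for a signal that vanishes at [0], which
    [exp (- z t)] does not. Hence the inputs at [z] and [16 z] are compared, in a chain going up to
    [z >= l ^ 2 b], where the filters hardly alter the input; the number of links produces the
    logarithm.

    Budget: the tangents lose a factor [exp 0.92 <= 2.6] provided [h < 2.39], the filters are
    bounded by [3.29 + 0.47 * ln (l ^ 2 b / a)], and the product of the two is at most [4 * gamma].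
    For larger [h] one has [4 * gamma * rho ^ (l / 2) >= 1] and the approximant [0] suffices. The
    projection contributes the other factor [4]: two sides, each with an exact and a compressed
    matrix function. *)

(** * Theta functions *)

(* Sums of non-negative families, as real numbers (junk value [0] when the sum
   diverges). *)
Definition ssum {R : realType} {T : choiceType} (P : set T) (f : T -> R) : R :=
  fine (\esum_(i in P) (f i)%:E).

Definition ssummable {R : realType} {T : choiceType} (f : T -> R) : Prop :=
  (forall i, 0 <= f i) /\ (\esum_(i in setT) (f i)%:E < +oo)%E.

Section NonNegativeSums.
Variable R : realType.
Implicit Types T : choiceType.

Lemma esum_subset T (P Q : set T) (a : T -> \bar R) :
  (forall i, 0 <= a i)%E -> P `<=` Q ->
  (\esum_(i in P) a i <= \esum_(i in Q) a i)%E.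
Proof.
move=> a0 PQ; rewrite (esumID P Q)// setIidr// leeDl//.
by apply: esum_ge0 => i _.
Qed.

Lemma ssumE T (P : set T) (f : T -> R) :
  ssummable f -> (ssum P f)%:E = \esum_(i in P) (f i)%:E.
Proof.
move=> [f0 foo]; rewrite /ssum fineK// fin_real//.
rewrite (lt_le_trans (ltNyr 0)) ?esum_ge0// => [|i _]; last by rewrite lee_fin.
by rewrite (le_lt_trans _ foo)// esum_subset// => i; rewrite lee_fin.
Qed.

Lemma ssum_ge0 T (P : set T) (f : T -> R) :
  (forall i, 0 <= f i) -> 0 <= ssum P f.
Proof. by move=> f0; rewrite fine_ge0// esum_ge0// => i _; rewrite lee_fin. Qed.

Lemma eq_ssum T (P : set T) (f g : T -> R) :
  (forall i, P i -> f i = g i) -> ssum P f = ssum P g.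
Proof. by move=> fg; rewrite /ssum (eq_esum (b := EFin \o g))// => i /fg ->. Qed.

Lemma le_ssummable T (f g : T -> R) :
  (forall i, 0 <= f i <= g i) -> ssummable g -> ssummable f.
Proof.
move=> fg [g0 goo]; split=> [i|]; first by case/andP: (fg i).
rewrite (le_lt_trans _ goo)// le_esum// => i _.
by rewrite lee_fin; case/andP: (fg i).
Qed.

Lemma le_ssum T (P : set T) (f g : T -> R) :
  ssummable f -> ssummable g -> (forall i, P i -> f i <= g i) ->
  ssum P f <= ssum P g.
Proof.
move=> fs gs fg; rewrite -lee_fin !ssumE// le_esum// => i /fg.
Qed.

Lemma ssummableD T (f g : T -> R) :
  ssummable f -> ssummable g -> ssummable (fun i => f i + g i).
Proof.
move=> [f0 foo] [g0 goo]; split=> [i|]; first by rewrite addr_ge0.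
rewrite (eq_esum (b := fun i => (f i)%:E + (g i)%:E)%E)//.
by rewrite esumD ?lte_add_pinfty// => i _; rewrite lee_fin.
Qed.

Lemma ssumD T (P : set T) (f g : T -> R) : ssummable f -> ssummable g ->
  ssum P (fun i => f i + g i) = ssum P f + ssum P g.
Proof.
move=> fs gs; apply: EFin_inj; rewrite EFinD !ssumE//; last exact: ssummableD.
by case: fs gs => f0 _ [g0 _]; rewrite -esumD// => i _; rewrite lee_fin.
Qed.

(** One inequality, proved for every positive factor, also gives the other when applied to the
    inverse factor. *)
Lemma esumZ T (P : set T) (a : T -> \bar R) (c : R) : 0 <= c ->
  (forall i, 0 <= a i)%E ->
  (\esum_(i in P) (c%:E * a i) = c%:E * \esum_(i in P) a i)%E.
Proof.
rewrite le_eqVlt => /orP[/eqP <-|].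
  by rewrite mul0e esum1// => i _; rewrite mul0e.
have le d (b : T -> \bar R) : 0 < d -> (forall i, 0 <= b i)%E ->
    (\esum_(i in P) (d%:E * b i) <= d%:E * \esum_(i in P) b i)%E.
  move=> d0 b0; apply: ge_ereal_sup => _ [X [finX XP] <-].
  rewrite -ge0_mule_fsumr// lee_wpmul2l ?lee_fin ?(ltW d0)//.
  by apply: esum_ge; exists X.
move=> c0 a0; apply/eqP; rewrite eq_le le//=.
rewrite -(@lee_pmul2l _ c^-1%:E) ?lte_fin ?invr_gt0//.
rewrite muleA -EFinM mulVf ?gt_eqF// mul1e.
rewrite (le_trans _ (le _ _ _ _)) ?invr_gt0//.
  rewrite le_eqVlt; apply/orP; left; apply/eqP/eq_esum => i _.
  by rewrite muleA -EFinM mulVf ?gt_eqF// mul1e.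
by move=> i; rewrite mule_ge0// lee_fin ltW.
Qed.

Lemma ssummableZ T (f : T -> R) (c : R) :
  0 <= c -> ssummable f -> ssummable (fun i => c * f i).
Proof.
move=> c0 [f0 foo]; split=> [i|]; first by rewrite mulr_ge0.
rewrite (eq_esum (b := fun i => c%:E * (f i)%:E)%E)// esumZ//.
have -> : \esum_(i in [set: T]) (f i)%:E = (ssum setT f)%:E by rewrite ssumE.
by rewrite -EFinM ltry.
Qed.

Lemma ssumZ T (P : set T) (f : T -> R) (c : R) : 0 <= c -> ssummable f ->
  ssum P (fun i => c * f i) = c * ssum P f.
Proof.
move=> c0 fs; apply: EFin_inj; rewrite EFinM !ssumE//; last exact: ssummableZ.
by rewrite -esumZ// => i; rewrite lee_fin; case: fs.
Qed.

Lemma ssum_setU T (P Q : set T) (f : T -> R) :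
  ssummable f -> P `&` Q = set0 -> ssum (P `|` Q) f = ssum P f + ssum Q f.
Proof.
move=> fs PQ0; apply: EFin_inj; rewrite EFinD !ssumE//.
rewrite (esumID P) => [|i _]; last by rewrite lee_fin; case: fs.
have -> : (P `|` Q) `&` P = P by rewrite setIidr//; left.
have -> // : (P `|` Q) `&` ~` P = Q; rewrite setIUl setICr set0U.
apply/seteqP; split=> [i []//|i Qi]; split=> // Pi.
by have : (P `&` Q) i by []; rewrite PQ0.
Qed.

Lemma reindex_ssum (T T' : choiceType) (P : set T) (Q : set T') (e : T -> T')
  (f : T' -> R) : set_bij P Q e -> ssum Q f = ssum P (f \o e).
Proof. by move=> e_bij; rewrite /ssum (reindex_esum P Q e). Qed.

Lemma ssumM (T T' : choiceType) (P : set T) (Q : set T') (f : T -> R)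
    (g : T' -> R) : ssummable f -> ssummable g ->
  ssum P f * ssum Q g = ssum (P `*` Q) (fun k => f k.1 * g k.2).
Proof.
move=> fs gs; have [[f0 _] [g0 _]] := (fs, gs).
rewrite /ssum -(@esum_esum _ _ _ P (fun=> Q) (fun i j => (f i * g j)%:E)).
  rewrite [X in _ = fine X](eq_esum
    (b := fun i => (ssum Q g)%:E * (f i)%:E)%E) => [|i _].
    rewrite esumZ//; last exact: ssum_ge0.
    by rewrite -!ssumE// -EFinM/= mulrC.
  by rewrite muleC ssumE// -esumZ.
by move=> i j _ _; rewrite lee_fin mulr_ge0.
Qed.

Lemma ssummableM (T T' : choiceType) (f : T -> R) (g : T' -> R) :
  ssummable f -> ssummable g -> ssummable (fun k : T * T' => f k.1 * g k.2).
Proof.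
move=> fs gs; have [[f0 _] [g0 _]] := (fs, gs).
split=> [k|]; first by rewrite mulr_ge0.
rewrite -setXTT -(@esum_esum _ _ _ _ (fun=> setT) (fun i j => (f i * g j)%:E)).
  rewrite (eq_esum (b := fun i => (ssum setT g)%:E * (f i)%:E)%E) => [|i _].
    rewrite esumZ//; last exact: ssum_ge0.
    by rewrite -(ssumE setT fs) -EFinM ltry.
  by rewrite muleC ssumE// -esumZ.
by move=> i j _ _; rewrite lee_fin mulr_ge0.
Qed.

Lemma ssum_gt0 T (P : set T) (f : T -> R) i :
  ssummable f -> P i -> 0 < f i -> 0 < ssum P f.
Proof.
move=> fs Pi fi; rewrite -lte_fin ssumE//.
apply: (@lt_le_trans _ _ (f i)%:E); first by rewrite lte_fin.
apply: esum_ge; exists [set i]; last by rewrite fsbig_set1.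
by split=> [|j ->//]; exact: finite_set1.
Qed.

End NonNegativeSums.

(** * Theta series and their product formulas *)

Definition theta_term {R : realType} (L u : R) (n : int) : R :=
  expR (- L * n%:~R ^+ 2 + n%:~R * u).

Definition even_int : set int := [set n | exists i, n = i * 2].
Definition odd_int : set int := [set n | exists i, n = i * 2 + 1].

(** The sum of [theta_even] and [theta_odd] is a Jacobi theta function at an imaginary argument;
    their difference is its alternating version. *)
Definition theta_even {R : realType} (L u : R) := ssum even_int (theta_term L u).
Definition theta_odd {R : realType} (L u : R) := ssum odd_int (theta_term L u).

(* [\sum_i exp (- 2 L i ^ 2 + 2 i u)], over the integers and over the
   half-integers [i]. *)
Definition theta_int {R : realType} (L u : R) :=
  ssum setT (theta_term (2 * L) (2 * u)).
Definition theta_half {R : realType} (L u : R) :=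
  expR (u - L / 2) * ssum setT (theta_term (2 * L) (2 * u - 2 * L)).

Section Theta.
Variable R : realType.
Implicit Types L u v : R.

Lemma even_odd_int_set0 : even_int `&` odd_int = set0.
Proof. by apply/seteqP; split=> // n [[i ->] [j]]; lia. Qed.

Lemma ssummable_geometric :
  ssummable (fun n : int => expR (- (absz n)%:R) : R).
Proof.
split=> [n|]; first exact: expR_ge0.
pose r : R := expR (- 1).
have r1 : 0 < r < 1 by rewrite expR_gt0 expR_lt1 oppr_lt0 ltr01.
have nat_sum (e : nat -> int) (k : nat) : injective e ->
    (forall n, absz (e n) = (n + k)%N) ->
    (\esum_(i in e @` setT) (expR (- (absz i)%:R) : R)%:E < +oo)%E.
  move=> e_inj eE; rewrite esum_image; last by move=> ? ? _ _ /e_inj.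
  rewrite -nneseries_esumT => [|n]; last by rewrite lee_fin expR_ge0.
  apply: le_lt_trans (ltry (1 - r)^-1).
  apply: lime_le; first by apply: is_cvg_nneseries => n _ _; rewrite lee_fin expR_ge0.
  apply: nearW => n; rewrite sumEFin lee_fin.
  apply: (@le_trans _ _ (\sum_(0 <= i < n) r ^+ i)).
    apply: ler_sum => i _; rewrite eE -expRM_natl ler_expR mulrN1 lerN2.
    by rewrite ler_nat leq_addr.
  have h1 : 0 < 1 - r by rewrite subr_gt0; case/andP: r1.
  rewrite -(ler_pM2l h1) divff ?gt_eqF// big_mkord -[1 - r]opprB mulNr -subrX1.
  by rewrite opprB gerBl exprn_ge0// ltW//; case/andP: r1.
have -> : [set: int] = (Posz @` setT) `|` (Negz @` setT).
  by apply/seteqP; split=> // -[] n _; [left|right]; exists n.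
rewrite (esumID (Posz @` setT)) => [|i _]; last by rewrite lee_fin expR_ge0.
apply: lte_add_pinfty; apply: le_lt_trans (esum_subset _ _) _.
- by move=> i; rewrite lee_fin expR_ge0.
- exact: subIsetr.
- by apply: (nat_sum _ 0%N) => [? ? []//|n]; rewrite addn0.
- by move=> i; rewrite lee_fin expR_ge0.
- move=> i [] [] hi nhi; [by case: nhi|exact: hi].
- by apply: (nat_sum _ 1%N) => [? ? []//|n]; rewrite addn1.
Qed.

(** Completing the square: [K] is the maximum of [(|u| + 1) * y - L * y ^ 2], so the exponent is at
    most [K - |n|]. *)
Lemma ssummable_theta L u : 0 < L -> ssummable (theta_term L u).
Proof.
move=> L0; pose K := (`|u| + 1) ^+ 2 / (4 * L).
apply: (@le_ssummable _ _ _ (fun n : int => expR K * expR (- (absz n)%:R))).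
  move=> n; rewrite expR_ge0 -expRD ler_expR.
  have -> : (absz n)%:R = `|n%:~R| :> R by rewrite natr_absz intr_norm.
  set x : R := n%:~R.
  have h1 : x * u <= `|x| * `|u| by rewrite -normrM ler_norm.
  have h2 : x ^+ 2 = `|x| ^+ 2 by rewrite real_normK ?num_real.
  rewrite h2; set y := `|x| in h1 *.
  have -> : K = y * (`|u| + 1) - L * y ^+ 2 + L * (y - (`|u| + 1) / (2 * L)) ^+ 2.
    by rewrite /K; field; rewrite gt_eqF.
  have : 0 <= L * (y - (`|u| + 1) / (2 * L)) ^+ 2.
    by rewrite mulr_ge0 ?sqr_ge0// ltW.
  nra.
by apply: ssummableZ; [exact: expR_ge0|exact: ssummable_geometric].
Qed.

Lemma theta_term_gt0 L u n : 0 < theta_term L u n.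
Proof. exact: expR_gt0. Qed.

Lemma even_pairs :
  set_bij setT ((even_int `*` even_int) `|` (odd_int `*` odd_int))
    (fun k : int * int => (k.1 + k.2, k.1 - k.2)).
Proof.
split=> [[i j] _ /=||[n m] /= h].
- have [e|e] : (i - j = ((i - j) %/ 2)%Z * 2
            \/ i - j = ((i - j) %/ 2)%Z * 2 + 1) by lia.
  + by left; split; [exists (((i - j) %/ 2)%Z + j); lia|exists ((i - j) %/ 2)%Z].
  + by right; split; [exists (((i - j) %/ 2)%Z + j); lia|exists ((i - j) %/ 2)%Z].
- by move=> [i j] [i' j'] _ _ [e1 e2]; congr pair; lia.
- case: h => -[[i /= ->] [j /= ->]].
  + by exists (i + j, i - j) => //=; congr pair; lia.
  + by exists (i + j + 1, i - j) => //=; congr pair; lia.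
Qed.

Lemma odd_pairs :
  set_bij setT ((even_int `*` odd_int) `|` (odd_int `*` even_int))
    (fun k : int * int => (k.1 + k.2 + 1, k.1 - k.2)).
Proof.
split=> [[i j] _ /=||[n m] /= h].
- have [e|e] : (i - j = ((i - j) %/ 2)%Z * 2
            \/ i - j = ((i - j) %/ 2)%Z * 2 + 1) by lia.
  + by right; split; [exists (((i - j) %/ 2)%Z + j); lia|exists ((i - j) %/ 2)%Z].
  + by left; split; [exists (((i - j) %/ 2)%Z + j + 1); lia|exists ((i - j) %/ 2)%Z].
- by move=> [i j] [i' j'] _ _ [e1 e2]; congr pair; lia.
- case: h => -[[i /= ->] [j /= ->]].
  + by exists (i + j, i - j - 1) => //=; congr pair; lia.
  + by exists (i + j, i - j) => //=; congr pair; lia.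
Qed.

Let pair_set0 (A B C D : set int) :
  A `&` C = set0 -> (A `*` B) `&` (C `*` D) = set0.
Proof.
move=> AC; apply/seteqP; split=> // -[n m] [[/= An _] [/= Cn _]].
by have : (A `&` C) n by []; rewrite AC.
Qed.

(** With [n = i + j] and [m = i - j], the forms [n ^ 2 + m ^ 2 = 2 (i ^ 2 + j ^ 2)] and
    [n (u + v) + m (u - v) = 2 i u + 2 j v] both separate. Pairs [(n, m)] of equal parity come from
    integers [i, j]. *)
Lemma theta_mul_even L u v : 0 < L ->
  theta_even L (u + v) * theta_even L (u - v)
  + theta_odd L (u + v) * theta_odd L (u - v) = theta_int L u * theta_int L v.
Proof.
move=> L0; have s w := ssummable_theta w L0.
have L2 : 0 < 2 * L by rewrite mulr_gt0.
rewrite /theta_even /theta_odd /theta_int !ssumM//;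
  try exact: ssummable_theta.
rewrite -ssum_setU.
- rewrite (reindex_ssum _ even_pairs) setXTT; apply: eq_ssum => -[i j] _ /=.
  by rewrite /theta_term -!expRD; congr expR; rewrite rmorphD rmorphB/=; ring.
- exact: ssummableM.
- exact/pair_set0/even_odd_int_set0.
Qed.

(** The same rotation of the lattice; pairs of opposite parity come from half-integers [i, j],
    whence [theta_half]. *)
Lemma theta_mul_odd L u v : 0 < L ->
  theta_even L (u + v) * theta_odd L (u - v)
  + theta_odd L (u + v) * theta_even L (u - v) = theta_half L u * theta_half L v.
Proof.
move=> L0; have s w := ssummable_theta w L0.
have L2 : 0 < 2 * L by rewrite mulr_gt0.
rewrite /theta_even /theta_odd /theta_half [RHS]mulrACA !ssumM//;
  try exact: ssummable_theta.
rewrite -ssum_setU.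
- rewrite (reindex_ssum _ odd_pairs).
  rewrite -ssumZ; [|by rewrite mulr_ge0 ?expR_ge0|].
  + rewrite setXTT; apply: eq_ssum => -[i j] _ /=.
    rewrite /theta_term -!expRD; congr expR.
    by rewrite !rmorphD rmorphN/= rmorph1; field.
  + by apply: ssummableM; exact: ssummable_theta.
- exact: ssummableM.
- exact/pair_set0/even_odd_int_set0.
Qed.

End Theta.

(** * A finite form of the Jacobi triple product and its limit *)

Definition q_exp {R : realType} (L : R) (m : int) : R := expR (- 2 * L * m%:~R).

Definition q_poch {R : realType} (L : R) (n : nat) : R :=
  \prod_(i < n) (1 - q_exp L (Posz i.+1)).

(** The value [0] at negative integers makes [inv_q_poch_pred] hold for all integers, so that
    identities between binomial ratios need no condition on [j]. *)
Definition inv_q_poch {R : realType} (L : R) (m : int) : R :=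
  if m is Posz n then (q_poch L n)^-1 else 0.

(* The Gaussian binomial coefficient [2N, N + j] in base [q = exp (- 2 L)],
   divided by the central one [2N, N]. *)
Definition q_binom_ratio {R : realType} (L : R) (N : nat) (j : int) : R :=
  q_poch L N ^+ 2 * inv_q_poch L (Posz N - j) * inv_q_poch L (Posz N + j).

Definition jacobi_prod {R : realType} (L sg u : R) (N : nat) : R :=
  \prod_(k < N) ((1 + sg * expR (u - (2 * k%:R + 1) * L))
                 * (1 + sg * expR (- u - (2 * k%:R + 1) * L))).

Section TripleProduct.
Variables (R : realType) (L : R).
Hypothesis L_gt0 : 0 < L.
Implicit Types u v : R.

Lemma q_expD m n : q_exp L (m + n) = q_exp L m * q_exp L n.
Proof. by rewrite /q_exp -expRD rmorphD/= mulrDr. Qed.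

Lemma q_exp0 : q_exp L 0 = 1.
Proof. by rewrite /q_exp mulr0 expR0. Qed.

Lemma q_exp_gt0 m : 0 < q_exp L m. Proof. exact: expR_gt0. Qed.

Lemma q_exp_le m n : m <= n -> q_exp L n <= q_exp L m.
Proof.
by move=> mn; rewrite ler_expR ler_wnM2l ?ler_int// mulNr oppr_le0 mulr_ge0// ltW.
Qed.

Lemma q_exp_lt1 m : 0 < m -> q_exp L m < 1.
Proof.
move=> m0; rewrite expR_lt1 -mulrA mulNr oppr_lt0 mulr_gt0// mulr_gt0//.
by rewrite ltr0z.
Qed.

Lemma q_poch_gt0 n : 0 < q_poch L n.
Proof. by apply: prodr_gt0 => i _; rewrite subr_gt0 q_exp_lt1. Qed.

Lemma q_pochS n : q_poch L n.+1 = q_poch L n * (1 - q_exp L (Posz n.+1)).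
Proof. by rewrite /q_poch big_ord_recr. Qed.

Lemma inv_q_poch_pred m :
  inv_q_poch L (m - 1) = (1 - q_exp L m) * inv_q_poch L m.
Proof.
case: m => [[|n]|n].
- by rewrite sub0r/= q_exp0 subrr mul0r.
- have -> : Posz n.+1 - 1 = Posz n by lia.
  rewrite /= q_pochS invfM mulrCA divff ?mulr1//.
  by rewrite gt_eqF// subr_gt0 q_exp_lt1.
- have -> : Negz n - 1 = Negz n.+1 by lia.
  by rewrite /= mulr0.
Qed.

Lemma q_binom_ratioN N j : q_binom_ratio L N (- j) = q_binom_ratio L N j.
Proof. by rewrite /q_binom_ratio opprK mulrAC. Qed.

Lemma q_binom_ratioS N j :
  (1 - q_exp L (Posz N + j + 1)) * q_binom_ratio L N (j + 1)
  = (1 - q_exp L (Posz N - j)) * q_binom_ratio L N j.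
Proof.
rewrite /q_binom_ratio.
have -> : Posz N - (j + 1) = Posz N - j - 1 by lia.
rewrite inv_q_poch_pred.
have -> : Posz N + (j + 1) = Posz N + j + 1 by lia.
have -> : inv_q_poch L (Posz N + j) =
  (1 - q_exp L (Posz N + j + 1)) * inv_q_poch L (Posz N + j + 1).
  by rewrite -inv_q_poch_pred addrK.
by ring.
Qed.

Lemma inv_q_poch_ge0 m : 0 <= inv_q_poch L m.
Proof. by case: m => //= n; rewrite invr_ge0 ltW// q_poch_gt0. Qed.

Lemma q_binom_ratio_ge0 N j : 0 <= q_binom_ratio L N j.
Proof.
have h := inv_q_poch_ge0.
by apply: mulr_ge0 (h _); apply: mulr_ge0 (h _); exact: sqr_ge0.
Qed.

(** Passing from [j] to [j + 1] multiplies the ratio by [(1 - q ^ (N - j)) / (1 - q ^ (N + j + 1))],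
    which lies between [1 - q ^ (N - j)] and [1]; the successive losses add up to at most a
    geometric series. *)
Lemma q_binom_ratio_bound N j :
  1 - q_exp L (Posz N - Posz (absz j) + 1) / (1 - q_exp L 1)
  <= q_binom_ratio L N j <= 1.
Proof.
wlog [n ->] : j / exists n, j = Posz n.
  move=> h; case: j => n; first by apply: h; exists n.
  by have := h (- Negz n); rewrite q_binom_ratioN abszN; apply; exists n.+1.
have q1 : 0 < 1 - q_exp L 1 by rewrite subr_gt0 q_exp_lt1.
rewrite absz_nat; elim: n => [|n /andP[ih1 ih2]].
  have -> : Posz N - Posz 0 = Posz N by lia.
  rewrite /q_binom_ratio (_ : Posz N + Posz 0 = Posz N); last by lia.
  have -> : q_poch L N ^+ 2 * inv_q_poch L N * inv_q_poch L N = 1.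
    by rewrite /=; field; rewrite gt_eqF ?q_poch_gt0.
  rewrite lexx andbT gerBl.
  by rewrite divr_ge0 ?ltW// q_exp_gt0.
have -> : Posz N - Posz n.+1 + 1 = Posz N - Posz n by lia.
(* Beyond [N] the ratio is [0], and the lower bound is not positive because the exponent of [q] in
   it is at most [0]. *)
have [Nn|nN] := leqP N n.
  have -> : q_binom_ratio L N (Posz n.+1) = 0.
    rewrite /q_binom_ratio (_ : Posz N - _ = Negz (n - N)); last by lia.
    by rewrite /= mulr0 mul0r.
  rewrite ler01 andbT subr_le0 ler_pdivlMr// mul1r.
  apply: (@le_trans _ _ 1); first by rewrite gerBl ltW// q_exp_gt0.
  by rewrite -q_exp0 q_exp_le//; lia.
have := q_binom_ratioS N (Posz n).
have -> : Posz n + 1 = Posz n.+1 by lia.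
have w0 := q_binom_ratio_ge0 N (Posz n).
have w'0 := q_binom_ratio_ge0 N (Posz n.+1).
set w := q_binom_ratio L N (Posz n) in w0 ih1 ih2 *.
set w' := q_binom_ratio L N _ in w'0 *.
have xy : q_exp L (Posz N + Posz n + 1) <= q_exp L (Posz N - Posz n).
  by apply: q_exp_le; lia.
have x1 : q_exp L (Posz N - Posz n) < 1 by apply: q_exp_lt1; lia.
have x0 := q_exp_gt0 (Posz N - Posz n).
have y0 := q_exp_gt0 (Posz N + Posz n + 1).
move: ih1; rewrite q_expD.
set x := q_exp L (Posz N - Posz n) in xy x1 x0 *.
set y := q_exp L _ in xy y0 *.
set q := q_exp L 1 in q1 *.
have -> : x / (1 - q) = x * q / (1 - q) + x by field; rewrite gt_eqF.
move=> ih1 e; apply/andP; split.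
  have : (1 - x) * w <= w' by rewrite -e; nra.
  by nra.
have : (1 - y) * w' <= (1 - y) * 1 by rewrite e; nra.
by rewrite ler_pM2l//; lra.
Qed.

Definition theta_trunc (P : set int) u N : R :=
  ssum P (fun j => q_binom_ratio L N j * theta_term L u j).

Lemma ssummable_theta_trunc u N :
  ssummable (fun j => q_binom_ratio L N j * theta_term L u j).
Proof.
apply: le_ssummable (ssummable_theta u L_gt0) => j.
have /andP[_ h] := q_binom_ratio_bound N j.
rewrite mulr_ge0 ?q_binom_ratio_ge0 ?expR_ge0//=.
by rewrite ler_piMl// expR_ge0.
Qed.

(** The deficit of a term carries the growing factor [q ^ (- |j|) = exp (2 L |j|)]. It is absorbed
    by moving [u] to [u + 2 L] or [u - 2 L], where the theta series still converges; what remains is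
    [O(q ^ N)]. *)
Lemma theta_trunc_cvg P u :
  theta_trunc P u N @[N --> \oo] --> ssum P (theta_term L u).
Proof.
pose S := ssum P (theta_term L (u + 2 * L)) + ssum P (theta_term L (u - 2 * L)).
pose C := S / (1 - q_exp L 1).
have q1 : 0 < 1 - q_exp L 1 by rewrite subr_gt0 q_exp_lt1.
have bnd N : ssum P (theta_term L u) - C * q_exp L (Posz N + 1)
    <= theta_trunc P u N <= ssum P (theta_term L u).
  have s1 := ssummable_theta_trunc u N.
  have s0 v := ssummable_theta v L_gt0.
  have qC : 0 <= q_exp L (Posz N + 1) / (1 - q_exp L 1).
    by rewrite divr_ge0 ?ltW// q_exp_gt0.
  apply/andP; split; last first.
    apply: le_ssum => // j _; rewrite ler_piMl ?expR_ge0//.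
    by case/andP: (q_binom_ratio_bound N j).
  have -> : C * q_exp L (Posz N + 1) = ssum P (fun j =>
      q_exp L (Posz N + 1) / (1 - q_exp L 1) *
      (theta_term L (u + 2 * L) j + theta_term L (u - 2 * L) j)).
    rewrite ssumZ//; last exact: ssummableD.
    by rewrite ssumD// -/S /C mulrC mulrA mulrAC.
  rewrite lerBlDr /theta_trunc.
  rewrite -ssumD//; last by apply: ssummableZ => //; exact: ssummableD.
  apply: le_ssum => //.
    by apply: ssummableD => //; apply: ssummableZ => //; exact: ssummableD.
  move=> j _; have /andP[h _] := q_binom_ratio_bound N j.
  have t0 := theta_term_gt0 L u j.
  have e1 : q_exp L (Posz N - Posz (absz j) + 1) * theta_term L u j <=
    q_exp L (Posz N + 1) *
    (theta_term L (u + 2 * L) j + theta_term L (u - 2 * L) j).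
    rewrite mulrDr /q_exp /theta_term -!expRD.
    have [j0|j0] := leP 0 j.
      apply: (@le_trans _ _ (expR
        (- 2 * L * (Posz N + 1)%:~R + (- L * j%:~R ^+ 2 + j%:~R * (u + 2 * L))))).
        rewrite ler_expR (_ : Posz (absz j) = j); last by lia.
        by rewrite !rmorphD rmorphN/=; lra.
      by rewrite lerDl expR_ge0.
    apply: (@le_trans _ _ (expR
        (- 2 * L * (Posz N + 1)%:~R + (- L * j%:~R ^+ 2 + j%:~R * (u - 2 * L))))).
      rewrite ler_expR (_ : Posz (absz j) = - j); last by lia.
      by rewrite !rmorphD !rmorphN/=; lra.
    by rewrite lerDr expR_ge0.
  have e2 : (1 - q_binom_ratio L N j) * theta_term L u j
     <= q_exp L (Posz N + 1) / (1 - q_exp L 1) *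
    (theta_term L (u + 2 * L) j + theta_term L (u - 2 * L) j).
    rewrite mulrAC ler_pdivlMr// mulrAC; apply: le_trans e1.
    rewrite ler_pM2r// -ler_pdivlMr//; lra.
  lra.
apply: (squeeze_cvgr (f := fun N => ssum P (theta_term L u)
                                    - C * q_exp L (Posz N + 1))
                     (h := fun=> ssum P (theta_term L u))).
- exact: nearW.
- rewrite -[X in _ --> X]subr0; apply: cvgB; first exact: cvg_cst.
  rewrite -(mulr0 C); apply: cvgM; first exact: cvg_cst.
  apply: (squeeze_cvgr (f := fun=> 0)
                       (h := fun N => (expR (- (2 * L))) ^+ N)).
  + apply: nearW => N; rewrite ltW ?q_exp_gt0//= -expRM_natl ler_expR.
    rewrite mulrN mulNr mulNr lerN2 rmorphD/= mulrDr mulrC lerDl.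
    by rewrite !mulr_ge0// ltW.
  + exact: cvg_cst.
  + apply: cvg_expr; rewrite ger0_norm ?expR_ge0// expR_lt1 oppr_lt0.
    by rewrite mulr_gt0.
- exact: cvg_cst.
Qed.

End TripleProduct.

Section TripleProductLimit.
Variables (R : realType) (L : R).
Hypothesis L_gt0 : 0 < L.
Implicit Types u v : R.

Lemma ssum_eq0 (P : set int) (f : int -> R) :
  (forall i, P i -> f i = 0) -> ssum P f = 0.
Proof. by move=> f0; rewrite /ssum esum1// => i /f0 ->. Qed.

Lemma ssum_shift (P Q : set int) (f : int -> R) (c : int) :
  (forall j, P j <-> Q (j + c)) -> ssum P (fun j => f (j + c)) = ssum Q f.
Proof.
move=> PQ; rewrite (@reindex_ssum _ _ _ P Q (fun j => j + c))//; split.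
- by move=> j /PQ.
- by move=> i j _ _ /addIr.
- by move=> j Qj; exists (j - c); rewrite ?subrK//; apply/PQ; rewrite subrK.
Qed.

Lemma even_int_shift (c : int) : c = 1 \/ c = - 1 ->
  forall j, even_int j <-> odd_int (j + c).
Proof.
case=> -> j; split=> -[i e].
- by exists i; lia.
- by exists i; lia.
- by exists (i - 1); lia.
- by exists (i + 1); lia.
Qed.

Lemma odd_int_shift (c : int) : c = 1 \/ c = - 1 ->
  forall j, odd_int j <-> even_int (j + c).
Proof.
case=> -> j; split=> -[i e].
- by exists (i + 1); lia.
- by exists (i - 1); lia.
- by exists i; lia.
- by exists i; lia.
Qed.

Let K N := q_poch L (2 * N) / q_poch L N ^+ 2.

Lemma q_poch_double N :
  q_poch L (2 * N.+1) = q_poch L (2 * N)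
    * (1 - q_exp L (Posz (2 * N).+1)) * (1 - q_exp L (Posz (2 * N).+2)).
Proof. by rewrite (_ : 2 * N.+1 = (2 * N).+2)%N ?q_pochS//; lia. Qed.

(* With [x = q ^ (N + 1 - j)] and [y = q ^ (N + 1 + j)] this is the identity
   (1 - xy/q)(1 - xy)
   = (1 + xy/q)(1 - x)(1 - y) + x (1 - y/q)(1 - y) + y (1 - x/q)(1 - x). *)
Lemma q_binom_ratio_rec N j :
  K N.+1 * q_binom_ratio L N.+1 j =
  K N * ((1 + q_exp L (Posz (2 * N).+1)) * q_binom_ratio L N j
         + q_exp L (Posz N + 1 - j) * q_binom_ratio L N (j - 1)
         + q_exp L (Posz N + 1 + j) * q_binom_ratio L N (j + 1)).
Proof.
have P0 n : q_poch L n != 0 by rewrite gt_eqF ?q_poch_gt0.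
have -> : K N.+1 * q_binom_ratio L N.+1 j = q_poch L (2 * N.+1)
    * inv_q_poch L (Posz N + 1 - j) * inv_q_poch L (Posz N + 1 + j).
  rewrite /K /q_binom_ratio (_ : Posz N.+1 = Posz N + 1); last by lia.
  by field; exact: P0.
have KE i : K N * q_binom_ratio L N i = q_poch L (2 * N)
    * inv_q_poch L (Posz N - i) * inv_q_poch L (Posz N + i).
  by rewrite /K /q_binom_ratio; field; exact: P0.
have dist (k x y z x' y' z' : R) : k * (x * x' + y * y' + z * z')
  = x * (k * x') + y * (k * y') + z * (k * z') by ring.
rewrite dist !KE q_poch_double.
have e1 : inv_q_poch L (Posz N - j)
  = (1 - q_exp L (Posz N + 1 - j)) * inv_q_poch L (Posz N + 1 - j).
  by rewrite -inv_q_poch_pred//; congr inv_q_poch; lia.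
have e2 : inv_q_poch L (Posz N + j)
  = (1 - q_exp L (Posz N + 1 + j)) * inv_q_poch L (Posz N + 1 + j).
  by rewrite -inv_q_poch_pred//; congr inv_q_poch; lia.
have e3 : inv_q_poch L (Posz N - (j + 1))
  = (1 - q_exp L (Posz N - j)) * inv_q_poch L (Posz N - j).
  by rewrite -inv_q_poch_pred//; congr inv_q_poch; lia.
have e4 : inv_q_poch L (Posz N + (j - 1))
  = (1 - q_exp L (Posz N + j)) * inv_q_poch L (Posz N + j).
  by rewrite -inv_q_poch_pred//; congr inv_q_poch; lia.
rewrite e3 e4 e1 e2.
rewrite (_ : Posz N - (j - 1) = Posz N + 1 - j); last by lia.
rewrite (_ : Posz N + (j + 1) = Posz N + 1 + j); last by lia.
have q0 : q_exp L 1 != 0 by rewrite gt_eqF// q_exp_gt0.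
have -> : q_exp L (Posz N - j) = q_exp L (Posz N + 1 - j) / q_exp L 1.
  apply: (mulIf q0); rewrite divfK// -q_expD; congr q_exp; lia.
have -> : q_exp L (Posz N + j) = q_exp L (Posz N + 1 + j) / q_exp L 1.
  apply: (mulIf q0); rewrite divfK// -q_expD; congr q_exp; lia.
have -> : q_exp L (Posz (2 * N).+2)
  = q_exp L (Posz N + 1 - j) * q_exp L (Posz N + 1 + j).
  by rewrite -q_expD; congr q_exp; lia.
have -> : q_exp L (Posz (2 * N).+1)
  = q_exp L (Posz N + 1 - j) * q_exp L (Posz N + 1 + j) / q_exp L 1.
  apply: (mulIf q0); rewrite divfK// -!q_expD; congr q_exp; lia.
by field.
Qed.

(** The recursion in [N] relates [j] to [j - 1] and [j + 1], hence each parity class to the other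
    one. *)
Lemma theta_trunc_rec (P Q : set int) u N :
  (forall j, P j <-> Q (j + 1)) -> (forall j, P j <-> Q (j - 1)) ->
  K N.+1 * theta_trunc L P u N.+1 =
  K N * ((1 + expR (- (2 * N%:R + 1) * L) ^+ 2) * theta_trunc L P u N
     + expR (- (2 * N%:R + 1) * L) * (expR u + expR (- u)) * theta_trunc L Q u N).
Proof.
move=> PQ1 PQ2.
have K0 n : 0 <= K n by rewrite divr_ge0 ?sqr_ge0// ltW// q_poch_gt0.
have st := ssummable_theta_trunc L_gt0 u.
set f := fun j => q_binom_ratio L N j * theta_term L u j.
have sft (c : int) : ssummable (fun j => f (j + c)).
  split=> [j|]; first by case: (st N) => h _; exact: h.
  have [_] := st N.
  rewrite -(@reindex_esum _ _ _ setT setT (fun j => j + c) (fun j => (f j)%:E))//.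
  by split=> // [i j _ _ /addIr//|j _]; exists (j - c); rewrite ?subrK.
set t := expR _; have t0 : 0 <= t by exact: expR_ge0.
have [c0 [c1 c2]] : 0 <= K N * (1 + t ^+ 2) /\ 0 <= K N * t * expR u
    /\ 0 <= K N * t * expR (- u).
  have e0 x : 0 <= expR x :> R by exact: expR_ge0.
  have := K0 N; move: (e0 u) (e0 (- u)) (sqr_ge0 t).
  by move: (K N) (t ^+ 2) => k w h1 h2 h3 h4; rewrite !mulr_ge0// addr_ge0.
transitivity (K N * (1 + t ^+ 2) * ssum P f
    + (K N * t * expR u * ssum P (fun j => f (j - 1))
       + K N * t * expR (- u) * ssum P (fun j => f (j + 1)))); last first.
  by rewrite !(@ssum_shift P Q)// /theta_trunc -/f; ring.
have sf : ssummable f by exact: st.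
have [s1 s2] := (sft 1, sft (- 1)).
have ssZ c g : 0 <= c -> ssummable g -> ssummable (fun j : int => c * g j).
  exact: ssummableZ.
rewrite /theta_trunc -!ssumZ -?ssumD//.
- apply: eq_ssum => j _; rewrite mulrA q_binom_ratio_rec /f /theta_term.
  have -> : expR (- L * (j - 1)%:~R ^+ 2 + (j - 1)%:~R * u) = q_exp L (Posz N + 1 - j)
     * expR (- L * j%:~R ^+ 2 + j%:~R * u) / (t * expR u).
    rewrite /q_exp /t -!expRD -expRB; congr expR.
    by rewrite !rmorphD !rmorphN/= rmorph1; ring.
  have -> : expR (- L * (j + 1)%:~R ^+ 2 + (j + 1)%:~R * u) = q_exp L (Posz N + 1 + j)
     * expR (- L * j%:~R ^+ 2 + j%:~R * u) / (t * expR (- u)).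
    rewrite /q_exp /t -!expRD -expRB; congr expR.
    by rewrite !rmorphD/= rmorph1; ring.
  have -> : t ^+ 2 = q_exp L (Posz (2 * N).+1).
    rewrite /t -expRM_natl /q_exp; congr expR.
    by rewrite -pmulrn -[(2 * N).+1%:R]natr1 natrM; ring.
  have [tn un vn] : [/\ t != 0, expR u != 0 & expR (- u) != 0].
    by rewrite !gt_eqF ?expR_gt0.
  by field; rewrite tn un vn.
- exact: ssZ.
- by apply: ssummableD; exact: ssZ.
- exact: ssZ.
- exact: ssZ.
Qed.

(** With [t = exp (- (2 N + 1) L)] and [sg ^ 2 = 1], the new factor is
    [1 + t ^ 2 + sg * t * (exp u + exp (- u))], which matches [theta_trunc_rec]: the part with [sg]
    exchanges the two parities. *)
Lemma jacobi_prodE sg u N : sg = 1 \/ sg = - 1 ->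
  jacobi_prod L sg u N = K N * (theta_trunc L even_int u N
                                + sg * theta_trunc L odd_int u N).
Proof.
move=> sg1; have sg2 : sg ^+ 2 = 1 by case: sg1 => ->; rewrite ?sqrrN expr1n.
elim: N => [|N ih].
  have w0 j : j != 0 -> q_binom_ratio L 0 j = 0.
    rewrite /q_binom_ratio; case: j => [[|n]|n]// _.
      by rewrite (_ : Posz 0 - Posz n.+1 = Negz n)/= ?mulr0 ?mul0r//; lia.
    by rewrite (_ : Posz 0 + Negz n = Negz n)/= ?mulr0//; lia.
  have -> : theta_trunc L odd_int u 0 = 0.
    by apply: ssum_eq0 => j [i e]; rewrite w0 ?mul0r//; apply/eqP; lia.
  have -> : theta_trunc L even_int u 0 = 1.
    have e0 : even_int = [set 0] `|` (even_int `\ 0).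
      apply/seteqP; split=> [j Ej|j [->|[]//]]; last by exists 0.
      by have [->|/eqP] := eqVneq j 0; [left|right].
    rewrite /theta_trunc e0 ssum_setU.
    - rewrite (_ : ssum (_ `\ 0) _ = 0) ?addr0; last first.
        by apply: ssum_eq0 => j [_ /eqP j0]; rewrite w0 ?mul0r.
      rewrite /ssum esum_set1/=; last first.
        by rewrite lee_fin mulr_ge0 ?q_binom_ratio_ge0 ?expR_ge0.
      rewrite /q_binom_ratio /theta_term /q_poch/= !big_ord0 expr0n/=.
      by rewrite mulr0 mul0r addr0 expR0 /q_poch big_ord0 invr1 expr1n !mulr1.
    - exact: ssummable_theta_trunc.
    - by rewrite setDE setICA setICr setI0.
  by rewrite /jacobi_prod /K /q_poch !big_ord0; field.
rewrite /jacobi_prod big_ord_recr/= -/(jacobi_prod L sg u N) ih.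
transitivity (K N.+1 * theta_trunc L even_int u N.+1
  + sg * (K N.+1 * theta_trunc L odd_int u N.+1)); last by ring.
rewrite (@theta_trunc_rec even_int odd_int); last 2 first.
- by apply: even_int_shift; left.
- by apply: even_int_shift; right.
rewrite (@theta_trunc_rec odd_int even_int); last 2 first.
- by apply: odd_int_shift; left.
- by apply: odd_int_shift; right.
rewrite mulNr !expRD.
set t := expR (- ((2 * N%:R + 1) * L)); set x := expR u; set y := expR (- u).
set E := theta_trunc _ _ _ _; set O := theta_trunc _ _ _ _.
have xy : x * y = 1 by rewrite /x /y -expRD subrr expR0.
have -> : (1 + sg * (x * t)) * (1 + sg * (y * t)) = 1 + t ^+ 2 + sg * t * (x + y).
  transitivity (1 + sg ^+ 2 * (x * y) * t ^+ 2 + sg * t * (x + y)); first by ring.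
  by rewrite sg2 xy !mul1r.
transitivity (K N * ((1 + t ^+ 2) * E + sg ^+ 2 * (t * (x + y) * O)
  + sg * ((1 + t ^+ 2) * O + t * (x + y) * E))); last by rewrite sg2; ring.
by ring.
Qed.

Lemma theta_even_gt0 u : 0 < theta_even L u.
Proof.
apply: (@ssum_gt0 _ _ _ _ 0); [exact: ssummable_theta|by exists 0|].
exact: theta_term_gt0.
Qed.

Lemma theta_odd_gt0 u : 0 < theta_odd L u.
Proof.
apply: (@ssum_gt0 _ _ _ _ 1); [exact: ssummable_theta|by exists 0|].
exact: theta_term_gt0.
Qed.

(** The central coefficient [K N] cancels in the quotient, so its limit is never computed. *)
Lemma jacobi_quot_cvg u :
  jacobi_prod L (- 1) u N / jacobi_prod L 1 u N @[N --> \oo] -->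
  (theta_even L u - theta_odd L u) / (theta_even L u + theta_odd L u).
Proof.
have E0 := theta_even_gt0 u; have O0 := theta_odd_gt0 u.
have eE : (fun N => (theta_trunc L even_int u N - theta_trunc L odd_int u N)
      / (theta_trunc L even_int u N + theta_trunc L odd_int u N)) =
    (fun N => jacobi_prod L (- 1) u N / jacobi_prod L 1 u N).
  apply/funext => N; rewrite !jacobi_prodE; [|by left|by right].
  rewrite mul1r mulN1r -mulf_div divff ?mul1r//.
  by rewrite mulf_neq0 ?invr_neq0 ?expf_neq0// gt_eqF ?q_poch_gt0.
rewrite -eE; apply: cvgM.
  by apply: cvgB; exact: theta_trunc_cvg.
apply: cvgV; first by rewrite gt_eqF// addr_gt0.
by apply: cvgD; exact: theta_trunc_cvg.
Qed.

Definition theta_ratio u := theta_half L u / theta_int L u.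

Lemma theta_int_gt0 u : 0 < theta_int L u.
Proof.
apply: (@ssum_gt0 _ _ _ _ 0) => //; last exact: theta_term_gt0.
by apply: ssummable_theta; rewrite mulr_gt0.
Qed.

Lemma theta_half_gt0 u : 0 < theta_half L u.
Proof.
rewrite mulr_gt0 ?expR_gt0//.
apply: (@ssum_gt0 _ _ _ _ 0) => //; last exact: theta_term_gt0.
by apply: ssummable_theta; rewrite mulr_gt0.
Qed.

Lemma theta_ratio_gt0 u : 0 < theta_ratio u.
Proof. by rewrite divr_gt0 ?theta_half_gt0 ?theta_int_gt0. Qed.

(** By the two product formulas, [(e1 + o1) (e2 + o2)] and [(e1 - o1) (e2 - o2)] are [A A' + B B']
    and [A A' - B B'], in the notation of the proof. *)
Lemma theta_ratio_add u v :
  (1 - theta_ratio u * theta_ratio v) / (1 + theta_ratio u * theta_ratio v) =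
  ((theta_even L (u + v) - theta_odd L (u + v))
     / (theta_even L (u + v) + theta_odd L (u + v))) *
  ((theta_even L (u - v) - theta_odd L (u - v))
     / (theta_even L (u - v) + theta_odd L (u - v))).
Proof.
have h1 := theta_mul_even u v L_gt0; have h2 := theta_mul_odd u v L_gt0.
rewrite /theta_ratio.
have := (theta_int_gt0 u, theta_int_gt0 v, theta_half_gt0 u, theta_half_gt0 v).
have := (theta_even_gt0 (u + v), theta_even_gt0 (u - v),
         theta_odd_gt0 (u + v), theta_odd_gt0 (u - v)).
move: h1 h2; set e1 := theta_even _ _; set e2 := theta_even _ (u - v).
set o1 := theta_odd _ _; set o2 := theta_odd _ (u - v).
set A := theta_int _ u; set A' := theta_int _ v.
set B := theta_half _ u; set B' := theta_half _ v.
move=> h1 h2 [[[e10 e20] o10] o20] [[[A0 A'0] B0] B'0].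
transitivity ((A * A' - B * B') / (A * A' + B * B')).
  have [An A'n] : A != 0 /\ A' != 0 by rewrite !gt_eqF.
  have Dn : A * A' + B * B' != 0 by rewrite gt_eqF// addr_gt0// mulr_gt0.
  have -> : 1 - B / A * (B' / A') = (A * A' - B * B') / (A * A').
    by field; rewrite An A'n.
  have -> : 1 + B / A * (B' / A') = (A * A' + B * B') / (A * A').
    by field; rewrite An A'n.
  by rewrite -mulf_div divff ?mulr1 ?invr_eq0 ?mulf_neq0.
rewrite -h1 -h2 mulf_div; congr (_ / _); ring.
Qed.

(** The involution [n -> - n - 1] folds the half-integer sum into twice its part over [n >= 0],
    whose terms [exp (- 2 L n ^ 2 - 2 L n)] are at most those of [theta_int]. *)
Lemma theta_ratio0_le : theta_ratio 0 <= 2 * expR (- L / 2).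
Proof.
have L2 : 0 < 2 * L by rewrite mulr_gt0.
rewrite ler_pdivrMr ?theta_int_gt0// /theta_half.
have -> : 0 - L / 2 = - L / 2 by ring.
have -> : 2 * 0 - 2 * L = - (2 * L) by ring.
rewrite [leRHS](_ : _ = expR (- L / 2) * (2 * theta_int L 0)); last by ring.
rewrite ler_pM2l ?expR_gt0// /theta_int mulr0.
have s0 u := @ssummable_theta R (2 * L) u L2.
have shiftE : ssum [set: int] (theta_term (2 * L) (- (2 * L))) =
    ssum [set n : int | 0 <= n] (theta_term (2 * L) (- (2 * L)))
    + ssum [set n : int | 0 <= n] (theta_term (2 * L) (- (2 * L))).
  have -> : [set: int] = [set n : int | 0 <= n] `|` [set n : int | n < 0].
    by apply/seteqP; split=> // n _ /=; case: (leP 0 n); [left|right].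
  rewrite ssum_setU//; last first.
    by apply/seteqP; split=> // n [/= h1 h2]; move: h1 h2; lia.
  congr (_ + _); rewrite (@reindex_ssum _ _ _ [set n : int | 0 <= n] _
    (fun n => - n - 1)).
    apply: eq_ssum => n _; rewrite /= /theta_term; congr expR.
    by rewrite !rmorphD !rmorphN/= rmorph1; ring.
  split=> [n /=|i j _ _ /addIr /oppr_inj//|n /= n0]; first by lia.
  by exists (- n - 1) => /=; lia.
rewrite shiftE; suff h : ssum [set n : int | 0 <= n]
    (theta_term (2 * L) (- (2 * L))) <= ssum setT (theta_term (2 * L) 0).
  by rewrite [2 * ssum _ _]mulr_natl mulr2n; exact: lerD.
apply: (@le_trans _ _ (ssum [set n : int | 0 <= n] (theta_term (2 * L) 0))).
  apply: le_ssum => // n /= n0; rewrite ler_expR lerD2l mulr0 mulrN oppr_le0.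
  by rewrite mulr_ge0 ?ler0z// ltW.
rewrite -lee_fin !ssumE//; apply: esum_subset => // n.
by rewrite lee_fin expR_ge0.
Qed.

(** Up to a common type of exponential factor, translation by [L] exchanges the sums over integers
    and over half-integers. *)
Lemma theta_ratio_end : theta_ratio L = (theta_ratio 0)^-1.
Proof.
rewrite /theta_ratio invf_div /theta_half /theta_int.
have -> : ssum [set: int] (theta_term (2 * L) (2 * L)) =
  ssum [set: int] (theta_term (2 * L) (2 * 0 - 2 * L)).
  rewrite (@reindex_ssum _ _ _ setT _ (fun n => - n)); last first.
    by split=> // [i j _ _ /oppr_inj//|n _]; exists (- n); rewrite ?opprK.
  apply: eq_ssum => n _; rewrite /= /theta_term; congr expR.
  by rewrite rmorphN/=; ring.
rewrite subrr mulr0.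
have -> : L - L / 2 = - (0 - L / 2) by field.
rewrite expRN invfM; move: (expR _)^-1 (ssum _ _) (ssum _ _) => x y z.
by rewrite [RHS]mulrCA mulrA.
Qed.

End TripleProductLimit.

Section ThetaContinuity.
Variable R : realType.
Implicit Types L u v : R.

Lemma dist_expR_le (x y : R) : `|expR x - expR y| <= `|x - y| * (expR x + expR y).
Proof.
wlog xy : x y / y <= x.
  move=> h; have [/h//|/ltW /h] := leP y x.
  by move=> {}h; rewrite distrC [`|x - y|]distrC [expR x + _]addrC.
rewrite !ger0_norm ?subr_ge0 ?ler_expR//.
have h := expR_ge1Dx (y - x).
have -> : expR y = expR x * expR (y - x) by rewrite -expRD; congr expR; ring.
have e0 := expR_gt0 x.
have : 0 <= expR x * (expR (y - x) - 1 - (y - x)) by rewrite mulr_ge0 ?(ltW e0)//; lra.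
have : 0 <= (x - y) * (expR x * expR (y - x)).
  by rewrite !mulr_ge0 ?expR_ge0// subr_ge0.
lra.
Qed.

(** The series is Lipschitz near [u]: for [|u - w| <= 1], the quantity [|n| * exp (n w)] is at most
    [exp (n (u + 2))] or [exp (n (u - 2))], according to the sign of [n], which gives a summable
    bound independent of [w]. *)
Lemma continuous_theta L : 0 < L ->
  continuous (fun u => ssum setT (theta_term L u)).
Proof.
move=> L0 u.
have s0 v := ssummable_theta v L0.
pose g n := theta_term L (u + 2) n + theta_term L (u - 2) n.
have gs : ssummable g by exact: ssummableD.
pose S := ssum setT g.
have S0 : 0 <= S by apply: ssum_ge0 => n; rewrite addr_ge0 ?expR_ge0.
have lip v : `|u - v| <= 1 -> `|ssum setT (theta_term L u) - ssum setT (theta_term L v)|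
    <= `|u - v| * (2 * S).
  move=> uv1.
  have d0 : 0 <= `|u - v| * 2 by rewrite mulr_ge0.
  have term n : `|theta_term L u n - theta_term L v n| <= (`|u - v| * 2) * g n.
    have bnd w : `|u - w| <= 1 ->
        `|n%:~R| * theta_term L w n <= g n.
      move=> uw; have [n0|n0] := leP 0 (n%:~R : R).
        rewrite ger0_norm// (@le_trans _ _ (theta_term L (u + 2) n))//; last first.
          by rewrite lerDl expR_ge0.
        apply: (@le_trans _ _ (expR n%:~R * theta_term L w n)).
          rewrite ler_wpM2r ?expR_ge0//.
          by apply: le_trans (expR_ge1Dx _); rewrite lerDr.
        rewrite -expRD ler_expR; move: uw; rewrite ler_norml => /andP[h1 h2].
        by nra.
      rewrite ltr0_norm// (@le_trans _ _ (theta_term L (u - 2) n))//; last first.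
        by rewrite lerDr expR_ge0.
      apply: (@le_trans _ _ (expR (- n%:~R) * theta_term L w n)).
        rewrite ler_wpM2r ?expR_ge0//.
        by apply: le_trans (expR_ge1Dx _); rewrite lerDr.
      rewrite -expRD ler_expR; move: uw; rewrite ler_norml => /andP[h1 h2].
      by nra.
    apply: le_trans (dist_expR_le _ _) _.
    rewrite opprD addrACA subrr add0r -mulrBr normrM.
    have b1 := bnd u; have b2 := bnd v uv1.
    move: b1; rewrite subrr normr0 ler01 => /(_ isT) b1.
    rewrite -/(theta_term L u n) -/(theta_term L v n).
    have := normr_ge0 (u - v); nra.
  have ts : ssummable (fun n => (`|u - v| * 2) * g n) by exact: ssummableZ.
  have cmp w w' : (forall n, theta_term L w n <= theta_term L w' n
        + `|u - v| * 2 * g n) ->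
      ssum setT (theta_term L w) <= ssum setT (theta_term L w') + `|u - v| * 2 * S.
    move=> h; rewrite /S -ssumZ// -ssumD//.
    by apply: le_ssum => //; exact: ssummableD.
  have h1 : ssum setT (theta_term L u) <= ssum setT (theta_term L v) + `|u - v| * 2 * S.
    by apply: cmp => n; have := term n; rewrite ler_norml => /andP[]; lra.
  have h2 : ssum setT (theta_term L v) <= ssum setT (theta_term L u) + `|u - v| * 2 * S.
    by apply: cmp => n; have := term n; rewrite ler_norml => /andP[]; lra.
  by rewrite ler_norml; apply/andP; split; lra.
have cid e : 0 < e -> \forall v \near u, `|u - v| <= e.
  by move=> e0; have /cvgrPdist_le := @cvg_id _ (nbhs u); exact.
have S1 : 0 < 2 * S + 1 by lra.
apply/cvgrPdist_le => e e0; near=> v.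
have uv1 : `|u - v| <= 1.
  by near: v; exact: cid.
have uve : `|u - v| <= e / (2 * S + 1).
  by near: v; apply: cid; rewrite divr_gt0.
apply: le_trans (lip _ uv1) _.
move: uve; rewrite ler_pdivlMr// => uve; apply: le_trans uve.
by rewrite ler_wpM2l// lerDl.
Unshelve. all: by end_near.
Qed.

Lemma continuous_theta_ratio L : 0 < L -> continuous (theta_ratio L).
Proof.
move=> L0 u; have L2 : 0 < 2 * L by rewrite mulr_gt0.
have cA := continuous_theta L2.
apply: cvgM; last first.
  apply: cvgV; first by rewrite gt_eqF// theta_int_gt0.
  apply: (@continuous_comp _ _ _ (fun u => 2 * u)) (cA _).
  exact: mulrl_continuous.
apply: cvgM.
  apply: continuous_comp; last exact: continuous_expR.
  by apply: cvgB; [exact: cvg_id|exact: cvg_cst].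
apply: (@continuous_comp _ _ _ (fun u => 2 * u - 2 * L)) (cA _).
by apply: cvgB; [exact: mulrl_continuous|exact: cvg_cst].
Qed.

End ThetaContinuity.

(** * Elementary real analysis *)

Section DerivativeSigns.
Variable R : realType.
Implicit Types (f g : R -> R) (a b x : R).

Lemma is_derive_ge0_le f g a b : a <= b ->
  (forall x, a <= x <= b -> is_derive x 1 f (g x)) ->
  (forall x, a <= x <= b -> 0 <= g x) -> f a <= f b.
Proof.
move=> ab df g0.
have [x||c] := @MVT_segment R f g a b ab.
- by rewrite in_itv/= => /andP[/ltW ? /ltW ?]; apply: df; apply/andP.
- apply: derivable_within_continuous => x; rewrite in_itv/= => xab.
  by case: (df x xab).
- rewrite in_itv/= => cab e; rewrite -subr_ge0 e mulr_ge0 ?subr_ge0//.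
  exact: g0.
Qed.

Lemma is_derive_expR_scale (c x : R) :
  is_derive x 1 (fun t => expR (c * t)) (c * expR (c * x)).
Proof.
have h : is_derive x 1 (fun t => c * t) c.
  by apply: is_derive_eq; rewrite /GRing.scale/=; ring.
have := @is_derive1_comp _ expR (fun t => c * t) x _ _ (is_derive_expR _) h.
by rewrite mulrC.
Qed.

Lemma sin_ge_mul_cos x : 0 <= x <= pi -> x * cos x <= sin x.
Proof.
move=> /andP[x0 xpi]; rewrite -subr_ge0.
have := @is_derive_ge0_le (fun t => sin t - t * cos t) (fun t => t * sin t) 0 x x0.
rewrite sin0 mul0r subrr; apply.
- by move=> t _; apply: is_derive_eq; rewrite /GRing.scale/=; ring.
- move=> t /andP[t0 tx]; rewrite mulr_ge0// sin_ge0_pi// t0/=.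
  exact: le_trans xpi.
Qed.

Lemma inv_sin2_le x : 0 < x <= pi / 2 -> (sin x ^+ 2)^-1 <= (x ^+ 2)^-1 + 1.
Proof.
move=> /andP[x0 xpi].
have pi0 : 0 < pi :> R := pi_gt0 R.
have s0 : 0 < sin x by apply: sin_gt0_pi; rewrite x0/=; lra.
have c0 : 0 <= cos x by apply: cos_ge0_pihalf; apply/andP; lra.
have h : x * cos x <= sin x by apply: sin_ge_mul_cos; apply/andP; lra.
have h2 : x ^+ 2 * cos x ^+ 2 <= sin x ^+ 2.
  by rewrite -exprMn ler_pXn2r// ?nnegrE ?(ltW s0)// mulr_ge0// ltW.
have := cos2Dsin2 x; have s2 : 0 < sin x ^+ 2 by rewrite exprn_gt0.
have x2 : 0 < x ^+ 2 by rewrite exprn_gt0.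
move=> e; rewrite -(ler_pM2l s2) divff ?gt_eqF//.
rewrite -(ler_pM2l x2) mulr1.
have -> : x ^+ 2 * (sin x ^+ 2 * ((x ^+ 2)^-1 + 1)) = sin x ^+ 2 * (1 + x ^+ 2).
  by field; rewrite gt_eqF.
nra.
Qed.

(** Induction through [1 / sin y ^ 2 + 1 / cos y ^ 2 = 4 / sin (2 y) ^ 2]: the angles [y] and
    [pi / 2 - y] at one level merge into [2 y] at the level below. *)
Lemma sum_inv_sin2 m :
  \sum_(k < 2 ^ m) (sin ((2 * k%:R + 1) * pi / (2 ^+ m.+2)) ^+ 2)^-1
  = 2 * 4 ^+ m :> R.
Proof.
elim: m => [|m ih].
  rewrite expn0 big_ord1 mulr0 add0r mul1r expr0 mulr1.
  have := sin_mulr2n (pi / 2 ^+ 2 : R); have := cos2Dsin2 (pi / 2 ^+ 2 : R).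
  rewrite (_ : (pi / 2 ^+ 2 : R) *+ 2 = pi / 2) ?sin_pihalf; last by field.
  set s := sin _; set c := cos _ => e1 e2.
  have cs : c = s by rewrite -mulr_natr in e2; nra.
  rewrite cs in e1; have -> : s ^+ 2 = 2^-1 by lra.
  by rewrite invrK.
rewrite [4 ^+ m.+1]exprS mulrCA -ih mulr_sumr.
rewrite (_ : 2 ^ m.+1 = 2 ^ m + 2 ^ m)%N ?big_split_ord/=; last first.
  by rewrite expnS mul2n addnn.
rewrite [X in _ + X](reindex_inj rev_ord_inj)/= -big_split/=.
apply: eq_bigr => k _.
set y := (2 * k%:R + 1) * pi / 2 ^+ m.+3.
have p0 : (2 : R) ^+ m.+1 != 0 by rewrite expf_neq0.
have -> : (2 * k%:R + 1) * pi / 2 ^+ m.+2 = y *+ 2.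
  by rewrite /y [2 ^+ m.+3]exprS [2 ^+ m.+2]exprS; field.
have -> : (2 * (2 ^ m + (2 ^ m - k.+1))%:R + 1) * pi / 2 ^+ m.+3 = pi / 2 - y.
  rewrite natrD natrB ?ltn_ord// -natr1 natrX /y ![2 ^+ m.+3]exprS !exprS.
  field; exact: expf_neq0.
have sy : 0 < sin y /\ 0 < cos y.
  have pi0 : 0 < pi :> R := pi_gt0 R.
  have y0 : 0 < y by rewrite divr_gt0 ?exprn_gt0// mulr_gt0// ltr_wpDl// mulr_ge0.
  have y1 : y < pi / 2.
    rewrite /y ltr_pdivrMr ?exprn_gt0//.
    have -> : pi / 2 * 2 ^+ m.+3 = (2 * 2 ^+ m + 2 * 2 ^+ m) * pi :> R.
      by rewrite !exprS; field.
    rewrite ltr_pM2r//.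
    have : (k.+1%:R <= (2 ^+ m : R)) by rewrite -natrX ler_nat ltn_ord.
    rewrite -natr1; have : 0 < (2 : R) ^+ m by rewrite exprn_gt0.
    lra.
  split; first by apply: sin_gt0_pi; rewrite y0/=; lra.
  by apply: cos_gt0_pihalf; apply/andP; split; lra.
case: sy => s0 c0.
rewrite sin_mulr2n (_ : sin (pi / 2 - y) = cos y); last first.
  by rewrite sinB sin_pihalf cos_pihalf mul1r mul0r subr0.
have := cos2Dsin2 y.
move: s0 c0; move: (sin y) (cos y) => s c s0 c0 e.
transitivity ((c ^+ 2 + s ^+ 2) / (c ^+ 2 * s ^+ 2)).
  by field; rewrite !gt_eqF.
by rewrite e; field; rewrite !gt_eqF.
Qed.

(** Each term [1 / (2 k + 1) ^ 2] is at most [1 / (4 k) - 1 / (4 (k + 1))], which telescopes. *)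
Lemma sum_inv_odd2_tail n m : (0 < n)%N ->
  \sum_(k < n + m) ((2 * k%:R + 1) ^+ 2)^-1
  <= \sum_(k < n) ((2 * k%:R + 1) ^+ 2)^-1 + (4 * n%:R)^-1 - (4 * (n + m)%:R)^-1 :> R.
Proof.
move=> n0; elim: m => [|m ih]; first by rewrite addn0 addrK.
rewrite addnS big_ord_recr/=; apply: le_trans (lerD ih (lexx _)) _.
have k0 : 0 < (n + m)%:R :> R by rewrite ltr0n addn_gt0 n0.
rewrite -[(n + m).+1%:R]natr1; move: k0; set k : R := (n + m)%:R => k0.
suff : ((2 * k + 1) ^+ 2)^-1 <= (4 * k)^-1 - (4 * (k + 1))^-1 by lra.
have -> : (4 * k)^-1 - (4 * (k + 1))^-1 = (4 * k * (k + 1))^-1.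
  by field; rewrite !gt_eqF//; lra.
by rewrite lef_pV2 ?posrE ?exprn_gt0 ?mulr_gt0//; nra.
Qed.

(** Replacing [1 / sin x ^ 2] by the larger [1 / x ^ 2 + 1] in [sum_inv_sin2] and rescaling by
    [4 ^ m] leaves an error of order [2 ^ (- m)], which vanishes in the limit; the terms from [n] on
    are bounded by the tail estimate. *)
Lemma sum_inv_odd2_ge n : (0 < n)%N ->
  pi ^+ 2 / 8 - (4 * n%:R)^-1 <= \sum_(k < n) ((2 * k%:R + 1) ^+ 2)^-1 :> R.
Proof.
move=> n0; set S := \sum_(k < n) _.
have pi0 : 0 < pi :> R := pi_gt0 R.
have step m : (n <= 2 ^ m)%N ->
    pi ^+ 2 / 8 <= S + (4 * n%:R)^-1 + pi ^+ 2 / 16 * (2^-1) ^+ m.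
  move=> nm.
  have h1 : 2 * 4 ^+ m <= 16 * 4 ^+ m / pi ^+ 2 *
      \sum_(k < 2 ^ m) ((2 * k%:R + 1) ^+ 2)^-1 + 2 ^+ m :> R.
    rewrite -sum_inv_sin2.
    have -> : (2 ^+ m : R) = \sum_(k < 2 ^ m) 1 by rewrite sumr_const card_ord natrX.
    rewrite mulr_sumr -big_split/=; apply: ler_sum => k _.
    set y := (2 * k%:R + 1) * pi / 2 ^+ m.+2.
    have p0 : 0 < (2 : R) ^+ m by rewrite exprn_gt0.
    have e4 : (4 ^+ m : R) = 2 ^+ m * 2 ^+ m by rewrite -expr2 exprAC -!natrX.
    have c0 : 0 < 2 * k%:R + 1 :> R by rewrite ltr_wpDl// mulr_ge0.
    have -> : 16 * 4 ^+ m / pi ^+ 2 * ((2 * k%:R + 1) ^+ 2)^-1 = (y ^+ 2)^-1.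
      have gen (P c t : R) : 0 < P -> 0 < c -> 0 < t ->
          16 * (t * t) / P ^+ 2 * (c ^+ 2)^-1 = ((c * P / (2 * (2 * t))) ^+ 2)^-1.
        by move=> ? ? ?; field; rewrite !gt_eqF.
      by rewrite e4 /y [2 ^+ m.+2]exprS [2 ^+ m.+1]exprS gen.
    apply: inv_sin2_le; rewrite /y divr_gt0 ?(mulr_gt0 c0 pi0) ?exprn_gt0//=.
    rewrite ler_pdivrMr ?exprn_gt0//.
    have -> : pi / 2 * 2 ^+ m.+2 = 2 * 2 ^+ m * pi :> R by rewrite !exprS; field.
    rewrite ler_pM2r//.
    have : (k.+1%:R <= (2 ^+ m : R)) by rewrite -natrX ler_nat ltn_ord.
    by rewrite -natr1; lra.
  have h2 := @sum_inv_odd2_tail n (2 ^ m - n)%N n0.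
  rewrite subnKC// -/S in h2.
  have h3 : \sum_(k < 2 ^ m) ((2 * k%:R + 1) ^+ 2)^-1 <= S + (4 * n%:R)^-1 :> R.
    apply: le_trans h2 _; rewrite gerBl invr_ge0 mulr_ge0//.
  have f0 : 0 < (4 : R) ^+ m by rewrite exprn_gt0.
  have q0 : 0 < pi ^+ 2 / (16 * 4 ^+ m) :> R.
    by rewrite divr_gt0 ?exprn_gt0// mulr_gt0.
  have h4 := ler_wpM2l (ltW q0) h1.
  have e1 : pi ^+ 2 / (16 * 4 ^+ m) * (2 * 4 ^+ m) = pi ^+ 2 / 8 :> R.
    by rewrite -mulrA; congr (_ * _); field; rewrite gt_eqF.
  rewrite e1 mulrDr in h4; apply: le_trans h4 _; apply: lerD.
    rewrite mulrA (_ : _ * (_ / _) = 1) ?mul1r//.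
    have gen (P t : R) : 0 < P -> 0 < t -> P / (16 * t) * (16 * t / P) = 1.
      by move=> ? ?; field; rewrite !gt_eqF.
    by rewrite gen// exprn_gt0.
  have p0 : 0 < (2 : R) ^+ m by rewrite exprn_gt0.
  have e4 : (4 ^+ m : R) = 2 ^+ m * 2 ^+ m by rewrite -expr2 exprAC -!natrX.
  rewrite le_eqVlt; apply/orP; left; apply/eqP.
  have gen (P t : R) : 0 < t -> P / (16 * (t * t)) * t = P / 16 * t^-1.
    by move=> ?; field; rewrite gt_eqF.
  by rewrite e4 exprVn gen.
rewrite lerBlDr.
have lim0 : S + (4 * n%:R)^-1 + pi ^+ 2 / 16 * (2^-1) ^+ m @[m --> \oo]
    --> S + (4 * n%:R)^-1.
  rewrite -[X in _ --> X]addr0; apply: cvgD; first exact: cvg_cst.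
  rewrite -(mulr0 (pi ^+ 2 / 16)); apply: cvgM; first exact: cvg_cst.
  by apply: cvg_expr; rewrite ger0_norm// invf_lt1// ltr1n.
apply: (cvgr_to_ge lim0); near=> m; apply: step.
apply: (@leq_trans m); last by rewrite ltnW// ltn_expl.
by near: m; exact: nbhs_infty_ge.
Unshelve. all: by end_near.
Qed.

(** Two terms of the series give [pi ^ 2 <= 8 * (10 / 9 + 1 / 8) = 89 / 9]. *)
Lemma pi2_lt : pi ^+ 2 <= 9889 / 1000 :> R.
Proof.
have := @sum_inv_odd2_ge 2 isT.
have -> : \sum_(k < 2) ((2 * k%:R + 1) ^+ 2)^-1 = 10 / 9 :> R.
  by rewrite !big_ord_recr big_ord0/=; field.
by lra.
Qed.

(** The right-hand side is [1 / (2 * sinh x)]. After clearing denominators the difference [f0]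
    vanishes at [0] together with its first two derivatives [f1] and [f2], and its third derivative
    [f3] is non-negative. *)
Lemma half_csch_ge x : 0 < x ->
  (x^-1 - x / 6) / 2 <= expR (- x) / (1 - expR (- (2 * x))).
Proof.
move=> x0.
pose f0 (t : R) : R := 12 * t - (6 - t ^+ 2) * (expR (1 * t) - expR (- 1 * t)).
pose f1 (t : R) : R := 12 + 2 * t * (expR (1 * t) - expR (- 1 * t))
  - (6 - t ^+ 2) * (expR (1 * t) + expR (- 1 * t)).
pose f2 (t : R) : R := (t ^+ 2 - 4) * (expR (1 * t) - expR (- 1 * t))
  + 4 * t * (expR (1 * t) + expR (- 1 * t)).
pose f3 (t : R) : R := t ^+ 2 * (expR (1 * t) + expR (- 1 * t))
  + 6 * t * (expR (1 * t) - expR (- 1 * t)).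
have dE c t := is_derive_expR_scale c t.
have sh0 (t : R) : 0 <= t -> 0 <= expR (1 * t) - expR (- 1 * t).
  by move=> t0; rewrite subr_ge0 ler_expR mul1r mulN1r; lra.
have d2 (t : R) : is_derive t 1 f2 (f3 t).
  rewrite /f2 /f3; have := dE 1 t; have := dE (- 1) t => ? ?.
  by apply: is_derive_eq; rewrite /GRing.scale/=; ring.
have d1 (t : R) : is_derive t 1 f1 (f2 t).
  rewrite /f1 /f2; have := dE 1 t; have := dE (- 1) t => ? ?.
  by apply: is_derive_eq; rewrite /GRing.scale/=; ring.
have d0 (t : R) : is_derive t 1 f0 (f1 t).
  rewrite /f0 /f1; have := dE 1 t; have := dE (- 1) t => ? ?.
  by apply: is_derive_eq; rewrite /GRing.scale/=; ring.
have p2 t : 0 <= t -> 0 <= f2 t.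
  move=> t0; have := @is_derive_ge0_le f2 f3 0 t t0.
  rewrite (_ : f2 0 = 0); last by rewrite /f2 !mulr0 expR0; ring.
  apply=> // s /andP[s0 _].
  apply: addr_ge0; apply: mulr_ge0; rewrite ?sqr_ge0 ?sh0//.
  by rewrite mulr_ge0.
have p1 t : 0 <= t -> 0 <= f1 t.
  move=> t0; have := @is_derive_ge0_le f1 f2 0 t t0.
  rewrite (_ : f1 0 = 0); last by rewrite /f1 !mulr0 expR0; ring.
  by apply=> // s /andP[s0 _]; exact: p2.
have : 0 <= f0 x.
  have := @is_derive_ge0_le f0 f1 0 x (ltW x0).
  rewrite (_ : f0 0 = 0); last by rewrite /f0 !mulr0 expR0; ring.
  by apply=> // s /andP[s0 _]; exact: p1.
rewrite /f0 mul1r mulN1r => h.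
have ex := expR_gt0 x; have e2 : expR (- (2 * x)) = expR (- x) / expR x.
  by rewrite -expRN -expRD; congr expR; ring.
have d : expR (- x) < expR x by rewrite ltr_expR; lra.
have -> : expR (- x) / (1 - expR (- (2 * x))) = (expR x - expR (- x))^-1.
  have ee : expR x * expR (- x) = 1 by exact: expRxMexpNx_1.
  rewrite e2; have -> : 1 - expR (- x) / expR x = (expR x - expR (- x)) / expR x.
    by field; rewrite gt_eqF.
  by rewrite invf_div mulrA [expR (- x) * _]mulrC ee mul1r.
have d' : 0 < expR x - expR (- x) by lra.
rewrite -(ler_pM2r d') mulVf ?gt_eqF// -(ler_pM2l (mulr_gt0 (ltr0n R 12) x0)).
have -> : 12%:R * x * ((x^-1 - x / 6) / 2 * (expR x - expR (- x))) =
  (6 - x ^+ 2) * (expR x - expR (- x)) by field; rewrite gt_eqF.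
lra.
Qed.

End DerivativeSigns.

(** * Products of hyperbolic tangents *)

(* [tanh (w / 2)]. *)
Definition tanh_half {R : realType} (w : R) : R :=
  (1 - expR (- w)) / (1 + expR (- w)).

Definition grid_prod {R : realType} (h u : R) (M : nat) : R :=
  \prod_(m < M) `|tanh_half ((m%:R + 2^-1) * h - u)
                  * tanh_half ((m%:R + 2^-1) * h + u)|.

Definition half_grid_prod {R : realType} (h : R) (M : nat) : R :=
  \prod_(m < M) tanh_half ((m%:R + 2^-1) * h) ^+ 2.

Section GridProducts.
Variable R : realType.
Implicit Types h u w c : R.

Let expR_pos w : 0 < expR w := expR_gt0 w.

Lemma tanh_halfN w : tanh_half (- w) = - tanh_half w.
Proof.
rewrite /tanh_half opprK.
have e : expR w * expR (- w) = 1 := expRxMexpNx_1 w.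
have := (expR_pos w, expR_pos (- w)); move: e; rewrite expRN.
by move: (expR w) => x e [x0 _]; field; rewrite !gt_eqF//; lra.
Qed.

Lemma tanh_half_ge0 w : 0 <= w -> 0 <= tanh_half w.
Proof.
move=> w0; apply: divr_ge0; last by apply: addr_ge0 => //; exact: expR_ge0.
by rewrite subr_ge0 expR_le1; lra.
Qed.

Lemma norm_tanh_half_le1 w : `|tanh_half w| <= 1.
Proof.
have := expR_pos (- w) => e0.
have d0 : 0 < 1 + expR (- w) by lra.
rewrite /tanh_half ler_norml ler_pdivlMr// ler_pdivrMr//.
by apply/andP; split; lra.
Qed.

Lemma norm_tanh_halfN w : `|tanh_half (- w)| = `|tanh_half w|.
Proof. by rewrite tanh_halfN normrN. Qed.

(** With [E = exp (- c)] and [s = exp u + exp (- u)], the product is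
    [(1 + E ^ 2 - E s) / (1 + E ^ 2 + E s)], which decreases in [s]; the bound is its value at
    [s = 2]. *)
Lemma tanh_half_pair_le c u : `|u| <= c ->
  `|tanh_half (c - u) * tanh_half (c + u)| <= tanh_half c ^+ 2.
Proof.
move=> uc; have /andP[u1 u2] : - c <= u <= c by rewrite -ler_norml.
rewrite ger0_norm; last by rewrite mulr_ge0// tanh_half_ge0//; lra.
rewrite /tanh_half.
have -> : - (c - u) = - c + u by ring.
have -> : - (c + u) = - c - u by ring.
rewrite !expRD [expR (- u)]expRN; have := (expR_pos (- c), expR_pos u).
move: (expR (- c)) (expR u) => E X [E0 X0].
have d1 : 0 < 1 + E * X by rewrite addr_gt0 ?mulr_gt0.
have d2 : 0 < 1 + E / X by rewrite addr_gt0 ?divr_gt0.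
rewrite mulf_div expr_div_n.
have -> : (1 - E * X) * (1 - E / X) = 1 + E ^+ 2 - E * (X + X^-1).
  by field; rewrite gt_eqF.
have -> : (1 + E * X) * (1 + E / X) = 1 + E ^+ 2 + E * (X + X^-1).
  by field; rewrite gt_eqF.
have : 2 <= X + X^-1.
  have : 0 <= (X - 1) ^+ 2 / X by rewrite divr_ge0 ?sqr_ge0// ltW.
  have -> : (X - 1) ^+ 2 / X = X + X^-1 - 2 by field; rewrite gt_eqF.
  lra.
move: (X + X^-1) => s s2.
have E2 : 0 <= E ^+ 2 by exact: sqr_ge0.
have Es : 0 <= E * (s - 2) by apply: mulr_ge0; lra.
have d3 : 0 < 1 + E ^+ 2 + E * s by nra.
have d4 : 0 < (1 + E) ^+ 2 by rewrite exprn_gt0// addr_gt0.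
rewrite ler_pdivrMr// mulrAC ler_pdivlMr//.
have : 0 <= E * (s - 2) * (1 + E ^+ 2) by apply: mulr_ge0; lra.
by nra.
Qed.

Lemma half_grid_prod_le h M N :
  (M <= N)%N -> half_grid_prod h N <= half_grid_prod h M.
Proof.
move=> /subnKC <-; elim: (N - M)%N => [|k ih]; first by rewrite addn0.
rewrite addnS; apply: le_trans ih; rewrite /half_grid_prod big_ord_recr/=.
apply: ler_piMr; first by apply: prodr_ge0 => i _; rewrite sqr_ge0.
by rewrite -real_normK ?num_real// expr_le1// norm_tanh_half_le1.
Qed.

(* Shifting the grid by one node drops two factors of modulus at most one. *)
Lemma grid_prod_shift h u M : grid_prod h (u + h) M.+1 <= grid_prod h u M.
Proof.
pose f (m : nat) : R := `|tanh_half ((m%:R + 2^-1) * h - u)|.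
pose g (m : nat) : R := `|tanh_half ((m%:R + 2^-1) * h + u)|.
have g1 m : g m <= 1 by exact: norm_tanh_half_le1.
have -> : grid_prod h u M = (\prod_(m < M) f m) * (\prod_(m < M) g m).
  by rewrite -big_split/=; apply: eq_bigr => i _; rewrite normrM.
have -> : grid_prod h (u + h) M.+1 = (\prod_(m < M) f m) * (\prod_(m < M.+2) g m).
  have -> : grid_prod h (u + h) M.+1 =
      (\prod_(m < M.+1) `|tanh_half ((m%:R + 2^-1) * h - (u + h))|)
      * (\prod_(m < M.+1) g m.+1).
    rewrite -big_split/=; apply: eq_bigr => i _.
    by rewrite normrM /g -natr1; congr (_ * `|tanh_half _|); ring.
  have -> : \prod_(m < M.+2) g m = g 0%N * \prod_(m < M.+1) g m.+1.
    by rewrite big_ord_recl.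
  have -> : \prod_(m < M.+1) `|tanh_half ((m%:R + 2^-1) * h - (u + h))|
      = g 0%N * \prod_(m < M) f m; last by ring.
  rewrite big_ord_recl; congr (_ * _).
    by rewrite /g -norm_tanh_halfN/=; congr `|tanh_half _|; field.
  apply: eq_bigr => i _; rewrite /f lift0 -natr1.
  by congr `|tanh_half _|; ring.
apply: ler_wpM2l; first by apply: prodr_ge0 => i _; exact: normr_ge0.
have G0 k : 0 <= \prod_(m < k) g m by apply: prodr_ge0 => i _; exact: normr_ge0.
rewrite !big_ord_recr/= -mulrA; apply: ler_piMr; first exact: G0.
apply: mulr_ile1; [exact: normr_ge0|exact: normr_ge0|exact: g1|exact: g1].
Qed.

(** At most [i] shifts by [h] bring [u] within [h / 2] of the centre of the grid, where
    [tanh_half_pair_le] applies to every pair of nodes; each shift uses up one index. *)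
Lemma grid_prod_le h (i M : nat) u : 0 < h ->
  - (h / 2) <= u <= i%:R * h + h / 2 -> grid_prod h u (M + i) <= half_grid_prod h M.
Proof.
move=> h0; elim: i u => [|i ih] u /andP[u1 u2].
  rewrite addn0; apply: ler_prod => m _; rewrite normr_ge0/=.
  apply: tanh_half_pair_le; rewrite ler_norml.
  have : 0 <= m%:R * h by rewrite mulr_ge0// ltW.
  by move: u1 u2; rewrite mul0r add0r => *; apply/andP; split; lra.
have [uh|uh] := leP u (h / 2).
  apply: le_trans (_ : half_grid_prod h (M + i.+1) <= _); last first.
    by apply: half_grid_prod_le; rewrite leq_addr.
  apply: ler_prod => m _; rewrite normr_ge0/=.
  apply: tanh_half_pair_le; rewrite ler_norml.
  have : 0 <= m%:R * h by rewrite mulr_ge0// ltW.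
  by move=> *; apply/andP; split; lra.
rewrite -(subrK h u) addnS; apply: le_trans (grid_prod_shift _ _ _) _.
apply: ih; apply/andP; split; first lra.
by move: u2; rewrite -natr1; lra.
Qed.

(** The nodes with [2 l k <= m < 2 l (k + 1)] form a block centred at [(2 k + 1) * (l h)]. Reversing
    its lower half pairs the nodes symmetrically about that centre, which is the shape given by the
    triple product with [L = l h]. *)
Lemma grid_prod_blocks h u (l N : nat) :
  grid_prod h u (2 * l * N) =
  \prod_(k < N) \prod_(j < l)
    `|(tanh_half ((2 * k%:R + 1) * (l%:R * h) - (j%:R + 2^-1) * h - u)
       * tanh_half ((2 * k%:R + 1) * (l%:R * h) - (j%:R + 2^-1) * h + u))
      * (tanh_half ((2 * k%:R + 1) * (l%:R * h) + (j%:R + 2^-1) * h - u)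
       * tanh_half ((2 * k%:R + 1) * (l%:R * h) + (j%:R + 2^-1) * h + u))|.
Proof.
elim: N => [|N ih]; first by rewrite muln0 /grid_prod !big_ord0.
rewrite mulnSr big_ord_recr/= -ih /grid_prod big_split_ord/=; congr (_ * _).
rewrite mul2n -addnn big_split_ord/= (reindex_inj rev_ord_inj)/= -big_split/=.
apply: eq_bigr => j _; rewrite -normrM.
rewrite !natrD natrB ?ltn_ord// -natr1 !natrM.
by congr `| (_ * _) * (_ * _)|; congr tanh_half; rewrite ?natrD; field.
Qed.

(** This truncates the series of [artanh]. The function [f] increases because
    [(1 - x ^ 2) * dS x = 1 - x ^ (2 K)] is at most [1]. *)
Lemma ln_ratio_ge (K : nat) (t : R) : 0 <= t < 1 ->
  (1 - t) / (1 + t) <= expR (- (2 * \sum_(k < K) t ^+ (2 * k).+1 / (2 * k%:R + 1))).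
Proof.
move=> /andP[t0 t1].
pose S (x : R) := \sum_(k < K) x ^+ (2 * k).+1 / (2 * k%:R + 1).
pose dS (x : R) := \sum_(k < K) x ^+ (2 * k).
have dSE (x : R) : is_derive x 1 S (dS x).
  rewrite /S /dS; elim: (K) => [|k ih].
    have -> : (fun x : R => \sum_(k < 0) x ^+ (2 * k).+1 / (2 * k%:R + 1)) = cst 0.
      by apply/funext => y; rewrite big_ord0.
    by rewrite big_ord0; exact: is_derive_cst.
  have -> : (fun x : R => \sum_(i < k.+1) x ^+ (2 * i).+1 / (2 * i%:R + 1)) =
    (fun x => \sum_(i < k) x ^+ (2 * i).+1 / (2 * i%:R + 1)
       + x ^+ (2 * k).+1 / (2 * k%:R + 1)).
    by apply/funext => y; rewrite big_ord_recr.
  rewrite big_ord_recr/=; apply: is_deriveD.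
  have hp : is_derive x 1 (fun y : R => y ^+ (2 * k).+1)
      ((2 * k).+1%:R * x ^+ (2 * k)).
    have -> : (fun y : R => y ^+ (2 * k).+1) = (@idfun R) ^+ (2 * k).+1.
      by apply/funext => y; rewrite exprfctE.
    by apply: is_derive_eq; rewrite /GRing.scale/= mulr1.
  apply: is_derive_eq; rewrite /GRing.scale/= -[(2 * k).+1%:R]natr1 natrM.
  have k0 : 0 <= 2 * k%:R :> R by rewrite mulr_ge0.
  by field; rewrite gt_eqF//; lra.
pose f (x : R) := - ((1 - x) * expR (2 * S x) * (1 + x)^-1).
pose g (x : R) := expR (2 * S x) * (2 - 2 * (1 - x ^+ 2) * dS x) / (1 + x) ^+ 2.
have dexp (x : R) : is_derive x 1 (fun x => expR (2 * S x)) (2 * dS x * expR (2 * S x)).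
  have h : is_derive x 1 (fun t => 2 * S t) (2 * dS x).
    by have ? := dSE x; apply: is_derive_eq; rewrite /GRing.scale/=; ring.
  have := @is_derive1_comp _ expR (fun t => 2 * S t) x _ _ (is_derive_expR _) h.
  by rewrite mulrC.
have dfE (x : R) : 0 <= x -> is_derive x 1 f (g x).
  move=> x0; have x1 : 1 + x != 0 by rewrite gt_eqF//; lra.
  have dinv : is_derive x 1 (fun x => (1 + x)^-1) (- (1 + x) ^- 2).
    have h : is_derive x 1 (fun x : R => 1 + x) 1.
      by apply: is_derive_eq; rewrite add0r mulr1.
    by apply: is_derive_eq; rewrite /GRing.scale/= mulr1.
  have ? := dexp x; apply: is_derive_eq; rewrite /GRing.scale/= /g.
  by field.
have g0 (x : R) : 0 <= x <= t -> 0 <= g x.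
  move=> /andP[x0 xt].
  apply: divr_ge0; last exact: sqr_ge0.
  apply: mulr_ge0; first exact: expR_ge0.
  have -> : 2 * (1 - x ^+ 2) * dS x = 2 * (1 - x ^+ (2 * K)).
    have -> : dS x = \sum_(k < K) (x ^+ 2) ^+ k.
      by apply: eq_bigr => k _; rewrite exprM.
    rewrite exprM -[(x ^+ 2) ^+ K](subrK 1) subrX1; ring.
  rewrite subr_ge0 ger_pMr// gerBl; exact: exprn_ge0.
have : f 0 <= f t.
  by apply: (@is_derive_ge0_le _ f g 0 t t0 _ g0) => x /andP[x0 _]; exact: dfE.
have -> : f 0 = - 1.
  rewrite /f /S big1 => [|k _]; last by rewrite expr0n/= mul0r.
  by rewrite mulr0 expR0 subr0 addr0; field.
rewrite /f lerN2 expRN -/(S t) => h.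
have e0 := expR_gt0 (2 * S t); have t1' : 0 < 1 + t by lra.
rewrite ler_pdivrMr// mulrC ler_pdivlMr// -[leRHS]mul1r.
by move: h; rewrite ler_pdivrMr.
Qed.

End GridProducts.

(** * A bound for the Zolotarev problem *)

Section Competitor.
Variable R : realType.

(** After [ln_ratio_ge] at each node and an exchange of sums, the nodes give for each [k] a
    geometric series of ratio [exp (- (2 k + 1) h)], with full sum
    [1 / (2 * sinh ((2 k + 1) h / 2))]. The slowest of them, [k = 0], bounds the effect of stopping
    at [M] nodes. *)
Lemma half_grid_prod_le_exp (h : R) (K M : nat) : 0 < h ->
  half_grid_prod h M <= expR (- (4 * (\sum_(k < K)
    (expR (- ((2 * k%:R + 1) * h / 2)) / (1 - expR (- ((2 * k%:R + 1) * h))))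
      / (2 * k%:R + 1)) * (1 - expR (- h) ^+ M))).
Proof.
move=> h0; set T := \sum_(k < K) _.
have k1 (k : nat) : 0 < 2 * k%:R + 1 :> R by rewrite ltr_wpDl// mulr_ge0.
pose S (m : nat) := \sum_(k < K)
  expR (- ((m%:R + 2^-1) * h)) ^+ (2 * k).+1 / (2 * k%:R + 1).
have step (m : nat) :
    tanh_half ((m%:R + 2^-1) * h) ^+ 2 <= expR (- (4 * S m)).
  have p0 : 0 < (m%:R + 2^-1) * h by rewrite mulr_gt0// ltr_wpDl.
  have -> : - (4 * S m) = 2%:R * (- (2 * S m)) by ring.
  rewrite expRM_natl ler_pXn2r ?nnegrE ?expR_ge0 ?(tanh_half_ge0 (ltW p0))//.
  apply: (@ln_ratio_ge R K (expR (- ((m%:R + 2^-1) * h)))).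
  by rewrite expR_ge0 expR_lt1 oppr_lt0.
apply: (@le_trans _ _ (\prod_(m < M) expR (- (4 * S m)))).
  by apply: ler_prod => m _; rewrite sqr_ge0 step.
rewrite -expR_sum ler_expR sumrN lerN2 -mulr_sumr -mulrA ler_pM2l//.
rewrite /S exchange_big/= /T mulr_suml; apply: ler_sum => k _.
rewrite -mulr_suml mulrAC ler_pM2r ?invr_gt0//.
set x := (2 * k%:R + 1) * h; have x0 : 0 < x by rewrite mulr_gt0.
have x1 : 0 < 1 - expR (- x) by rewrite subr_gt0 expR_lt1 oppr_lt0.
have -> : \sum_(m < M) expR (- ((m%:R + 2^-1) * h)) ^+ (2 * k).+1
    = expR (- (x / 2)) / (1 - expR (- x)) * (1 - expR (- x) ^+ M).
  have -> (q : R) : 1 - q ^+ M = (1 - q) * \sum_(m < M) q ^+ m.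
    by rewrite -opprB subrX1 -mulNr opprB.
  rewrite mulrA divfK ?gt_eqF// mulr_sumr.
  apply: eq_bigr => m _; rewrite -!expRM_natl -expRD; congr expR.
  by rewrite /x -[(2 * k).+1%:R]natr1 natrM; field.
apply: ler_wpM2l; first by apply: divr_ge0; [exact: expR_ge0|exact: ltW].
rewrite lerD2l lerN2 lerXn2r ?nnegrE ?expR_ge0//.
rewrite ler_expR lerN2 ler_peMl ?(ltW h0)//.
by rewrite lerDr mulr_ge0.
Qed.

(** The cut-off [K] is kept free: the omitted part of the odd series costs [1 / (K h)], while the
    correction in [half_csch_ge] costs [K h / 6]. *)
Lemma half_grid_prod_bound (h G : R) (K : nat) : 0 < h -> (0 < K)%N ->
  (forall M, G <= half_grid_prod h M) ->
  G <= expR (- (pi ^+ 2 / (2 * h)) + K%:R * h / 6 + (K%:R * h)^-1).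
Proof.
move=> h0 K0 GM.
have K0' : 0 < K%:R :> R by rewrite ltr0n.
set T := \sum_(k < K)
    (expR (- ((2 * k%:R + 1) * h / 2)) / (1 - expR (- ((2 * k%:R + 1) * h))))
      / (2 * k%:R + 1).
have limT : expR (- (4 * T * (1 - expR (- h) ^+ M))) @[M --> \oo] --> expR (- (4 * T)).
  apply: (@continuous_cvg _ _ _ _ _
    (fun M => - (4 * T * (1 - expR (- h) ^+ M))) expR); first exact: continuous_expR.
  apply: cvgN; rewrite -[X in _ --> X]mulr1; apply: cvgM; first exact: cvg_cst.
  rewrite -[X in _ --> X]subr0; apply: cvgB; first exact: cvg_cst.
  by apply: cvg_expr; rewrite ger0_norm ?expR_ge0// expR_lt1 oppr_lt0.
have GT : G <= expR (- (4 * T)).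
  apply: (cvgr_to_ge limT); apply: nearW => M.
  by apply: le_trans (GM M) _; exact: half_grid_prod_le_exp.
apply: le_trans GT _; rewrite ler_expR.
have k1 (k : nat) : 0 < 2 * k%:R + 1 :> R by rewrite ltr_wpDl// mulr_ge0.
have TS : h^-1 * \sum_(k < K) ((2 * k%:R + 1) ^+ 2)^-1 - K%:R * h / 24 <= T.
  have -> : K%:R * h / 24 = \sum_(k < K) h / 24.
    by rewrite sumr_const card_ord -[RHS]mulr_natl mulrA.
  rewrite mulr_sumr -sumrB; apply: ler_sum => k _.
  have x0 : 0 < (2 * k%:R + 1) * h / 2 by rewrite divr_gt0// mulr_gt0.
  have := half_csch_ge x0.
  have -> : 2 * ((2 * k%:R + 1) * h / 2) = (2 * k%:R + 1) * h by field.
  move=> csch; rewrite ler_pdivlMr//; apply: le_trans csch.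
  have := k1 k; move: (2 * k%:R + 1) => c c0.
  by rewrite le_eqVlt; apply/orP; left; apply/eqP; field; rewrite !gt_eqF.
have hB : h^-1 * (pi ^+ 2 / 8 - (4 * K%:R)^-1)
    <= h^-1 * \sum_(k < K) ((2 * k%:R + 1) ^+ 2)^-1.
  by rewrite ler_pM2l ?invr_gt0// sum_inv_odd2_ge.
have e1 : h^-1 * (pi ^+ 2 / 8 - (4 * K%:R)^-1)
   = (pi ^+ 2 / (2 * h) - (K%:R * h)^-1) / 4.
  move: (pi ^+ 2) => P; field; by rewrite !gt_eqF.
rewrite e1 in hB; lra.
Qed.

Lemma cvg_prod_ord (l : nat) (F : 'I_l -> nat -> R) (c : 'I_l -> R) :
  (forall i, F i N @[N --> \oo] --> c i) ->
  \prod_i F i N @[N --> \oo] --> \prod_i c i.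
Proof.
move=> Fc; elim: (index_enum _) => [|i s ih].
  rewrite big_nil; under eq_cvg do rewrite big_nil; exact: cvg_cst.
by rewrite big_cons; under eq_cvg do rewrite big_cons; exact: cvgM.
Qed.

Lemma jacobi_quotE (L w : R) (N : nat) :
  jacobi_prod L (- 1) w N / jacobi_prod L 1 w N =
  \prod_(k < N) (tanh_half ((2 * k%:R + 1) * L - w)
                 * tanh_half ((2 * k%:R + 1) * L + w)).
Proof.
rewrite /jacobi_prod -prodf_div; apply: eq_bigr => k _.
rewrite -mulf_div /tanh_half !mulN1r !mul1r.
have -> : - ((2 * k%:R + 1) * L - w) = w - (2 * k%:R + 1) * L by ring.
by have -> : - ((2 * k%:R + 1) * L + w) = - w - (2 * k%:R + 1) * L by ring.
Qed.

Lemma grid_size (l M N : nat) : (0 < l)%N -> (M < N)%N ->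
  exists2 m, (2 * l * N = m + l)%N & (M <= m)%N.
Proof. by move=> l0 MN; exists (2 * l * N - l)%N; nia. Qed.

Lemma zolotarev_nodes (a b : R) (l : nat) : 0 < a -> a < b -> (0 < l)%N ->
  exists y : 'I_l -> R, (forall j, 0 < y j) /\
    forall (x : R) (M : nat), a <= x <= b ->
      \prod_j `|(x - y j) / (x + y j)|
      <= half_grid_prod (ln (4 * b / a) / l%:R) M.
Proof.
move=> a0 ab l0; set L := ln _; set h := L / _.
have b0 : 0 < b by lra.
have l0' : 0 < l%:R :> R by rewrite ltr0n.
have k4 : 4 < 4 * b / a by rewrite ltr_pdivlMr// ltr_pM2l.
have L0 : 0 < L by apply: ln_gt0; lra.
have h0 : 0 < h by exact: divr_gt0.
have eL : expR (- L) = a / (4 * b).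
  by rewrite expRN lnK ?invf_div// posrE; lra.
pose D := theta_ratio L; have D0 u : 0 < D u by exact: theta_ratio_gt0.
(* This scale makes [c * D] cover [[a, b]]: the bound on [D 0] gives [c * D 0 <= 4 b exp (- L) = a],
   and then [c * D L = c / D 0 >= b]. *)
pose c := 2 * b * expR (- L / 2).
have c0 : 0 < c by rewrite !mulr_gt0 ?expR_gt0.
have eL2 : expR (- L / 2) * expR (- L / 2) = a / (4 * b).
  by rewrite -expRD -eL; congr expR; field.
pose v (j : 'I_l) : R := (j%:R + 2^-1) * h.
exists (fun j => c / D (v j)); split=> [j|x M /andP[xa xb]]; first exact: divr_gt0.
have [u /andP[u0 uL] ux] : exists2 u, 0 <= u <= L & c * D u = x.
  have [||u] := @IVT R (fun u => c * D u) 0 L x (ltW L0).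
  - apply: continuous_subspaceT => u; apply: cvgM; first exact: cvg_cst.
    exact: continuous_theta_ratio.
  - have d0 : D 0 <= 2 * expR (- L / 2) by exact: theta_ratio0_le.
    rewrite ge_min le_max; apply/andP; split; apply/orP.
      left; apply: le_trans xa; apply: le_trans (ler_wpM2l (ltW c0) d0) _.
      have -> : c * (2 * expR (- L / 2)) = 4 * b * (expR (- L / 2) * expR (- L / 2)).
        by rewrite /c; ring.
      by rewrite eL2 mulrC divfK// gt_eqF// mulr_gt0.
    right; apply: le_trans xb _; rewrite /D theta_ratio_end// ler_pdivlMr//.
    apply: le_trans (ler_wpM2l (ltW b0) d0) _.
    by rewrite /c mulrCA mulrA.
  by rewrite in_itv/= => uL e; exists u.
(* Taking the nodes at [c / D (v j)], and not at [c * D (v j)], makes the factor a function of the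
   product [D u * D (v j)], as the addition formula requires. *)
have factor j : (x - c / D (v j)) / (x + c / D (v j)) =
    - ((1 - D u * D (v j)) / (1 + D u * D (v j))).
  have := (D0 u, D0 (v j)); rewrite -ux; move: (D u) (D (v j)) => d d' [? ?].
  have n1 : 0 < 1 + d * d' by rewrite addr_gt0// mulr_gt0.
  have -> : c * d - c / d' = - (c / d' * (1 - d * d')) by field; rewrite gt_eqF.
  have -> : c * d + c / d' = c / d' * (1 + d * d') by field; rewrite gt_eqF.
  rewrite mulNr; congr (- _); rewrite -mulf_div divff ?mul1r//.
  by rewrite gt_eqF// divr_gt0.
pose Q w N := jacobi_prod L (- 1) w N / jacobi_prod L 1 w N.
have lim : \prod_j `|Q (u + v j) N * Q (u - v j) N| @[N --> \oo] -->
    \prod_j `|(x - c / D (v j)) / (x + c / D (v j))|.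
  apply: cvg_prod_ord => j; rewrite factor normrN /D theta_ratio_add//.
  by apply: cvg_norm; apply: cvgM; exact: jacobi_quot_cvg.
have grid N : \prod_j `|Q (u + v j) N * Q (u - v j) N| = grid_prod h u (2 * l * N).
  rewrite grid_prod_blocks exchange_big/=; apply: eq_bigr => j _.
  rewrite /Q !jacobi_quotE -big_split normr_prod/=; apply: eq_bigr => k _.
  rewrite -/(v j) (_ : l%:R * h = L); last by rewrite mulrC divfK// gt_eqF.
  move: ((2 * k%:R + 1) * L) (v j) => d w.
  have -> : d - w - u = d - (u + w) by ring.
  have -> : d - w + u = d + (u - w) by ring.
  have -> : d + w - u = d - (u - w) by ring.
  have -> : d + w + u = d + (u + w) by ring.
  by congr `|_|; ring.
apply: (cvgr_to_le lim); near=> N; rewrite grid.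
have NM : (M.+1 <= N)%N by near: N; exact: nbhs_infty_ge.
(* As [u <= L = l * h], at most [l] shifts are needed, so [l] indices are set aside. *)
have [m -> Mm] := grid_size l0 NM.
apply: le_trans (@grid_prod_le _ _ _ _ _ h0 _) _.
  have -> : l%:R * h = L by rewrite mulrC divfK// gt_eqF.
  by apply/andP; split; lra.
exact: half_grid_prod_le.
Unshelve. all: by end_near.
Qed.

End Competitor.

Section ZolotarevBound.
Variable R : realType.
Local Notation C := R[i].

Lemma normc_real (x : R) : Normc.normc (x%:C) = `|x|.
Proof. by rewrite /Normc.normc/= expr0n/= addr0 sqrtr_sqr. Qed.

Lemma le_inve (I : \bar R) (r : R) : 0 < r ->
  (0 <= I)%E -> (I <= (r^-1)%:E)%E -> (r%:E <= inve I)%E.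
Proof.
move=> r0; case: I => [t|//|//]; rewrite !lee_fin => t0 tr.
rewrite inver; case: eqVneq => [_|tn0]; first by rewrite leey.
by rewrite lee_fin -[leLHS]invrK lef_pV2// posrE ?invr_gt0// lt_def tn0.
Qed.

Lemma inve_le (I : \bar R) (r : R) : 0 < r ->
  ((r^-1)%:E <= I)%E -> (inve I <= r%:E)%E.
Proof.
move=> r0; case: I => [t|_|//]; last by rewrite invey lee_fin ltW.
rewrite lee_fin => tr; have t0 : 0 < t by apply: lt_le_trans tr; rewrite invr_gt0.
rewrite inver gt_eqF// lee_fin -[leRHS]invrK lef_pV2 ?posrE ?invr_gt0//.
Qed.

Lemma horner_prodD (I : Type) (s : seq I) (F : I -> R) (x : R) :
  (\prod_(i <- s) ('X + ((F i)%:C)%:P)).[x%:C] = (\prod_(i <- s) (x + F i))%:C.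
Proof.
rewrite horner_prod rmorph_prod/=; apply: eq_bigr => i _.
by rewrite hornerD hornerX hornerC rmorphD.
Qed.

Lemma horner_prodNXD (I : Type) (s : seq I) (F : I -> R) (x : R) :
  (\prod_(i <- s) (- 'X + ((F i)%:C)%:P)).[x%:C] = (\prod_(i <- s) (- x + F i))%:C.
Proof.
rewrite horner_prod rmorph_prod/=; apply: eq_bigr => i _.
by rewrite hornerD hornerN hornerX hornerC rmorphD rmorphN.
Qed.

Lemma horner_prodB (I : Type) (s : seq I) (F : I -> R) (x : R) :
  (\prod_(i <- s) ('X - ((F i)%:C)%:P)).[x%:C] = (\prod_(i <- s) (x - F i))%:C.
Proof.
rewrite horner_prod rmorph_prod/=; apply: eq_bigr => i _.
by rewrite hornerXsubC rmorphB.
Qed.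

Lemma abs_ratfun_real (g d : {poly C}) (x u v : R) :
  g.[x%:C] = u%:C -> d.[x%:C] = v%:C ->
  abs_ratfun g d x = if v == 0 then +oo%E else (`|u / v|)%:E.
Proof.
move=> gu dv; rewrite /abs_ratfun gu dv.
rewrite (_ : (v%:C == 0) = (v == 0)); last first.
  by apply/eqP/eqP => [[]|->].
by case: ifP => // _; rewrite -fmorphV -rmorphM normc_real.
Qed.

(** Reflection inverts the rational function, so the supremum on [[a, b]] and the inverse of the
    infimum on [[- b, - a]] are both at most [G]. *)
Lemma zolotarev_ratio_le (a b : R) (l : nat) (y : 'I_l -> R) (G : R) :
  0 < a -> a <= b -> 0 < G -> (forall j, 0 < y j) ->
  (forall x, a <= x <= b -> \prod_j `|(x - y j) / (x + y j)| <= G) ->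
  (zolotarev_ratio a b (\prod_j ('X - ((y j)%:C)%:P))
     (\prod_j ('X + ((y j)%:C)%:P)) <= (G ^+ 2)%:E)%E.
Proof.
move=> a0 ab G0 y0 yG.
have val x : abs_ratfun (\prod_j ('X - ((y j)%:C)%:P))
     (\prod_j ('X + ((y j)%:C)%:P)) x =
  if \prod_j (x + y j) == 0 then +oo%E else (`|\prod_j (x - y j) / \prod_j (x + y j)|)%:E.
  by apply: abs_ratfun_real; [exact: horner_prodB|exact: horner_prodD].
have normE x : `|\prod_j (x - y j) / \prod_j (x + y j)|
    = \prod_j `|(x - y j) / (x + y j)|.
  by rewrite -prodf_div normr_prod.
rewrite /zolotarev_ratio expr2 EFinM.
apply: lee_pmul => //.
- apply: (@le_trans _ _ (abs_ratfun (\prod_j ('X - ((y j)%:C)%:P))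
     (\prod_j ('X + ((y j)%:C)%:P)) a)).
    by rewrite val; case: ifP => // _; rewrite lee_fin.
  by apply: ereal_sup_ubound; exists a => //; rewrite /= in_itv/= lexx.
- rewrite inve_ge0; apply: le_ereal_inf_tmp => _ [x _ <-].
  by rewrite val; case: ifP => // _; rewrite lee_fin.
- apply: ge_ereal_sup => _ [x /= xab <-]; rewrite in_itv/= in xab.
  have x0 : 0 < x by case/andP: xab => h _; exact: lt_le_trans h.
  rewrite val gt_eqF; last by apply: prodr_gt0 => j _; rewrite addr_gt0.
  by rewrite normE lee_fin yG.
- apply: inve_le => //; apply: le_ereal_inf_tmp => _ [x /= xab <-].
  rewrite in_itv/= in xab.
  rewrite val; case: ifP => [_|/negbT h]; first by rewrite leey.
  have xab' : a <= - x <= b by apply/andP; split; case/andP: xab; lra.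
  have e : `|\prod_j (x - y j) / \prod_j (x + y j)|
       = (\prod_j `|(- x - y j) / (- x + y j)|)^-1.
    rewrite normE -prodfV; apply: eq_bigr => j _; rewrite -normfV invf_div.
    have -> : - x + y j = - (x - y j) by ring.
    have -> : - x - y j = - (x + y j) by ring.
    by rewrite invrN mulrNN.
  rewrite lee_fin e lef_pV2 ?posrE ?yG//.
  apply: prodr_gt0 => j _; rewrite normr_gt0 mulf_neq0 ?invr_eq0//.
    move/prodf_neq0: h => /(_ j isT).
    by rewrite -oppr_eq0; congr (_ != 0); ring.
  have yj := y0 j; have /andP[h1 _] := xab'; rewrite gt_eqF//; lra.
Qed.

Lemma half_grid_prod_gt0 (h : R) M : 0 < h -> 0 < half_grid_prod h M.
Proof.
move=> h0; apply: prodr_gt0 => m _; rewrite exprn_gt0// divr_gt0//.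
by rewrite subr_gt0 expR_lt1 oppr_lt0 mulr_gt0// ltr_wpDl.
Qed.

(** The values at [x] and [- x] alone show that the optimal ratio is at least [r ^ 2]; by optimality
    it is at most the ratio [G ^ 2] allowed by the competitor. *)
Lemma zolotarev_poles_bound (a b : R) (l : nat) (psi : l.-tuple R) (M : nat) x :
  0 < a -> a < b -> (0 < l)%N -> zolotarev_poles a b psi -> a <= x <= b ->
  `|\prod_(p <- psi) ((x + p) / (x - p))|
  <= half_grid_prod (ln (4 * b / a) / l%:R) M.
Proof.
move=> a0 ab l0 [psi_ab opt] xab.
have [y [y0 yG]] := zolotarev_nodes a0 ab l0.
have l0' : 0 < l%:R :> R by rewrite ltr0n.
have L0 : 0 < ln (4 * b / a) by rewrite ln_gt0// ltr_pdivlMr//; lra.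
have G0 := half_grid_prod_gt0 M (divr_gt0 L0 l0').
set G := half_grid_prod _ _ in G0 *.
pose g : {poly C} := \prod_j ('X - ((y j)%:C)%:P).
pose d : {poly C} := \prod_j ('X + ((y j)%:C)%:P).
have dE : d = \prod_j ('X - ((- y j)%:C)%:P).
  by apply: eq_bigr => j _; rewrite rmorphN polyCN opprK.
have sg : size g = l.+1 by rewrite size_prod_XsubC /index_enum -enumT size_enum_ord.
have sd : size d = l.+1.
  by rewrite dE size_prod_XsubC /index_enum -enumT size_enum_ord.
(* The zeros of [g] are positive and those of [d] are negative. *)
have cop : coprimep g d.
  apply: (big_ind (fun p => coprimep p d)) => [|p q hp hq|i _]; first exact: coprime1p.
    by rewrite coprimepMl hp.
  rewrite coprimep_sym coprimep_XsubC /root horner_prodD; apply/eqP => -[] /eqP.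
  by apply/negP; rewrite gt_eqF//; apply: prodr_gt0 => j _; rewrite addr_gt0.
have := opt g d; rewrite sg sd => /(_ (leqnn _) (leqnn _)).
rewrite -!size_poly_eq0 sg sd => /(_ isT isT cop) le1.
have le2 : (zolotarev_ratio a b g d <= (G ^+ 2)%:E)%E.
  by apply: zolotarev_ratio_le => //; [exact: ltW|move=> z zab; exact: yG].
have := le_trans le1 le2 => {le1 le2}.
set r := `|\prod_(p <- psi) _| => le12.
(* A zero of [r] is harmless here; once it is excluded, [- x] is not a pole. *)
have [r0|] := leP r 0; first exact: le_trans (ltW G0).
move=> r0.
have x0 : 0 < x by case/andP: xab => h _; exact: lt_le_trans h.
have psin p : p \in psi -> p < 0.
  by move=> /psi_ab /andP[_ h]; lra.
have dn0 : \prod_(p <- psi) (x - p) != 0.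
  by rewrite prodf_seq_neq0; apply/allP => p /psin p0 /=; rewrite gt_eqF//; lra.
pose A := \prod_(p <- psi) (x + p); pose B := \prod_(p <- psi) (- x + p).
have rE : `|A / B| = r.
  rewrite /r /A /B -prodf_div !normr_prod; apply: eq_bigr => p _.
  by rewrite !normrM !normfV -[`|x - p|]normrN opprB addrC [- x + p]addrC.
have B0 : B != 0.
  by rewrite prodf_seq_neq0; apply/allP => p /psin p0 /=; rewrite lt_eqF//; lra.
have A0 : A != 0 by apply: contraTneq r0 => A0; rewrite -rE A0 mul0r normr0 ltxx.
have at1 := abs_ratfun_real (horner_prodD psi id x) (horner_prodNXD psi id x).
rewrite -/A -/B (negbTE B0) rE in at1.
have := abs_ratfun_real (horner_prodD psi id (- x)) (horner_prodNXD psi id (- x)).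
rewrite opprK -/A -/B (negbTE A0) => at2.
have rE2 : `|B / A| = r^-1 by rewrite -rE -normfV invf_div.
rewrite rE2 in at2.
have : (r%:E * r%:E <= (G ^+ 2)%:E)%E.
  apply: le_trans le12; apply: lee_pmul; rewrite ?lee_fin ?(ltW r0)//.
    by rewrite -at1; apply: ereal_sup_ubound; exists x.
  apply: le_inve => //.
    apply: le_ereal_inf_tmp => _ [z _ <-]; rewrite /abs_ratfun; case: ifP => // _.
    by rewrite lee_fin; case: (_ / _) => u v; exact: sqrtr_ge0.
  rewrite -at2; apply: ereal_inf_lbound; exists (- x) => //.
  by rewrite /= in_itv/= !lerN2 andbC.
rewrite -EFinM lee_fin -expr2 ler_pXn2r// nnegrE ltW//.
Qed.

End ZolotarevBound.

(** * All-pass filters and rational approximation of exponentials *)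

Inductive expoly {R : realType} : (R -> R) -> Prop :=
| ExpolyMonomial n q : 0 < q -> expoly (fun t => t ^+ n * expR (- q * t))
| ExpolyAdd f g : expoly f -> expoly g -> expoly (fun t => f t + g t)
| ExpolyScale c f : expoly f -> expoly (fun t => c * f t).

Definition lowpass_spec {R : realType} (p : R) (f g : R -> R) : Prop :=
  g 0 = 0 /\ forall t : R, is_derive t 1 g (f t - p * g t).

Definition lowpass {R : realType} (p : R) (f : R -> R) : R -> R :=
  get [set g | expoly g /\ lowpass_spec p f g].

(* The filter with transfer function [(s - p) / (s + p)]. *)
Definition allpass {R : realType} (p : R) (f : R -> R) : R -> R :=
  fun t => f t - 2 * p * lowpass p f t.

Definition allpasses {R : realType} (s : seq R) (f : R -> R) : R -> R :=
  foldl (fun g p => allpass p g) f s.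

(** The energy stored in the cascade: with [g] the low-pass state of a stage, its term is
    [2 p g ^ 2], whose derivative is the squared input minus the squared output. *)
Fixpoint energy {R : realType} (s : seq R) (f : R -> R) (t : R) : R :=
  if s is p :: s' then
    (f t - allpass p f t) ^+ 2 / (2 * p) + energy s' (allpass p f) t
  else 0.

(** The stored energy for differentiated signals: [f + allpass p f = 2 g'] turns the term into
    [2 p g' ^ 2]. *)
Fixpoint derive_energy {R : realType} (s : seq R) (f : R -> R) (t : R) : R :=
  if s is p :: s' then
    p * (f t + allpass p f t) ^+ 2 / 2 + derive_energy s' (allpass p f) t
  else 0.

Section Filters.
Variable R : realType.
Implicit Types (f g : R -> R) (s : seq R) (p q t x : R).

Lemma expoly_derivable f : expoly f -> forall t, is_derive t 1 f ('D_1 f t).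
Proof.
move=> ef t; apply: derivableP; elim: ef => {f} [n q q0|f g _ df _ dg|c f _ df].
- apply: derivableM; last by case: (is_derive_expR_scale (- q) t).
  have -> : (fun t : R => t ^+ n) = (@idfun R) ^+ n.
    by apply/funext => y; rewrite exprfctE.
  by apply: derivableX; exact: derivable_id.
- exact: derivableD.
- by apply: derivableM => //; exact: derivable_cst.
Qed.

(** Decay like [1 / (1 + t)] is enough for the passage to large times in [allpasses_step]. *)
Lemma expoly_decay f : expoly f ->
  exists2 C, 0 <= C & forall t, 0 <= t -> `|f t| * (1 + t) <= C.
Proof.
elim=> {f} [n q q0|f g _ [C C0 fC] _ [D D0 gD]|c f _ [C C0 fC]].
- have mon m : exists2 C, 0 <= C & forall t, 0 <= t -> t ^+ m * expR (- q * t) <= C.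
    case: m => [|m].
      exists 1 => // t t0; rewrite expr0 mul1r expR_le1 mulNr oppr_le0.
      by rewrite mulr_ge0// ltW.
    exists ((m.+1)`!%:R / q ^+ m.+1).
      by rewrite divr_ge0// exprn_ge0// ltW.
    move=> t t0; rewrite ler_pdivlMr ?exprn_gt0//.
    have qt0 : 0 <= q * t by rewrite mulr_ge0// ltW.
    have h := expR_ge1Dxn m qt0; have f0 : 0 < (m.+1)`!%:R :> R by rewrite ltr0n fact_gt0.
    have h' : (q * t) ^+ m.+1 <= (m.+1)`!%:R * expR (q * t).
      by rewrite [leRHS]mulrC -ler_pdivrMr//; apply: le_trans h; rewrite lerDr.
    have -> : t ^+ m.+1 * expR (- q * t) * q ^+ m.+1 = (q * t) ^+ m.+1 / expR (q * t).
      by rewrite mulNr expRN exprMn; ring.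
    by rewrite ler_pdivrMr ?expR_gt0.
  have [C C0 h1] := mon n; have [D D0 h2] := mon n.+1.
  exists (C + D) => [|t t0]; first exact: addr_ge0.
  rewrite ger0_norm; last by rewrite mulr_ge0 ?exprn_ge0 ?expR_ge0.
  rewrite mulrDr mulr1; apply: lerD; first exact: h1.
  by rewrite mulrAC -exprSr h2.
- exists (C + D) => [|t t0]; first exact: addr_ge0.
  apply: le_trans (_ : (`|f t| + `|g t|) * (1 + t) <= _).
    by rewrite ler_wpM2r ?ler_normD//; lra.
  by rewrite mulrDl lerD ?fC ?gD.
- exists (`|c| * C) => [|t t0]; first by rewrite mulr_ge0.
  by rewrite normrM -mulrA ler_wpM2l// fC.
Qed.

Lemma is_derive_linear f g (a b df dg : R) t :
  is_derive t 1 f df -> is_derive t 1 g dg ->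
  is_derive t 1 (fun t => a * f t + b * g t) (a * df + b * dg).
Proof.
by move=> ? ?; apply: is_derive_eq; rewrite /GRing.scale/=; ring.
Qed.

(** The class [expoly] is closed under filtering. Away from resonance, the response to degree
    [n + 1] reduces to that of degree [n] through integration by parts. *)
Lemma lowpass_exists p f : 0 < p -> expoly f ->
  exists g, expoly g /\ lowpass_spec p f g.
Proof.
move=> p0; elim=> {f} [n q q0|f g _ [u [eu [u0 du]]] _ [v [ev [v0 dv]]]
                      |c f _ [u [eu [u0 du]]]].
- have dmon (m : nat) (r : R) t : is_derive t 1 (fun t => t ^+ m * expR (- r * t))
      (m%:R * t ^+ m.-1 * expR (- r * t) - r * (t ^+ m * expR (- r * t))).
    have h1 : is_derive t 1 (fun y : R => y ^+ m) (m%:R * t ^+ m.-1).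
      have -> : (fun y : R => y ^+ m) = (@idfun R) ^+ m.
        by apply/funext => y; rewrite exprfctE.
      by apply: is_derive_eq; rewrite /GRing.scale/= mulr1.
    have h2 := is_derive_expR_scale (- r) t.
    by apply: is_derive_eq; rewrite /GRing.scale/=; ring.
  (* At resonance the response has a degree one higher, which is why polynomial factors belong to
     the class. *)
  have [pq|pq] := eqVneq q p.
    exists (fun t => (n.+1%:R)^-1 * (t ^+ n.+1 * expR (- q * t))); split.
      by apply: ExpolyScale; exact: ExpolyMonomial.
    split=> [|t]; first by rewrite expr0n/= mul0r mulr0.
    have n0 : (n.+1%:R : R) != 0 by rewrite pnatr_eq0.
    have ? := dmon n.+1 q t; apply: is_derive_eq; rewrite /GRing.scale/= -pq.
    by field.
  have pq' : p - q != 0 by rewrite subr_eq0 eq_sym.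
  elim: n => [|n [g [eg [g0 dg]]]].
    exists (fun t => (p - q)^-1 * (t ^+ 0 * expR (- q * t))
                     + (- (p - q)^-1) * (t ^+ 0 * expR (- p * t))).
    split; first by apply: ExpolyAdd; apply: ExpolyScale; exact: ExpolyMonomial.
    split=> [|t]; first by rewrite !mulr0 expR0; ring.
    have ? := dmon 0%N q t; have ? := dmon 0%N p t.
    apply: is_derive_eq; rewrite /GRing.scale/= !expr0.
    by field.
  exists (fun t => (p - q)^-1 * (t ^+ n.+1 * expR (- q * t))
                   + (- (n.+1%:R / (p - q))) * g t).
  split; first by apply: ExpolyAdd; apply: ExpolyScale => //; exact: ExpolyMonomial.
  split=> [|t]; first by rewrite g0 expr0n/= mul0r !mulr0 addr0.
  have ? := dmon n.+1 q t; have ? := dg t.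
  apply: is_derive_eq; rewrite /GRing.scale/=.
  by field.
- exists (fun t => u t + v t); split; first exact: ExpolyAdd.
  split=> [|t]; first by rewrite u0 v0 addr0.
  by have ? := du t; have ? := dv t; apply: is_derive_eq; ring.
- exists (fun t => c * u t); split; first exact: ExpolyScale.
  split=> [|t]; first by rewrite u0 mulr0.
  by have ? := du t; apply: is_derive_eq; rewrite /GRing.scale/=; ring.
Qed.

Lemma lowpassP p f : 0 < p -> expoly f ->
  expoly (lowpass p f) /\ lowpass_spec p f (lowpass p f).
Proof.
by move=> p0 ef; have [g gP] := lowpass_exists p0 ef; 
exact: (@getI _ [set g | expoly g /\ lowpass_spec p f g] g gP).
Qed.

Lemma lowpass_unique p f g1 g2 :
  lowpass_spec p f g1 -> lowpass_spec p f g2 -> g1 = g2.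
Proof.
move=> [g10 dg1] [g20 dg2]; apply/funext => t.
pose w (t : R) := (g1 t - g2 t) * expR (p * t).
have dw (y : R) : is_derive y 1 w 0.
  have ? := dg1 y; have ? := dg2 y; have ? := is_derive_expR_scale p y.
  by apply: is_derive_eq; rewrite /GRing.scale/=; ring.
have := is_derive_0_is_cst t 0 dw; rewrite /w g10 g20 subrr mul0r => /eqP.
by rewrite mulf_eq0 expR_eq0 orbF subr_eq0 => /eqP.
Qed.

Lemma expoly_allpass p f : 0 < p -> expoly f -> expoly (allpass p f).
Proof.
move=> p0 ef; have [el _] := lowpassP p0 ef.
rewrite /allpass (_ : (fun t => _) = (fun t => f t + (- (2 * p)) * lowpass p f t)).
  by apply: ExpolyAdd => //; exact: ExpolyScale.
by apply/funext => t; rewrite mulNr.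
Qed.

Lemma expoly_allpasses s f :
  {in s, forall p, 0 < p} -> expoly f -> expoly (allpasses s f).
Proof.
elim: s f => [//|p s ih] f sp ef /=; apply: ih.
  by move=> q qs; apply: sp; rewrite inE qs orbT.
by apply: expoly_allpass => //; apply: sp; rewrite mem_head.
Qed.

Lemma expoly_linear (a b : R) f g : expoly f -> expoly g ->
  expoly (fun t => a * f t + b * g t).
Proof. by move=> ef eg; apply: ExpolyAdd; exact: ExpolyScale. Qed.

Lemma allpass_linear p (a b : R) f g : 0 < p -> expoly f -> expoly g ->
  allpass p (fun t => a * f t + b * g t)
  = (fun t => a * allpass p f t + b * allpass p g t).
Proof.
move=> p0 ef eg; have [_ [f0 df]] := lowpassP p0 ef.
have [_ [g0 dg]] := lowpassP p0 eg.
have [_ spec] := lowpassP p0 (expoly_linear a b ef eg).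
rewrite /allpass (lowpass_unique (g2 := fun t => a * lowpass p f t + b * lowpass p g t) spec).
  by apply/funext => t; ring.
split=> [|t]; first by rewrite f0 g0; ring.
have h := is_derive_linear a b (df t) (dg t).
by apply: is_derive_eq h _; ring.
Qed.

Lemma allpasses_linear s (a b : R) f g : {in s, forall p, 0 < p} ->
  expoly f -> expoly g ->
  allpasses s (fun t => a * f t + b * g t)
  = (fun t => a * allpasses s f t + b * allpasses s g t).
Proof.
elim: s f g => [//|p s ih] f g sp ef eg /=.
have p0 : 0 < p by apply: sp; rewrite mem_head.
have sp' : {in s, forall p, 0 < p} by move=> q qs; apply: sp; rewrite inE qs orbT.
have [ef' eg'] := (expoly_allpass p0 ef, expoly_allpass p0 eg).
by rewrite allpass_linear// ih.
Qed.

Lemma allpass0 p f : 0 < p -> expoly f -> allpass p f 0 = f 0.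
Proof.
by move=> p0 ef; have [_ [f0 _]] := lowpassP p0 ef; rewrite /allpass f0 mulr0 subr0.
Qed.

Lemma allpass_derive p f t : 0 < p -> expoly f ->
  'D_1 (allpass p f) t = 'D_1 f t - p * f t - p * allpass p f t.
Proof.
move=> p0 ef; have [_ [_ df]] := lowpassP p0 ef.
have ? := df t; have ? := expoly_derivable ef t.
have h : is_derive t 1 (allpass p f) ('D_1 f t - p * f t - p * allpass p f t).
  by apply: is_derive_eq; rewrite /GRing.scale/= /allpass; ring.
by rewrite derive_val.
Qed.

Lemma energy_derive s f t : {in s, forall p, 0 < p} -> expoly f ->
  is_derive t 1 (energy s f) (f t ^+ 2 - allpasses s f t ^+ 2).
Proof.
elim: s f => [|p s ih] f sp ef /=; first by rewrite subrr; exact: is_derive_cst.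
have p0 : 0 < p by apply: sp; rewrite mem_head.
have sp' : {in s, forall p, 0 < p} by move=> q qs; apply: sp; rewrite inE qs orbT.
have ea := expoly_allpass p0 ef; have h := ih _ sp' ea.
have ? := expoly_derivable ef t; have ? := expoly_derivable ea t.
have d2 : is_derive t 1 (fun t => (f t - allpass p f t) ^+ 2 / (2 * p))
    (f t ^+ 2 - allpass p f t ^+ 2).
  apply: is_derive_eq; rewrite /GRing.scale/= allpass_derive//.
  by field; rewrite gt_eqF.
have := is_deriveD d2 h; rewrite addrA subrK; exact.
Qed.

Lemma derive_energy_derive s f t : {in s, forall p, 0 < p} -> expoly f ->
  is_derive t 1 (derive_energy s f) ('D_1 f t ^+ 2 - 'D_1 (allpasses s f) t ^+ 2).
Proof.
elim: s f => [|p s ih] f sp ef /=; first by rewrite subrr; exact: is_derive_cst.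
have p0 : 0 < p by apply: sp; rewrite mem_head.
have sp' : {in s, forall p, 0 < p} by move=> q qs; apply: sp; rewrite inE qs orbT.
have ea := expoly_allpass p0 ef; have h := ih _ sp' ea.
have ? := expoly_derivable ef t; have ? := expoly_derivable ea t.
have d2 : is_derive t 1 (fun t => p * (f t + allpass p f t) ^+ 2 / 2)
    ('D_1 f t ^+ 2 - 'D_1 (allpass p f) t ^+ 2).
  apply: is_derive_eq; rewrite /GRing.scale/= allpass_derive//.
  by field.
have := is_deriveD d2 h; rewrite addrA subrK; exact.
Qed.

Lemma energy_ge0 s f t : {in s, forall p, 0 < p} -> 0 <= energy s f t.
Proof.
elim: s f => [//|p s ih] f sp /=; apply: addr_ge0.
  by rewrite divr_ge0 ?sqr_ge0// mulr_ge0// ltW// sp ?mem_head.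
by apply: ih => q qs; apply: sp; rewrite inE qs orbT.
Qed.

Lemma derive_energy_ge0 s f t : {in s, forall p, 0 < p} -> 0 <= derive_energy s f t.
Proof.
elim: s f => [//|p s ih] f sp /=; apply: addr_ge0.
  by rewrite divr_ge0// mulr_ge0 ?sqr_ge0// ltW// sp ?mem_head.
by apply: ih => q qs; apply: sp; rewrite inE qs orbT.
Qed.

Lemma energy0 s f : {in s, forall p, 0 < p} -> expoly f -> energy s f 0 = 0.
Proof.
elim: s f => [//|p s ih] f sp ef /=.
have p0 : 0 < p by apply: sp; rewrite mem_head.
have sp' : {in s, forall p, 0 < p} by move=> q qs; apply: sp; rewrite inE qs orbT.
have ef' := expoly_allpass p0 ef.
by rewrite allpass0// subrr expr0n/= mul0r add0r ih.
Qed.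

(** The states vanish at [0], but their derivatives equal the input there; hence the condition
    [f 0 = 0], met by a difference of two exponentials. *)
Lemma derive_energy0 s f : {in s, forall p, 0 < p} -> expoly f -> f 0 = 0 ->
  derive_energy s f 0 = 0.
Proof.
elim: s f => [//|p s ih] f sp ef f0 /=.
have p0 : 0 < p by apply: sp; rewrite mem_head.
have sp' : {in s, forall p, 0 < p} by move=> q qs; apply: sp; rewrite inE qs orbT.
have ef' := expoly_allpass p0 ef.
by rewrite ih ?allpass0// f0; ring.
Qed.

Lemma allpasses0 s f : {in s, forall p, 0 < p} -> expoly f -> allpasses s f 0 = f 0.
Proof.
elim: s f => [//|p s ih] f sp ef /=.
have p0 : 0 < p by apply: sp; rewrite mem_head.
have sp' : {in s, forall p, 0 < p} by move=> q qs; apply: sp; rewrite inE qs orbT.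
have ef' := expoly_allpass p0 ef.
by rewrite ih// allpass0.
Qed.

End Filters.

Section ExponentialApproximation.
Variable R : realType.
Implicit Types (f g : R -> R) (s : seq R) (p q t x z : R).

Lemma expoly_expR z : 0 < z -> expoly (fun t => expR (- z * t)).
Proof.
move=> z0; rewrite (_ : (fun t => _) = (fun t => t ^+ 0 * expR (- z * t))).
  exact: ExpolyMonomial.
by apply/funext => t; rewrite expr0 mul1r.
Qed.

Lemma norm_le_sqr (u c : R) : 0 <= c -> u ^+ 2 <= c ^+ 2 -> `|u| <= c.
Proof.
by move=> c0 uc; rewrite -(@ler_pXn2r _ 2%N) ?nnegrE// real_normK ?num_real.
Qed.

(* With [v] the filtered signal, [2 v ^ 2] is bounded by the initial value of
   [4 z (energy) + (derivative energy) / (4 z)]: [v ^ 2] plus this quantity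
   decreases, [v ^ 2] minus it increases to a non-positive limit. *)
Lemma allpasses_step s z t : {in s, forall p, 0 < p} -> 0 < z -> 0 <= t ->
  `|allpasses s (fun t => expR (- z * t)) t
    - allpasses s (fun t => expR (- (16 * z) * t)) t| <= 129 / 100.
Proof.
move=> sp z0 t0.
have z160 : 0 < 16 * z by rewrite mulr_gt0.
pose X (t : R) := expR (- z * t); pose Y (t : R) := expR (- (16 * z) * t).
have [eX eY] : expoly X /\ expoly Y by split; exact: expoly_expR.
pose f (t : R) := 1 * X t + (- 1) * Y t.
have ef : expoly f by exact: expoly_linear.
set v := fun t => allpasses s X t - allpasses s Y t.
have vE : allpasses s f = v.
  by rewrite /f allpasses_linear//; apply/funext => y; rewrite /v; ring.
have ev : expoly v by rewrite -vE; exact: expoly_allpasses.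
have dX (y : R) : is_derive y 1 X (- z * X y) by exact: is_derive_expR_scale.
have dY (y : R) : is_derive y 1 Y (- (16 * z) * Y y) by exact: is_derive_expR_scale.
have df (y : R) : 'D_1 f y = - z * X y + 16 * z * Y y.
  have h := is_derive_linear 1 (- 1) (dX y) (dY y).
  by rewrite (@derive_val _ _ _ _ _ _ _ h); ring.
(* [D0] and [D1] are the integrals of [f ^ 2] and [f' ^ 2] over [[t, +oo[], in closed form. Added to
   the stored energies, they give the corresponding integrals for [v]. *)
pose D0 (t : R) := X t ^+ 2 / (2 * z) + Y t ^+ 2 / (32 * z) - 2 * (X t * Y t) / (17 * z).
pose D1 (t : R) := z * (X t ^+ 2 / 2 + 8 * Y t ^+ 2 - 32 / 17 * (X t * Y t)).
have dD0 (y : R) : is_derive y 1 D0 (- f y ^+ 2).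
  have ? := dX y; have ? := dY y; apply: is_derive_eq.
  by rewrite /GRing.scale/= /f; field; rewrite gt_eqF.
have dD1 (y : R) : is_derive y 1 D1 (- ('D_1 f y) ^+ 2).
  have ? := dX y; have ? := dY y; apply: is_derive_eq.
  by rewrite df /GRing.scale/=; field.
(* The weight [4 z] is the geometric mean of the rates [z] and [16 z]; it makes the two
   contributions to [H 0] equal. *)
pose H (t : R) := 4 * z * (energy s f t + D0 t)
  + (4 * z)^-1 * (derive_energy s f t + D1 t).
have dH (y : R) : is_derive y 1 H (- (4 * z * v y ^+ 2 + (4 * z)^-1 * 'D_1 v y ^+ 2)).
  have ? := energy_derive y sp ef; have ? := derive_energy_derive y sp ef.
  have ? := dD0 y; have ? := dD1 y.
  by apply: is_derive_eq; rewrite /GRing.scale/= vE; ring.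
have dG (y : R) : is_derive y 1 (fun y => v y ^+ 2) (2 * v y * 'D_1 v y).
  have ? := expoly_derivable ev y; apply: is_derive_eq.
  by rewrite /GRing.scale/=; ring.
have z40 : 0 < 4 * z by rewrite mulr_gt0.
have v0 : v 0 = 0 by rewrite /v !allpasses0// /X /Y !mulr0 expR0 subrr.
have sq (y : R) : 4 * z * v y ^+ 2 + (4 * z)^-1 * 'D_1 v y ^+ 2 + 2 * v y * 'D_1 v y
   = (4 * z * v y + 'D_1 v y) ^+ 2 / (4 * z).
  by field; rewrite gt_eqF.
have sq' (y : R) : 4 * z * v y ^+ 2 + (4 * z)^-1 * 'D_1 v y ^+ 2 - 2 * v y * 'D_1 v y
   = (4 * z * v y - 'D_1 v y) ^+ 2 / (4 * z).
  by field; rewrite gt_eqF.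
have pos (w : R) : 0 <= w ^+ 2 / (4 * z).
  by apply: divr_ge0; [exact: sqr_ge0|exact: ltW].
have sum2 (u w : R) : 0 <= u ^+ 2 + 16 * w ^+ 2.
  by have := sqr_ge0 u; have := sqr_ge0 w; lra.
have up : v t ^+ 2 + H t <= 225 / 68.
  have H0 : H 0 = 225 / 68.
    rewrite /H energy0// derive_energy0//; last first.
      by rewrite /f /X /Y !mulr0 expR0; ring.
    rewrite /D0 /D1 /X /Y !mulr0 expR0; field; by rewrite gt_eqF.
  have := @is_derive_ge0_le _ (fun y => - (v y ^+ 2 + H y))
    (fun y => (4 * z * v y - 'D_1 v y) ^+ 2 / (4 * z)) 0 t t0.
  rewrite v0 expr0n/= add0r H0 lerN2; apply=> // y _.
  have ? := dG y; have ? := dH y; apply: is_derive_eq.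
  by rewrite -sq'; ring.
have low T : t <= T -> v t ^+ 2 - H t <= v T ^+ 2.
  move=> tT.
  have h := @is_derive_ge0_le _ (fun y => v y ^+ 2 - H y)
    (fun y => (4 * z * v y + 'D_1 v y) ^+ 2 / (4 * z)) t T tT.
  have H0 : 0 <= H T.
    have D0T : 0 <= D0 T.
      have -> : D0 T = ((16 * X T - Y T) ^+ 2 + 16 * (X T - Y T) ^+ 2) / (544 * z).
        by rewrite /D0; field; rewrite gt_eqF.
      apply: divr_ge0; first exact: (sum2 (16 * X T - Y T) (X T - Y T)).
      by lra.
    have D1T : 0 <= D1 T.
      have -> : D1 T = z * (((X T - 16 * Y T) ^+ 2 + 16 * (X T - Y T) ^+ 2) / 34).
        by rewrite /D1; field.
      apply: mulr_ge0; first exact: ltW.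
      apply: divr_ge0 => //; exact: (sum2 (X T - 16 * Y T) (X T - Y T)).
    apply: addr_ge0; apply: mulr_ge0; rewrite ?invr_ge0 ?(ltW z40)// addr_ge0//.
      exact: energy_ge0.
    exact: derive_energy_ge0.
  have : v t ^+ 2 - H t <= v T ^+ 2 - H T.
    apply: h => // y _; have ? := dG y; have ? := dH y; apply: is_derive_eq.
    by rewrite -sq; ring.
  by lra.
have lim : v t ^+ 2 - H t <= 0.
  have [C C0 vC] := expoly_decay ev.
  rewrite leNgt; apply/negP; set d := _ - _ => d0.
  (* At this time [d * (1 + T)] exceeds [C ^ 2], against the decay of [v]. *)
  pose T := t + C ^+ 2 / d.
  have q0 : 0 <= C ^+ 2 / d by rewrite divr_ge0 ?sqr_ge0// ltW.
  have tT : t <= T by rewrite /T lerDl.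
  have T0 : 0 <= T by exact: le_trans tT.
  have h1 := low T tT.
  have h2 : v T ^+ 2 * (1 + T) <= C ^+ 2.
    apply: (@le_trans _ _ ((`|v T| * (1 + T)) ^+ 2)).
      rewrite exprMn real_normK ?num_real// ler_wpM2l ?sqr_ge0//.
      by rewrite expr2 ler_peMl//; lra.
    by rewrite lerXn2r ?nnegrE ?vC// mulr_ge0//; lra.
  have h3 : d * (1 + T) <= C ^+ 2.
    by apply: le_trans h2; rewrite ler_wpM2r//; lra.
  have : d * (1 + T) = d * (1 + t) + C ^+ 2 by rewrite /T; field; rewrite gt_eqF.
  have : 0 < d * (1 + t) by rewrite mulr_gt0//; lra.
  by lra.
(* Adding [up] and [lim] gives [v ^ 2 <= 225 / 136], and [225 / 136 < 1.29 ^ 2]. *)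
have v2 : v t ^+ 2 <= (129 / 100) ^+ 2 by lra.
by apply: norm_le_sqr v2; lra.
Qed.

(** The energy of a single stage is at most the total, so a stage changes its input by at most the
    square root of [p / z], hence by at most [d]; the changes add up along the cascade. *)
Lemma allpasses_dist s f t (z d : R) : {in s, forall p, 0 < p <= z * d ^+ 2} ->
  0 < z -> 0 <= d -> energy s f t <= (2 * z)^-1 ->
  `|allpasses s f t - f t| <= (size s)%:R * d.
Proof.
move=> + z0 d0; elim: s f => [|p s ih] f sp /=.
  by rewrite subrr normr0 mul0r.
have /andP[p0 pz] : 0 < p <= z * d ^+ 2 by apply: sp; rewrite mem_head.
have sp' : {in s, forall p, 0 < p <= z * d ^+ 2}.
  by move=> q qs; apply: sp; rewrite inE qs orbT.
have sp0 : {in s, forall p, 0 < p} by move=> q /sp' /andP[].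
move=> en; have e0 := energy_ge0 (allpass p f) t sp0.
have sq0 : 0 <= (f t - allpass p f t) ^+ 2 / (2 * p).
  by rewrite divr_ge0 ?sqr_ge0// mulr_ge0// ltW.
have h1 := ih (allpass p f) sp'.
have h2 : `|allpass p f t - f t| <= d.
  apply: norm_le_sqr => //.
  have : (f t - allpass p f t) ^+ 2 / (2 * p) <= (2 * z)^-1 by lra.
  rewrite ler_pdivrMr ?mulr_gt0// => h.
  have -> : (allpass p f t - f t) ^+ 2 = (f t - allpass p f t) ^+ 2 by ring.
  apply: le_trans h _; rewrite (_ : (2 * z)^-1 * (2 * p) = p / z).
    by rewrite ler_pdivrMr// mulrC.
  by field; rewrite gt_eqF.
have h3 : `|allpasses s (allpass p f) t - allpass p f t| <= (size s)%:R * d.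
  by apply: h1; lra.
rewrite -natr1 mulrDl mul1r.
have -> : allpasses s (allpass p f) t - f t
  = (allpasses s (allpass p f) t - allpass p f t) + (allpass p f t - f t) by ring.
by apply: le_trans (ler_normD _ _) _; exact: lerD.
Qed.

(** The low-pass response to [exp (- x t)] is [(exp (- p t) - exp (- x t)) / (x - p)]; multiplying
    by [x - p] keeps the case [x = p]. The remaining filters act linearly. *)
Lemma allpasses_shift s p x t : {in s, forall p, 0 < p} -> 0 < p -> 0 < x ->
  (x - p) * allpasses (p :: s) (fun t => expR (- x * t)) t =
  (x + p) * allpasses s (fun t => expR (- x * t)) t
  - 2 * p * allpasses s (fun t => expR (- p * t)) t.
Proof.
move=> sp p0 x0 /=.
have [ex ep] := (expoly_expR x0, expoly_expR p0).
set X := fun t => expR (- x * t) in ex *.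
set P := fun t => expR (- p * t) in ep *.
have [el [l0 dl]] := lowpassP p0 ex.
have spec1 : lowpass_spec p (fun t => (x - p) * X t)
    (fun t => (x - p) * lowpass p X t).
  split=> [|y]; first by rewrite l0 mulr0.
  have := is_derive_linear (x - p) 0 (dl y) (dl y).
  rewrite (_ : (fun t => _) = (fun t => (x - p) * lowpass p X t)); last first.
    by apply/funext => u; rewrite mul0r addr0.
  by move=> h; apply: is_derive_eq h _; ring.
have spec2 : lowpass_spec p (fun t => (x - p) * X t) (fun t => 1 * P t + (- 1) * X t).
  split=> [|y]; first by rewrite /P /X !mulr0 expR0; ring.
  have h1 := is_derive_expR_scale (- p) y; have h2 := is_derive_expR_scale (- x) y.
  apply: is_derive_eq (is_derive_linear 1 (- 1) h1 h2) _.
  by rewrite /P /X; ring.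
have lE y : (x - p) * lowpass p X y = P y - X y.
  by have /(congr1 (fun f => f y)) := lowpass_unique spec1 spec2; lra.
have ea := expoly_allpass p0 ex.
have : (fun t => (x - p) * allpass p X t + 0 * X t)
    = (fun t => (x + p) * X t + (- (2 * p)) * P t).
  apply/funext => y; rewrite /allpass.
  have -> : (x - p) * (X y - 2 * p * lowpass p X y) =
    (x - p) * X y - 2 * p * ((x - p) * lowpass p X y) by ring.
  by rewrite lE; ring.
move=> /(congr1 (fun f => allpasses s f t)).
by rewrite !allpasses_linear//; lra.
Qed.

(** By [allpasses_shift], adding a pole multiplies the remainder by [(x - p) / (x + p)] up to a term
    [c * \prod_(q <- s) (x - q)] over the common denominator, where [c] is free of [x]; that term
    goes into the numerator. *)
Lemma expR_rational_approx s t : {in s, forall p, 0 < p} ->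
  exists2 N : {poly R}, (size N <= size s)%N & forall x, 0 < x ->
    expR (- x * t) - N.[x] / \prod_(p <- s) (x + p) =
    \prod_(p <- s) ((x - p) / (x + p)) * allpasses s (fun t => expR (- x * t)) t.
Proof.
elim: s => [_|p s ih sp].
  exists 0; first by rewrite size_poly0.
  by move=> x x0; rewrite horner0 mul0r subr0 big_nil mul1r.
have p0 : 0 < p by apply: sp; rewrite mem_head.
have sp' : {in s, forall p, 0 < p} by move=> q qs; apply: sp; rewrite inE qs orbT.
have [N sN NE] := ih sp'.
pose c := 2 * p * allpasses s (fun t => expR (- p * t)) t.
exists (N * ('X + p%:P) + c *: \prod_(q <- s) ('X - q%:P)).
  apply: leq_trans (size_polyD _ _) _; rewrite geq_max; apply/andP; split.
    apply: leq_trans (size_polyMleq _ _) _; rewrite size_XaddC/=.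
    by rewrite addn2.
  by apply: leq_trans (size_scale_leq _ _) _; rewrite size_prod_XsubC.
move=> x x0; have sh := allpasses_shift t sp' p0 x0.
rewrite hornerD hornerM hornerZ horner_prod !big_cons.
have -> : ('X + p%:P).[x] = x + p by rewrite hornerD hornerX hornerC.
have := NE x x0; rewrite prodf_div.
have -> : \prod_(q <- s) ('X - q%:P).[x] = \prod_(q <- s) (x - q).
  by apply: eq_bigr => q _; rewrite hornerXsubC.
rewrite -/c in sh; move: sh.
set E' := allpasses (p :: s) _ t; set E := allpasses s _ t.
have : \prod_(q <- s) (x + q) != 0.
  rewrite prodf_seq_neq0; apply/allP => q /sp' q0 /=; rewrite gt_eqF//; lra.
move: (\prod_(q <- s) (x - q)) (\prod_(q <- s) (x + q)) (expR _) N.[x].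
move=> A B e n B0 sh.
have xp : x + p != 0 by rewrite gt_eqF//; lra.
move=> h; have -> : (x - p) / (x + p) * (A / B) * E' = A / B / (x + p) * ((x - p) * E').
  by field; rewrite xp B0.
rewrite sh; have -> : e - (n * (x + p) + c * A) / ((x + p) * B)
   = (e - n / B) - c * A / ((x + p) * B) by field; rewrite xp B0.
by rewrite h; field; rewrite xp B0.
Qed.

Lemma expR_le_ratio t : 0 <= t < 1 -> expR (2 * t) <= (1 + t) / (1 - t).
Proof.
move=> /andP[t0 t1]; have := @ln_ratio_ge R 1 t; rewrite t0 t1 => /(_ isT).
rewrite big_ord1 mulr0 add0r divr1 expr1 expRN => h.
have e0 := expR_gt0 (2 * t).
by rewrite -[leLHS]invrK -[leRHS]invrK lef_pV2 ?posrE ?invr_gt0 ?divr_gt0 ?invf_div//; lra.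
Qed.

(** [exp 0.69] is the fourth power of [exp (2 * (69 / 800))], and [(107 / 90) ^ 4 < 2]. *)
Lemma ln2_ge : 69 / 100 <= ln 2 :> R.
Proof.
rewrite -[leLHS]expRK ler_ln ?posrE ?expR_gt0//.
have -> : 69 / 100 = 4%:R * (2 * (69 / 800)) :> R by field.
have h : expR (2 * (69 / 800)) <= 107 / 90 :> R.
  apply: le_trans (expR_le_ratio _) _; first by apply/andP; split; lra.
  by rewrite ler_pdivrMr; lra.
rewrite expRM_natl; move: (expR_ge0 (2 * (69 / 800) : R)) h; move: (expR _) => u u0 uc.
have u2 : u ^+ 2 <= 707 / 500 by nra.
by rewrite (exprM u 2 2); have := sqr_ge0 u; nra.
Qed.

(** The energy supplied by the input is at most [1 / (2 z)]. For [z >= l ^ 2 b] each of the [l]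
    stages then changes the signal by at most [1 / l], so the output differs from an input in
    [[0, 1]] by at most [1]. *)
Lemma allpasses_high s (b z t : R) : (0 < size s)%N ->
  {in s, forall p, 0 < p <= b} -> (size s)%:R ^+ 2 * b <= z -> 0 < z -> 0 <= t ->
  `|allpasses s (fun t => expR (- z * t)) t| <= 2.
Proof.
move=> s0 sp zb z0 t0.
have l0 : 0 < (size s)%:R :> R by rewrite ltr0n.
have sp0 : {in s, forall p, 0 < p} by move=> q /sp /andP[].
have ez := expoly_expR z0; set f := fun t => expR (- z * t) in ez *.
have f1 : 0 < f t <= 1.
  by rewrite expR_gt0 expR_le1 mulNr oppr_le0 mulr_ge0// ltW.
have en : energy s f t <= (2 * z)^-1.
  have dW (y : R) : is_derive y 1 (fun y => - (energy s f y + f y ^+ 2 / (2 * z)))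
      (allpasses s f y ^+ 2).
    have ? := energy_derive y sp0 ez; have ? := is_derive_expR_scale (- z) y.
    apply: is_derive_eq; rewrite /GRing.scale/= /f.
    by field; rewrite gt_eqF.
  have := is_derive_ge0_le t0 (fun y _ => dW y) (fun y _ => sqr_ge0 _).
  rewrite energy0// /f mulr0 expR0 expr1n add0r lerN2 mul1r.
  have : 0 <= expR (- z * t) ^+ 2 / (2 * z).
    by rewrite divr_ge0 ?sqr_ge0// mulr_ge0// ltW.
  by lra.
have bnd : {in s, forall p, 0 < p <= z * ((size s)%:R^-1) ^+ 2}.
  move=> p /sp /andP[-> pb] /=; apply: le_trans pb _.
  by rewrite exprVn ler_pdivlMr ?exprn_gt0// mulrC.
have d0 : 0 <= (size s)%:R^-1 :> R by rewrite invr_ge0.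
have := allpasses_dist bnd z0 d0 en; rewrite divff ?gt_eqF// => h.
have -> : allpasses s f t = (allpasses s f t - f t) + f t by rewrite subrK.
apply: le_trans (ler_normD _ _) _; case/andP: f1 => f0 f1.
by rewrite [`|f t|]gtr0_norm//; lra.
Qed.

Lemma allpasses_chain s (b x t : R) (n : nat) : (0 < size s)%N ->
  {in s, forall p, 0 < p <= b} -> 0 < x -> 0 <= t ->
  (size s)%:R ^+ 2 * b <= 16 ^+ n * x ->
  `|allpasses s (fun t => expR (- x * t)) t| <= 2 + n%:R * (129 / 100).
Proof.
move=> s0 sb + t0; have sp : {in s, forall p, 0 < p} by move=> q /sb /andP[].
elim: n x => [|n ih] x x0.
  by rewrite expr0 !mul1r mul0r addr0 => h; exact: allpasses_high h _ _.
rewrite [16 ^+ n.+1]exprSr -[leRHS]mulrA => h.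
have step := allpasses_step sp x0 t0.
have x16 : 0 < 16 * x by lra.
have {}ih := ih _ x16 h.
rewrite -natr1 mulrDl mul1r.
move: step ih; set u := allpasses _ _ _; set v := allpasses _ _ _ => step ih.
have -> : u = (u - v) + v by rewrite subrK.
by apply: le_trans (ler_normD _ _) _; lra.
Qed.

Lemma le_mul_of_le_div (u w k : R) : 0 <= u -> 276 / 100 <= w -> k <= u / w ->
  k <= 100 / 276 * u.
Proof.
move=> u0 wc ku; have w0 : 0 < w by lra.
have : 0 <= u * (w - 276 / 100) by apply: mulr_ge0 => //; lra.
move=> h; apply: le_trans ku _; rewrite ler_pdivrMr//; lra.
Qed.

Lemma allpasses_bound s (a b x t : R) : (0 < size s)%N -> 0 < a -> a < b ->
  {in s, forall p, 0 < p <= b} -> a <= x -> 0 <= t ->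
  `|allpasses s (fun t => expR (- x * t)) t|
  <= 329 / 100 + 47 / 100 * ln ((size s)%:R ^+ 2 * (b / a)).
Proof.
move=> s0 a0 ab sb ax t0.
set c := _ * (b / a).
have l1 : 1 <= (size s)%:R :> R by rewrite ler1n.
have c1 : 1 <= c.
  rewrite /c -[leLHS]mulr1 ler_pM// ?exprn_ege1//.
  by rewrite ler_pdivlMr// mul1r ltW.
have ln0 : 0 <= ln c by exact: ln_ge0.
have l2 := ln2_ge; have l20 : 0 < ln 2 :> R by lra.
have ln16 : ln (16 : R) = ln 2 *+ 4.
  by rewrite -lnXn//; congr ln; rewrite -natrX.
(* So many factors [16] lead from [a] up to [l ^ 2 b]. The constants are [3.29 = 2 + 1.29] and
   [0.47 >= 1.29 / 2.76], where [2.76 = 4 * 0.69] bounds [ln 16] from below. *)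
pose n := (Num.truncn (ln c / ln 16)).+1.
have q0 : 0 <= ln c / ln 16 by rewrite divr_ge0// ln16 mulrn_wge0// ltW.
have /andP[n1 n2] := truncn_itv q0.
have ln16p : 276 / 100 <= ln 16 :> R by rewrite ln16 -mulr_natr; lra.
have nc : c <= 16 ^+ n.
  rewrite -ler_ln ?posrE ?exprn_gt0//; last by lra.
  rewrite lnXn// -[leRHS]mulr_natl -ler_pdivrMr; last by lra.
  exact: ltW.
have bnd : (size s)%:R ^+ 2 * b <= 16 ^+ n * x.
  apply: (@le_trans _ _ (16 ^+ n * a)); last by rewrite ler_pM2l ?exprn_gt0.
  by rewrite -ler_pdivrMr// -mulrA.
have := allpasses_chain s0 sb (lt_le_trans a0 ax) t0 bnd.
have n3 : n%:R <= 1 + 100 / 276 * ln c.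
  by rewrite /n -natr1 addrC lerD2l; exact: (le_mul_of_le_div ln0 ln16p n1).
move=> h2; apply: le_trans h2 _; move: ln0 n3; clear.
by move: (n%:R) (ln c) => u w; lra.
Qed.

End ExponentialApproximation.

(** * Hermitian matrices *)

(* The real part of the Hermitian inner product is an inner product of the
   underlying real vector space, with the same norm. *)
Definition rdot {R : realType} (n : nat) (x y : 'cV[R[i]]_n) : R :=
  complex.Re ((x ^t* *m y) 0 0).

Section EuclideanNorm.
Variable R : realType.
Local Notation C := R[i].
Implicit Types (m n : nat).

Lemma ReD (z w : C) : complex.Re (z + w) = complex.Re z + complex.Re w.
Proof. by case: z w => [a b] [c d]. Qed.

Lemma ReM_real (r : R) (w : C) : complex.Re (r%:C * w) = r * complex.Re w.
Proof. by case: w => [c d] /=; rewrite mul0r subr0. Qed.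

Lemma Re_conj (z : C) : complex.Re (Num.conj z) = complex.Re z.
Proof. by case: z. Qed.

Lemma Re_sum (I : Type) (r : seq I) (P : pred I) (F : I -> C) :
  complex.Re (\sum_(i <- r | P i) F i) = \sum_(i <- r | P i) complex.Re (F i).
Proof. by elim/big_rec2: _ => // i x y _ <-; rewrite ReD. Qed.

Lemma adjmxM (m n p : nat) (A : 'M[C]_(m, n)) (B : 'M[C]_(n, p)) :
  (A *m B) ^t* = B ^t* *m A ^t*.
Proof. by rewrite trmx_mul map_mxM. Qed.

Lemma adjmxK (m n : nat) (A : 'M[C]_(m, n)) : (A ^t*) ^t* = A.
Proof. by apply/matrixP => i j; rewrite !mxE conjCK. Qed.

Lemma adjmx_tr (m n : nat) (A : 'M[C]_(m, n)) : A ^t* = (map_mx Num.conj A)^T.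
Proof. by apply/matrixP => i j; rewrite !mxE. Qed.

Lemma rdotC n (x y : 'cV[C]_n) : rdot x y = rdot y x.
Proof.
rewrite /rdot -[LHS]Re_conj; congr complex.Re.
have -> : y ^t* *m x = (x ^t* *m y) ^t* by rewrite adjmxM adjmxK.
by rewrite !mxE.
Qed.

Lemma rdotDr n (x y z : 'cV[C]_n) : rdot x (y + z) = rdot x y + rdot x z.
Proof. by rewrite /rdot mulmxDr mxE ReD. Qed.

Lemma rdotDl n (x y z : 'cV[C]_n) : rdot (x + y) z = rdot x z + rdot y z.
Proof. by rewrite rdotC rdotDr ![rdot z _]rdotC. Qed.

Lemma rdotZr n (r : R) (x y : 'cV[C]_n) : rdot x (r%:C *: y) = r * rdot x y.
Proof. by rewrite /rdot -scalemxAr mxE ReM_real. Qed.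

Lemma rdotZl n (r : R) (x y : 'cV[C]_n) : rdot (r%:C *: x) y = r * rdot x y.
Proof. by rewrite rdotC rdotZr rdotC. Qed.

Lemma rdotNr n (x y : 'cV[C]_n) : rdot x (- y) = - rdot x y.
Proof.
rewrite -[- y]scaleN1r (_ : -1 = (-1)%:C :> C); last by rewrite rmorphN rmorph1.
by rewrite rdotZr mulN1r.
Qed.

Lemma rdotBr n (x y z : 'cV[C]_n) : rdot x (y - z) = rdot x y - rdot x z.
Proof. by rewrite rdotDr rdotNr. Qed.

Lemma rdot_adj m n (A : 'M[C]_(m, n)) x y : rdot (A *m x) y = rdot x (A ^t* *m y).
Proof. by rewrite /rdot adjmxM mulmxA. Qed.

Lemma rdot_adjr m n (A : 'M[C]_(m, n)) x y : rdot x (A *m y) = rdot (A ^t* *m x) y.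
Proof. by rewrite rdot_adj adjmxK. Qed.

Lemma rdotxx n (x : 'cV[C]_n) :
  rdot x x = \sum_i Normc.normc (x i 0) ^+ 2.
Proof.
rewrite /rdot mxE Re_sum; apply: eq_bigr => i _; rewrite !mxE.
case: (x i 0) => [a b] /=; rewrite sqr_sqrtr ?addr_ge0 ?sqr_ge0//.
by rewrite mulNr opprK !expr2.
Qed.

Lemma enorm_ge0 n (x : 'cV[C]_n) : 0 <= enorm x.
Proof. exact: sqrtr_ge0. Qed.

Lemma enorm_sqr n (x : 'cV[C]_n) : enorm x ^+ 2 = rdot x x.
Proof.
by rewrite rdotxx /enorm sqr_sqrtr// sumr_ge0// => i _; exact: sqr_ge0.
Qed.

Lemma normc_le_enorm n (x : 'cV[C]_n) i : Normc.normc (x i 0) <= enorm x.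
Proof.
have n0 (z : C) : 0 <= Normc.normc z by case: z => a b; exact: sqrtr_ge0.
rewrite -(@ler_pXn2r _ 2%N) ?nnegrE ?enorm_ge0// enorm_sqr rdotxx.
by rewrite (bigD1 i)//= lerDl sumr_ge0// => j _; exact: sqr_ge0.
Qed.

Lemma enorm_eq0 n (x : 'cV[C]_n) : enorm x = 0 -> x = 0.
Proof.
move=> x0; apply/colP => i; rewrite mxE; apply: Normc.eq0_normc.
apply/eqP; rewrite eq_le -{1}x0 normc_le_enorm.
by case: (x i 0) => a b; exact: sqrtr_ge0.
Qed.

Lemma enorm0 n : enorm (0 : 'cV[C]_n) = 0.
Proof.
apply/eqP; rewrite -sqrf_eq0 enorm_sqr rdotxx big1// => i _.
by rewrite mxE Normc.normc0 expr0n.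
Qed.

Lemma rdot_le n (x y : 'cV[C]_n) : rdot x y <= enorm x * enorm y.
Proof.
have [x0|x0] := eqVneq (enorm x) 0.
  by rewrite (enorm_eq0 x0) /rdot trmx0 map_mx0 mul0mx mxE mulr_ge0 ?enorm_ge0.
have [y0|y0] := eqVneq (enorm y) 0.
  by rewrite (enorm_eq0 y0) /rdot mulmx0 mxE mulr_ge0 ?enorm_ge0.
have xp : 0 < enorm x by rewrite lt_def x0 enorm_ge0.
have yp : 0 < enorm y by rewrite lt_def y0 enorm_ge0.
have : 0 <= rdot ((enorm y)%:C *: x - (enorm x)%:C *: y)
                 ((enorm y)%:C *: x - (enorm x)%:C *: y).
  by rewrite -enorm_sqr sqr_ge0.
rewrite rdotBr ![rdot (_ - _) _]rdotC !rdotBr !rdotZr !rdotZl -!enorm_sqr.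
rewrite [rdot y x]rdotC; set a := enorm x in xp *; set b := enorm y in yp *.
set c := rdot x y => h.
have {h}: 0 <= a * b * (a * b - c).
  rewrite (_ : a * b * (a * b - c) = (b * (b * a ^+ 2) - b * (a * c)
    - (a * (b * c) - a * (a * b ^+ 2))) / 2); last by field.
  lra.
by rewrite pmulr_rge0 ?subr_ge0// mulr_gt0.
Qed.

Lemma enormD n (x y : 'cV[C]_n) : enorm (x + y) <= enorm x + enorm y.
Proof.
rewrite -(@ler_pXn2r _ 2%N) ?nnegrE ?addr_ge0 ?enorm_ge0// enorm_sqr.
rewrite rdotDl !rdotDr -!enorm_sqr [rdot y x]rdotC.
by have := rdot_le x y; lra.
Qed.

Lemma enormN n (x : 'cV[C]_n) : enorm (- x) = enorm x.
Proof.
apply/eqP; rewrite -(@eqrXn2 _ 2%N) ?enorm_ge0// !enorm_sqr rdotNr rdotC rdotNr.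
by rewrite opprK.
Qed.

Lemma enorm_isometry m n (U : 'M[C]_(m, n)) x :
  U ^t* *m U = 1%:M -> enorm (U *m x) = enorm x.
Proof.
move=> U1; apply/eqP; rewrite -(@eqrXn2 _ 2%N) ?enorm_ge0// !enorm_sqr.
by rewrite rdot_adj mulmxA U1 mul1mx.
Qed.

Lemma enorm_coisometry m n (U : 'M[C]_(m, n)) x :
  U ^t* *m U = 1%:M -> enorm (U ^t* *m x) <= enorm x.
Proof.
move=> U1; set w := U ^t* *m x.
have e : enorm w ^+ 2 <= enorm w * enorm x.
  rewrite enorm_sqr {1}/w rdot_adj adjmxK; apply: le_trans (rdot_le _ _) _.
  by rewrite enorm_isometry// mulrC.
have := enorm_ge0 w; have := enorm_ge0 x; have := enorm_ge0 w.
rewrite le_eqVlt => /orP[/eqP <-//|w0 _ _].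
by move: e; rewrite expr2 ler_pM2l.
Qed.

Lemma enorm_mulmx_bounded m n (M : 'M[C]_(m, n)) :
  exists K, forall x, enorm x <= 1 -> enorm (M *m x) <= K.
Proof.
have n0 (z : C) : 0 <= Normc.normc z by case: z => a b; exact: sqrtr_ge0.
exists (Num.sqrt (\sum_i (\sum_j Normc.normc (M i j)) ^+ 2)) => x x1.
apply: ler_wsqrtr; apply: ler_sum => i _.
have s0 : 0 <= \sum_j Normc.normc (M i j) by apply: sumr_ge0 => j _.
rewrite ler_pXn2r ?nnegrE// mxE.
elim/big_rec2: _ => [|j y z _ ih]; first by rewrite Normc.normc0.
apply: le_trans (le_normcD _ _) _; apply: lerD => //.
rewrite Normc.normcM ler_piMr// (le_trans _ x1)//.
exact: normc_le_enorm.
Qed.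

Lemma spectral_norm_ge m n (M : 'M[C]_(m, n)) x :
  enorm (M *m x) <= spectral_norm M * enorm x.
Proof.
have [x0|x0] := eqVneq (enorm x) 0.
  by rewrite x0 mulr0 (enorm_eq0 x0) mulmx0 enorm0.
have xp : 0 < enorm x by rewrite lt_def x0 enorm_ge0.
have enormZ (k : nat) (r : R) (y : 'cV[C]_k) : 0 <= r -> enorm (r%:C *: y) = r * enorm y.
  move=> r0; apply/eqP; rewrite -(@eqrXn2 _ 2%N) ?mulr_ge0 ?enorm_ge0// exprMn.
  by rewrite !enorm_sqr rdotZl rdotZr mulrA expr2.
have [K MK] := enorm_mulmx_bounded M.
set y := ((enorm x)^-1)%:C *: x.
have y1 : enorm y = 1 by rewrite enormZ ?invr_ge0 ?enorm_ge0// mulVf.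
have : enorm (M *m y) <= spectral_norm M.
  apply: sup_upper_bound; last by exists y => //=; rewrite y1.
  split; first by exists (enorm (M *m y)), y => //=; rewrite y1.
  by exists K => _ [z /= z1 <-]; exact: MK.
by rewrite /y -scalemxAr enormZ ?invr_ge0 ?enorm_ge0// mulrC ler_pdivrMr.
Qed.

Lemma spectral_norm_ge0 m n (M : 'M[C]_(m, n)) : 0 <= spectral_norm M.
Proof.
have [K MK] := enorm_mulmx_bounded M.
have <- : enorm (M *m 0) = 0 by rewrite mulmx0 enorm0.
apply: sup_upper_bound; last by exists 0 => //=; rewrite enorm0.
split; first by exists (enorm (M *m 0)), 0 => //=; rewrite enorm0.
by exists K => _ [z /= z1 <-]; exact: MK.
Qed.

Lemma spectral_norm_le m n (M : 'M[C]_(m, n)) (c : R) : 0 <= c ->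
  (forall x, enorm (M *m x) <= c * enorm x) -> spectral_norm M <= c.
Proof.
move=> c0 Mc; apply: ge_sup; first by exists (enorm (M *m 0)), 0 => //=; rewrite enorm0.
move=> _ [x /= x1 <-]; apply: le_trans (Mc x) _.
by rewrite ler_piMr.
Qed.

End EuclideanNorm.

Definition herm_between {R : realType} (n : nat) (A : 'M[R[i]]_n) (a b : R) : Prop :=
  A \is hermsymmx /\
  forall x, a * enorm x ^+ 2 <= rdot x (A *m x) <= b * enorm x ^+ 2.

Section UnitaryConjugate.
Variables (R : realType) (n : nat) (P : 'M[R[i]]_n) (e : 'I_n -> R).
Local Notation C := R[i].
Implicit Types (f g : R -> R).
Hypotheses (PadjP : P ^t* *m P = 1%:M) (PPadj : P *m P ^t* = 1%:M).

Definition eigfun f : 'M[C]_n :=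
  P ^t* *m diag_mx (\row_i (f (e i))%:C) *m P.

Lemma eigfunM f g : eigfun (fun x => f x * g x) = eigfun f *m eigfun g.
Proof.
rewrite /eigfun !mulmxA -[_ *m P *m P ^t*]mulmxA PPadj mulmx1.
rewrite -[_ *m diag_mx _ *m diag_mx _]mulmxA mulmx_diag.
have -> // : \row_i (f (e i) * g (e i))%:C =
   \row_i ((\row_i (f (e i))%:C) 0 i * (\row_i (g (e i))%:C) 0 i) :> 'rV[C]_n.
by apply/rowP => i; rewrite !mxE rmorphM.
Qed.

Lemma eigfunD f g : eigfun (fun x => f x + g x) = eigfun f + eigfun g.
Proof.
rewrite /eigfun -mulmxDl -mulmxDr -raddfD/=.
have -> // : \row_i (f (e i) + g (e i))%:C =
   \row_i (f (e i))%:C + \row_i (g (e i))%:C :> 'rV[C]_n.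
by apply/rowP => i; rewrite !mxE rmorphD.
Qed.

Lemma eigfun_cst (c : R) : eigfun (fun=> c) = (c%:C)%:M.
Proof.
rewrite /eigfun (_ : \row_i _ = const_mx c%:C); last by apply/rowP => i; rewrite !mxE.
by rewrite diag_const_mx mul_mx_scalar -scalemxAl PadjP scalemx1.
Qed.

Lemma eq_eigfun f g : (forall i, f (e i) = g (e i)) -> eigfun f = eigfun g.
Proof.
move=> fg; rewrite /eigfun (_ : \row_i (f (e i))%:C = \row_i (g (e i))%:C)//.
by apply/rowP => i; rewrite !mxE fg.
Qed.

Lemma eigfun_adj f : (eigfun f) ^t* = eigfun f.
Proof.
rewrite /eigfun !adjmxM adjmxK mulmxA.
have -> // : (diag_mx (\row_i (f (e i))%:C)) ^t* = diag_mx (\row_i (f (e i))%:C) :> 'M[C]_n.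
rewrite tr_diag_mx map_diag_mx (_ : map_mx _ _ = \row_i (f (e i))%:C)//.
by apply/rowP => i; rewrite !mxE; exact: conjc_real.
Qed.

Lemma rdot_eigfun f x :
  rdot x (eigfun f *m x) = \sum_i f (e i) * Normc.normc ((P *m x) i 0) ^+ 2.
Proof.
rewrite /eigfun -!mulmxA -rdot_adj; move: (P *m x) => y.
rewrite /rdot mxE Re_sum; apply: eq_bigr => i _; rewrite mul_diag_mx !mxE mulrCA.
rewrite ReM_real; congr (_ * _).
case: (y i 0) => [u v] /=; rewrite sqr_sqrtr ?addr_ge0 ?sqr_ge0//.
by rewrite mulNr opprK !expr2.
Qed.

End UnitaryConjugate.

Section HermitianFunctions.
Variable R : realType.
Local Notation C := R[i].
Implicit Types (m n : nat) (f g : R -> R) (a b : R).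

Lemma hermsymP n (A : 'M[C]_n) : reflect (A ^t* = A) (A \is hermsymmx).
Proof.
apply: (iffP (is_hermitianmxP _ _ _)); rewrite expr0 scale1r => h; last by rewrite h.
by rewrite -h.
Qed.

(* Opaque, as the conversion check would otherwise unfold the diagonalization
   algorithm. *)
Fact eigen_subproof n (A : 'M[C]_n) :
  {h : 'M[C]_n * ('I_n -> R) * ((R -> R) -> 'M[C]_n) |
    [/\ h.1.1 ^t* *m h.1.1 = 1%:M, h.1.1 *m h.1.1 ^t* = 1%:M,
        A \is hermsymmx -> h.2 id = A,
        h.2 =1 eigfun h.1.1 h.1.2 & h.2 = fun f => mxfun f A]}.
Proof.
set P := spectralmx A; set e := fun i => complex.Re (spectral_diag A 0 i).
exists (P, e, fun f => mxfun f A); split => //=.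
- by rewrite -invmx_unitary ?spectral_unitarymx// mulVmx// spectral_unit.
- exact/unitarymxP/spectral_unitarymx.
- move=> hA; rewrite [RHS](orthomx_spectralP (hermitian_normalmx hA)) /mxfun.
  have -> // : map_mx (fun z : C => (id (complex.Re z))%:C) (spectral_diag A) =
    spectral_diag A.
  apply/rowP => i; rewrite !mxE RRe_real//.
  by have /mxOverP := hermitian_spectral_diag_real hA; apply.
- move=> f; rewrite /mxfun /eigfun -invmx_unitary ?spectral_unitarymx//.
  have -> // : map_mx (fun z : C => (f (complex.Re z))%:C) (spectral_diag A) =
    \row_i (f (e i))%:C.
  by apply/rowP => i; rewrite !mxE.
Qed.

Definition eigmx n (A : 'M[C]_n) : 'M[C]_n := (sval (eigen_subproof A)).1.1.

Definition eigval n (A : 'M[C]_n) : 'I_n -> R := (sval (eigen_subproof A)).1.2.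

Definition hfun f n (A : 'M[C]_n) : 'M[C]_n := (sval (eigen_subproof A)).2 f.

Lemma mxfun_hfun f n (A : 'M[C]_n) : mxfun f A = hfun f A.
Proof. by rewrite /hfun; case: (svalP (eigen_subproof A)) => _ _ _ _ ->. Qed.

Lemma eigmx_adjM n (A : 'M[C]_n) : (eigmx A) ^t* *m eigmx A = 1%:M.
Proof. by rewrite /eigmx; case: (svalP (eigen_subproof A)). Qed.

Lemma eigmx_Madj n (A : 'M[C]_n) : eigmx A *m (eigmx A) ^t* = 1%:M.
Proof. by rewrite /eigmx; case: (svalP (eigen_subproof A)). Qed.

Lemma hfunE f n (A : 'M[C]_n) : hfun f A = eigfun (eigmx A) (eigval A) f.
Proof. by rewrite /hfun /eigmx /eigval; case: (svalP (eigen_subproof A)). Qed.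

Lemma hfun_id n (A : 'M[C]_n) : A \is hermsymmx -> hfun id A = A.
Proof. by rewrite /hfun; case: (svalP (eigen_subproof A)). Qed.

Lemma hfunM f g n (A : 'M[C]_n) :
  hfun (fun x => f x * g x) A = hfun f A *m hfun g A.
Proof. by rewrite !hfunE eigfunM//; exact: eigmx_Madj. Qed.

Lemma hfunD f g n (A : 'M[C]_n) :
  hfun (fun x => f x + g x) A = hfun f A + hfun g A.
Proof. by rewrite !hfunE eigfunD. Qed.

Lemma hfun_cst (c : R) n (A : 'M[C]_n) : hfun (fun=> c) A = (c%:C)%:M.
Proof. by rewrite !hfunE eigfun_cst//; exact: eigmx_adjM. Qed.

Lemma eq_hfun f g n (A : 'M[C]_n) :
  (forall i, f (eigval A i) = g (eigval A i)) -> hfun f A = hfun g A.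
Proof. by move=> fg; rewrite !hfunE; exact: eq_eigfun. Qed.

Lemma hfunZ (c : R) f n (A : 'M[C]_n) :
  hfun (fun x => c * f x) A = c%:C *: hfun f A.
Proof. by rewrite hfunM hfun_cst mul_scalar_mx. Qed.

Lemma hfun_adj f n (A : 'M[C]_n) : (hfun f A) ^t* = hfun f A.
Proof. by rewrite !hfunE eigfun_adj. Qed.

Lemma rdot_hfun f n (A : 'M[C]_n) x :
  rdot x (hfun f A *m x) =
  \sum_i f (eigval A i) * Normc.normc ((eigmx A *m x) i 0) ^+ 2.
Proof. by rewrite hfunE rdot_eigfun. Qed.

Lemma enorm_eigmx n (A : 'M[C]_n) x : enorm (eigmx A *m x) = enorm x.
Proof. by rewrite enorm_isometry//; exact: eigmx_adjM. Qed.

Lemma enorm_hfun_le f n (A : 'M[C]_n) (c : R) x : 0 <= c ->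
  (forall i, `|f (eigval A i)| <= c) -> enorm (hfun f A *m x) <= c * enorm x.
Proof.
move=> c0 fc; rewrite -(@ler_pXn2r _ 2%N) ?nnegrE ?mulr_ge0 ?enorm_ge0//.
rewrite exprMn enorm_sqr rdot_adj hfun_adj mulmxA -hfunM rdot_hfun.
rewrite -(enorm_eigmx A x) enorm_sqr rdotxx mulr_sumr.
apply: ler_sum => i _; rewrite ler_wpM2r ?sqr_ge0//.
by rewrite -expr2 -real_normK ?num_real// ler_pXn2r ?nnegrE.
Qed.

Lemma eigval_between n (A : 'M[C]_n) a b i :
  herm_between A a b -> a <= eigval A i <= b.
Proof.
move=> [hA /(_ ((eigmx A) ^t* *m delta_mx i 0))].
have dE j : Normc.normc ((delta_mx i 0 : 'cV[C]_n) j 0) ^+ 2 = (j == i)%:R.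
  rewrite mxE andbT; case: eqP => _; first by rewrite Normc.normc1 expr1n.
  by rewrite Normc.normc0 expr0n.
have -> : enorm ((eigmx A) ^t* *m delta_mx i 0) = 1.
  rewrite enorm_isometry ?adjmxK ?eigmx_Madj//.
  apply/eqP; rewrite -(@eqrXn2 _ 2%N) ?enorm_ge0// enorm_sqr rdotxx expr1n.
  rewrite (bigD1 i)//= dE eqxx big1 ?addr0// => j ji.
  by rewrite dE (negbTE ji).
have := rdot_hfun id A ((eigmx A) ^t* *m delta_mx i 0); rewrite hfun_id// => ->.
rewrite mulmxA eigmx_Madj mul1mx expr1n !mulr1.
rewrite (bigD1 i)//= dE eqxx mulr1 big1 ?addr0// => j ji.
by rewrite dE (negbTE ji) mulr0.
Qed.

Lemma herm_between_spectrum n (A : 'M[C]_n) a b :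
  A \is hermsymmx -> spectrum_in A a b -> herm_between A a b.
Proof.
move=> hA sA; split=> // x.
have ev i : a <= eigval A i <= b.
  have QA : eigmx A *m A = diag_mx (\row_i (eigval A i)%:C) *m eigmx A.
    rewrite -{2}(hfun_id hA) hfunE /eigfun !mulmxA eigmx_Madj mul1mx.
    by [].
  have /sA : eigenvalue A (eigval A i)%:C.
    apply/eigenvalueP; exists (row i (eigmx A)).
      by rewrite -row_mul QA row_mul row_diag_mx -scalemxAl -rowE mxE.
    apply/eqP => r0; have := eigmx_Madj A.
    move=> /(congr1 (row i)); rewrite row_mul r0 mul0mx => /rowP /(_ i).
    by rewrite !mxE eqxx => /eqP; rewrite eq_sym oner_eq0.
  by move=> /andP[]; rewrite !lecR => -> ->.
have := rdot_hfun id A x; rewrite hfun_id// => ->; rewrite -(enorm_eigmx A x).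
rewrite enorm_sqr rdotxx !mulr_sumr; apply/andP; split;
  by apply: ler_sum => i _; rewrite ler_wpM2r ?sqr_ge0//; case/andP: (ev i).
Qed.

Lemma herm_between_compress m n (A : 'M[C]_m) (U : 'M[C]_(m, n)) a b :
  herm_between A a b -> U ^t* *m U = 1%:M -> herm_between (U ^t* *m A *m U) a b.
Proof.
move=> [/hermsymP hA Aab] U1; split=> [|x].
  by apply/hermsymP; rewrite !adjmxM adjmxK hA mulmxA.
by rewrite -!mulmxA -rdot_adj -(enorm_isometry x U1).
Qed.

Lemma herm_between_tr n (A : 'M[C]_n) a b :
  herm_between A a b -> herm_between A^T a b.
Proof.
move=> [/hermsymP hA Aab]; split=> [|x].
  by apply/hermsymP; rewrite -[in RHS]hA !adjmx_tr trmxK.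
have eN : enorm (map_mx Num.conj x) = enorm x.
  apply/eqP; rewrite -(@eqrXn2 _ 2%N) ?enorm_ge0// !enorm_sqr !rdotxx.
  apply/eqP/eq_bigr => i _; rewrite mxE; congr (_ ^+ 2).
  by case: (x i 0) => u v /=; rewrite sqrrN.
have := Aab (map_mx Num.conj x); rewrite eN.
suff -> : rdot (map_mx Num.conj x) (A *m map_mx Num.conj x) = rdot x (A^T *m x) by [].
have e : x ^t* *m (A^T *m x) =
    ((map_mx Num.conj x) ^t* *m (A *m map_mx Num.conj x))^T.
  rewrite !trmx_mul mulmxA; congr (_ *m _ *m _); apply/matrixP => i j; rewrite !mxE ?conjCK//.
by rewrite /rdot e [in RHS]mxE.
Qed.

End HermitianFunctions.

(** On a finite spectrum every function is a polynomial. Polynomials in a matrix do not depend on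
    the diagonalization, so they serve to compare functions computed from unrelated ones. *)
Lemma interpolation_poly (F : fieldType) (f : F -> F) (s : seq F) :
  exists P : {poly F}, {in s, forall x, P.[x] = f x}.
Proof.
elim: s => [|x s [P Ps]]; first by exists 0.
have [xs|xs] := boolP (x \in s).
  by exists P => y; rewrite inE => /orP[/eqP ->|]; exact: Ps.
pose D := \prod_(y <- s) ('X - y%:P).
have Dx : D.[x] != 0.
  by apply/negP => /eqP/rootP; rewrite /D root_prod_XsubC => /(negP xs).
exists (P + ((f x - P.[x]) / D.[x]) *: D) => y; rewrite inE hornerD hornerZ.
move=> /orP[/eqP ->|ys]; first by rewrite divfK// addrC subrK.
have -> : D.[y] = 0 by apply/rootP; rewrite /D root_prod_XsubC.
by rewrite mulr0 addr0 Ps.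
Qed.

(** * Functions of a Kronecker difference *)

Section EigKron.
Variables (R : realType) (m n : nat).
Local Notation C := R[i].
Variables (Q : 'M[C]_m) (S : 'M[C]_n) (e : 'I_m -> R) (d : 'I_n -> R).
Hypotheses (QQ : Q *m Q ^t* = 1%:M) (SS : S *m S ^t* = 1%:M).
Variable F : 'M[C]_(m, n).
Implicit Types (f : R -> R).

Definition eigkron_coef f : 'M[C]_(m, n) :=
  \matrix_(i, j) ((f (e i - d j))%:C * (Q *m F *m S ^t*) i j).

(** In the eigenbases of the two coefficients, applying [f] to the Kronecker difference is an
    entrywise multiplication of [F]. *)
Definition eigkron f : 'M[C]_(m, n) := Q ^t* *m eigkron_coef f *m S.

Lemma eq_eigkron f g : (forall i j, f (e i - d j) = g (e i - d j)) ->
  eigkron f = eigkron g.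
Proof.
move=> fg; rewrite /eigkron; suff -> : eigkron_coef f = eigkron_coef g by [].
by apply/matrixP => i j; rewrite !mxE fg.
Qed.

Lemma eigkronX f : eigfun Q e id *m eigkron f - eigkron f *m eigfun S d id =
  eigkron (fun x => x * f x).
Proof.
rewrite /eigkron /eigfun; set W := eigkron_coef f.
rewrite !mulmxA -[_ *m Q *m Q ^t*]mulmxA QQ mulmx1.
rewrite -[_ *m S *m S ^t*]mulmxA SS mulmx1 -mulmxBl -!mulmxA -mulmxBr !mulmxA.
suff -> : eigkron_coef (fun x => x * f x) =
  diag_mx (\row_i (id (e i))%:C) *m W - W *m diag_mx (\row_j (id (d j))%:C) by [].
apply/matrixP => i j; rewrite mul_diag_mx mul_mx_diag /W /eigkron_coef.
move: (Q *m F *m S ^t*) => G; rewrite !mxE rmorphM rmorphB.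
by ring.
Qed.

Lemma eigkronD f g : eigkron (fun x => f x + g x) = eigkron f + eigkron g.
Proof.
rewrite /eigkron -mulmxDl -mulmxDr.
have -> // : eigkron_coef (fun x => f x + g x) = eigkron_coef f + eigkron_coef g.
rewrite /eigkron_coef; move: (Q *m F *m S ^t*) => G.
apply/matrixP => i j; rewrite !mxE. by rewrite rmorphD mulrDl.
Qed.

Lemma eigkron_cst (c : R) : Q ^t* *m Q = 1%:M -> S ^t* *m S = 1%:M ->
  eigkron (fun=> c) = c%:C *: F.
Proof.
move=> Q1 S1; rewrite /eigkron (_ : eigkron_coef _ = c%:C *: (Q *m F *m S ^t*)).
  by rewrite -scalemxAr -scalemxAl !mulmxA Q1 mul1mx -mulmxA S1 mulmx1.
by apply/matrixP => i j; rewrite !mxE.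
Qed.

Lemma eigkronM f g h : (forall x y, f (x - y) = g x * h y) ->
  eigkron f = eigfun Q e g *m F *m eigfun S d h.
Proof.
move=> fgh; rewrite /eigkron /eigfun; set G := Q *m F *m S ^t*.
have -> : eigkron_coef f = diag_mx (\row_i (g (e i))%:C) *m G *m diag_mx (\row_j (h (d j))%:C).
  rewrite /eigkron_coef -/G; move: G => G; apply/matrixP => i j.
  by rewrite mul_mx_diag mul_diag_mx !mxE fgh rmorphM mulrAC.
by rewrite /G !mulmxA.
Qed.

(** The coefficients are chosen before [f]: this order of quantifiers is what lets them be tested on
    exponentials and then integrated. *)
Lemma rdot_eigkron (v : 'cV[C]_m) (x : 'cV[C]_n) :
  exists c : 'I_m -> 'I_n -> R, forall f,
    rdot v (eigkron f *m x) = \sum_i \sum_j f (e i - d j) * c i j.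
Proof.
rewrite /eigkron /eigkron_coef; move: (Q *m F *m S ^t*) => G.
exists (fun i j => complex.Re
  (Num.conj ((Q *m v) i 0) * (G i j * (S *m x) j 0))) => f.
rewrite -!mulmxA -rdot_adj; move: (Q *m v) (S *m x) => Qv Sx.
rewrite /rdot mxE Re_sum; apply: eq_bigr => i _.
rewrite [X in _ * X]mxE mulr_sumr Re_sum; apply: eq_bigr => j _.
by rewrite -ReM_real !mxE; congr complex.Re; rewrite -[X in _ * X = _]mulrA [LHS]mulrCA.
Qed.

End EigKron.

Lemma hfun_hornerMXaddC (R : realType) (n : nat) (A : 'M[R[i]]_n) (P : {poly R}) (c : R) :
  A \is hermsymmx ->
  hfun (horner (P * 'X + c%:P)) A = A *m hfun (horner P) A + (c%:C)%:M.
Proof.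
move=> hA; rewrite (_ : horner _ = fun x => x * P.[x] + c); last first.
  by apply/funext => x; rewrite hornerMXaddC mulrC.
by rewrite (hfunD (fun x => x * P.[x]) (fun=> c)) (hfunM id (horner P)) hfun_cst hfun_id.
Qed.

Section KronFunctions.
Variables (R : realType) (m n : nat).
Local Notation C := R[i].
Variables (A : 'M[C]_m) (B : 'M[C]_n).
Hypotheses (hA : A \is hermsymmx) (hB : B \is hermsymmx).
Implicit Types (f : R -> R) (F : 'M[C]_(m, n)).

Lemma kron_diff_vec F : kron_diff A B *m vec F = vec (A *m F - F *m B).
Proof.
rewrite /kron_diff mulmxBl -[1%:M in X in X - _]trmx1 -!vec_kronecker.
by rewrite mulmx1 mul1mx /vec !linearB.
Qed.

Lemma kron_diff_herm : kron_diff A B \is hermsymmx.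
Proof.
move/hermsymP: hA => eA; move/hermsymP: hB => eB; apply/hermsymP.
rewrite /kron_diff raddfB/= map_mxB !trmx_tens !map_mxT eA !trmx1 !map_mx1.
congr (_ - _ *t _); rewrite -[in RHS]eB trmxK.
by apply/matrixP => i j; rewrite !mxE.
Qed.

(** The diagonalization of the Kronecker difference behind [hfun] is unrelated to those of [A] and
    [B]. Both sides agree for polynomials by Horner's scheme, so [f] is interpolated on the union of
    the two lists of eigenvalues. *)
Lemma unvec_hfun_kron f F : unvec (hfun f (kron_diff A B) *m vec F) =
  eigkron (eigmx A) (eigmx B) (eigval A) (eigval B) F f.
Proof.
set Q := eigmx A; set S := eigmx B; set e := eigval A; set d := eigval B.
set M := kron_diff A B.
have EA : A = eigfun Q e id by rewrite -hfunE hfun_id.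
have EB : B = eigfun S d id by rewrite -hfunE hfun_id.
have QQ : Q *m Q ^t* = 1%:M := eigmx_Madj A.
have SS : S *m S ^t* = 1%:M := eigmx_Madj B.
have hp (P : {poly R}) : hfun (horner P) M *m vec F = vec (eigkron Q S e d F (horner P)).
  elim/poly_ind: P => [|P c ih].
    rewrite (_ : horner 0 = fun=> 0); last by apply/funext => x; rewrite horner0.
    rewrite hfun_cst eigkron_cst ?eigmx_adjM// mul_scalar_mx !scale0r.
    by rewrite /vec !linear0.
  rewrite hfun_hornerMXaddC; last exact: kron_diff_herm.
  move: (hfun (horner P) M) ih => H ih.
  rewrite mulmxDl -(mulmxA M H) ih.
  rewrite (_ : horner (P * 'X + c%:P) = fun x => x * P.[x] + c); last first.
    by apply/funext => x; rewrite hornerMXaddC mulrC.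
  rewrite kron_diff_vec eigkronD eigkron_cst ?eigmx_adjM// mul_scalar_mx.
  rewrite EA EB eigkronX//.
  by rewrite /vec !linearD/= !linearZ.
have [P Pf] := interpolation_poly f
  (codom (eigval M) ++ codom (fun ij : 'I_m * 'I_n => e ij.1 - d ij.2)).
rewrite (@eq_hfun _ f (horner P)); last first.
  by move=> i; rewrite Pf// mem_cat; apply/orP; left; exact: codom_f.
rewrite hp vecK; apply: eq_eigkron => i j; rewrite Pf// mem_cat.
by apply/orP; right; exact: (codom_f _ (i, j)).
Qed.

End KronFunctions.

(** * Rational Krylov projections *)

Section MatrixPolynomials.
Variable R : realType.
Local Notation C := R[i].
Implicit Types (n : nat) (f g : R -> R) (P : {poly R}).

Lemma hfun_sum n (A : 'M[C]_n) m (F : 'I_m -> R -> R) :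
  hfun (fun x => \sum_i F i x) A = \sum_i hfun (F i) A.
Proof.
elim: m F => [|m ih] F.
  rewrite big_ord0 (@eq_hfun _ _ (fun=> 0)) ?hfun_cst ?raddf0// => i.
  by rewrite big_ord0.
rewrite big_ord_recr/= -ih -hfunD; apply: eq_hfun => i.
by rewrite big_ord_recr.
Qed.

Lemma hfunX n (A : 'M[C]_n) j : A \is hermsymmx -> hfun (fun x => x ^+ j) A = A ^+ j.
Proof.
move=> hA; elim: j => [|j ih]; first by rewrite hfun_cst.
transitivity (hfun id A *m hfun (fun x => x ^+ j) A).
  by rewrite -(hfunM id); apply: eq_hfun => i; rewrite exprS.
by rewrite hfun_id// ih exprS.
Qed.

Lemma hfun_tr n (A : 'M[C]_n) f : A \is hermsymmx -> hfun f A^T = (hfun f A)^T.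
Proof.
move=> hA; have hT : A^T \is hermsymmx.
  by apply/hermsymP; move/hermsymP: hA => eA; rewrite -[in RHS]eA !adjmx_tr trmxK.
have hp P : hfun (horner P) A^T = (hfun (horner P) A)^T.
  elim/poly_ind: P => [|P c ih].
    rewrite (_ : horner 0 = fun=> 0); last by apply/funext => x; rewrite horner0.
    by rewrite !hfun_cst tr_scalar_mx.
  rewrite hfun_hornerMXaddC// ih.
  rewrite (_ : horner (P * 'X + c%:P) = fun x => P.[x] * x + c); last first.
    by apply/funext => x; rewrite hornerMXaddC.
  rewrite (hfunD (fun x => P.[x] * x) (fun=> c)) (hfunM (horner P) id) hfun_cst.
  by rewrite hfun_id// raddfD/= trmx_mul tr_scalar_mx.
have [P Pf] := interpolation_poly f (codom (eigval A) ++ codom (eigval A^T)).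
rewrite (@eq_hfun _ f (horner P) _ A^T); last first.
  by move=> i; apply/esym/Pf; rewrite mem_cat; apply/orP; right; exact: codom_f.
rewrite (@eq_hfun _ f (horner P) _ A) ?hp// => i.
by apply/esym/Pf; rewrite mem_cat; apply/orP; left; exact: codom_f.
Qed.

End MatrixPolynomials.

Section RationalKrylov.
Variables (R : realType) (n k p : nat).
Local Notation C := R[i].
Variables (A : 'M[C]_n) (U : 'M[C]_(n, p)) (w : 'M[C]_(n, k)) (psi : seq R).
Hypotheses (hA : A \is hermsymmx) (U1 : U ^t* *m U = 1%:M).
Let D : {poly R} := \prod_(y <- psi) ('X - y%:P).
Let Al := U ^t* *m A *m U.
Hypotheses (DA : forall i, D.[eigval A i] != 0).
Hypotheses (DAl : forall i, D.[eigval Al i] != 0).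
Hypothesis (hK : (rat_krylov A w (real_poles psi) <= U^T)%MS).

Lemma rk_den_hfun : rk_den A (real_poles psi) = hfun (horner D) A.
Proof.
rewrite /rk_den /real_poles /D.
have -> : pmap id [seq Some x%:C | x <- psi] = [seq x%:C | x <- psi].
  by elim: psi => //= y s ->.
rewrite big_map; elim: psi => [|y s ih].
  rewrite !big_nil (@eq_hfun _ _ (fun=> 1)) ?hfun_cst// => i.
  by rewrite hornerC.
rewrite !big_cons ih -mulmxE.
rewrite [RHS](@eq_hfun _ _ (fun x => (x + - y) * (\prod_(j <- s) ('X - j%:P)).[x])); last first.
  by move=> i; rewrite hornerM hornerXsubC.
rewrite (hfunM (fun x => x + - y)) (hfunD id (fun=> - y)) hfun_cst hfun_id//.
by rewrite rmorphN raddfN.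
Qed.

Let s := hfun (fun x => (D.[x])^-1) A *m w.

Lemma invmx_rk_den : invmx (rk_den A (real_poles psi)) = hfun (fun x => (D.[x])^-1) A.
Proof.
have DD : hfun (fun x => (D.[x])^-1) A *m hfun (horner D) A = 1%:M.
  rewrite -hfunM (@eq_hfun _ _ (fun=> 1)) ?hfun_cst// => i.
  by rewrite mulVf.
rewrite rk_den_hfun; have [_ uD] := mulmx1_unit DD.
by rewrite -[LHS]mul1mx -DD mulmxK.
Qed.

Lemma krylov_power_fix j : (j <= size psi)%N ->
  U *m U ^t* *m (A ^+ j *m s) = A ^+ j *m s.
Proof.
move=> jl.
have e : invmx (rk_den A (real_poles psi)) *m A ^+ j *m w = A ^+ j *m s.
  rewrite invmx_rk_den /s mulmxA -(hfunX j hA) -!hfunM; congr (_ *m w).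
  by apply: eq_hfun => i; rewrite mulrC.
have jl' : (j < (size (real_poles psi)).+1)%N by rewrite size_map.
have : ((A ^+ j *m s)^T <= U^T)%MS.
  rewrite -e; apply: submx_trans hK.
  rewrite /rat_krylov (sumsmx_sup (Ordinal jl'))//=.
  by rewrite genmxE.
move=> /submxP[Z eZ].
have -> : A ^+ j *m s = U *m Z^T by rewrite -[LHS]trmxK eZ trmx_mul trmxK.
by rewrite -!mulmxA [U ^t* *m _]mulmxA U1 mul1mx.
Qed.

Lemma krylov_poly_fix (P : {poly R}) : (size P <= (size psi).+1)%N ->
  U *m U ^t* *m (hfun (horner P) A *m s) = hfun (horner P) A *m s.
Proof.
move=> sP.
rewrite (@eq_hfun _ _ (fun x => \sum_(j < size P) P`_j * x ^+ j)); last first.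
  by move=> i; rewrite horner_coef.
rewrite hfun_sum mulmx_suml mulmx_sumr; apply: eq_bigr => j _.
rewrite (hfunZ P`_j (fun x => x ^+ j)) hfunX// -scalemxAl -scalemxAr krylov_power_fix//.
by rewrite -ltnS (leq_trans (ltn_ord j)).
Qed.

(** At each step of Horner's scheme the vectors already built lie in the range of [U], so the
    projector [U *m U ^t*] can be inserted before the next multiplication by [A]. *)
Lemma krylov_poly_exact (P : {poly R}) : (size P <= (size psi).+1)%N ->
  hfun (horner P) Al *m (U ^t* *m s) = U ^t* *m (hfun (horner P) A *m s).
Proof.
have hAl : Al \is hermsymmx.
  by apply/hermsymP; rewrite /Al !adjmxM adjmxK mulmxA; move/hermsymP: hA => ->.
elim/poly_ind: P => [_|P c ih sP].
  rewrite !(@eq_hfun _ (horner 0) (fun=> 0)) ?hfun_cst; last 2 first.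
  - by move=> i; rewrite horner0.
  - by move=> i; rewrite horner0.
  by rewrite !mul_scalar_mx !scale0r mulmx0.
have sP' : (size P <= (size psi).+1)%N.
  rewrite (leq_trans _ sP)// size_MXaddC; case: ifP => // /andP[/eqP -> _].
  by rewrite size_poly0.
rewrite !hfun_hornerMXaddC// !mulmxDl mulmxDr !mul_scalar_mx -scalemxAr.
rewrite -(mulmxA Al) ih// -(mulmxA A) -{2}(krylov_poly_fix sP').
by rewrite /Al !mulmxA.
Qed.

Lemma krylov_rational_exact (N : {poly R}) : (size N <= (size psi).+1)%N ->
  hfun (fun x => N.[x] / D.[x]) A *m w =
  U *m hfun (fun x => N.[x] / D.[x]) Al *m U ^t* *m w.
Proof.
move=> sN.
have sD : (size D <= (size psi).+1)%N by rewrite /D size_prod_XsubC.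
have Ds : hfun (horner D) A *m s = w.
  rewrite /s mulmxA -hfunM (@eq_hfun _ _ (fun=> 1)) ?hfun_cst ?mul1mx// => i.
  by rewrite mulfV.
(* The denominator is itself a polynomial of admissible degree, so exactness applies to it and
   identifies the projected starting block. *)
have Us : U ^t* *m s = hfun (fun x => (D.[x])^-1) Al *m (U ^t* *m w).
  rewrite -[w in RHS]Ds -krylov_poly_exact// mulmxA -hfunM.
  rewrite (@eq_hfun _ _ (fun=> 1)) ?hfun_cst ?mul1mx// => i.
  by rewrite mulVf.
rewrite !(hfunM (horner N)) -mulmxA -/s -krylov_poly_fix//.
by rewrite -!mulmxA -krylov_poly_exact// Us !mulmxA.
Qed.

Lemma krylov_residual (f : R -> R) (N : {poly R}) : (size N <= (size psi).+1)%N ->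
  (hfun f A - U *m hfun f Al *m U ^t*) *m w =
  (hfun (fun x => f x - N.[x] / D.[x]) A
   - U *m hfun (fun x => f x - N.[x] / D.[x]) Al *m U ^t*) *m w.
Proof.
move=> sN; set g := fun x => N.[x] / D.[x]; set r := fun x => f x - g x.
have fE m (B : 'M[C]_m) : hfun f B = hfun r B + hfun g B.
  by rewrite -hfunD; apply: eq_hfun => i; rewrite /r subrK.
rewrite !fE mulmxDr mulmxDl opprD addrACA [LHS]mulmxDl.
by rewrite [X in _ + X]mulmxBl krylov_rational_exact// subrr addr0.
Qed.

End RationalKrylov.

Lemma compression_error (R : realType) (n p : nat) (A : 'M[R[i]]_n) (U : 'M[R[i]]_(n, p))
    (a b c : R) (f : R -> R) x :
  herm_between A a b -> U ^t* *m U = 1%:M -> 0 <= c ->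
  (forall y, a <= y <= b -> `|f y| <= c) ->
  enorm ((hfun f A - U *m hfun f (U ^t* *m A *m U) *m U ^t*) *m x) <= 2 * c * enorm x.
Proof.
move=> hA U1 c0 fc; rewrite mulmxBl.
have e1 : enorm (hfun f A *m x) <= c * enorm x.
  by apply: enorm_hfun_le => // i; apply: fc; exact: eigval_between.
have e2 : enorm (U *m hfun f (U ^t* *m A *m U) *m U ^t* *m x) <= c * enorm x.
  rewrite -!mulmxA enorm_isometry// !mulmxA.
  rewrite -[X in enorm X]mulmxA.
  have h : enorm (hfun f (U ^t* *m A *m U) *m (U ^t* *m x)) <= c * enorm (U ^t* *m x).
    apply: enorm_hfun_le => // i; apply: fc; apply: eigval_between.
    exact: herm_between_compress.
  apply: le_trans h _; rewrite ler_wpM2l//.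
  exact: enorm_coisometry.
have := enormD (hfun f A *m x) (- (U *m hfun f (U ^t* *m A *m U) *m U ^t* *m x)).
by rewrite enormN; lra.
Qed.

Section PolynomialReflection.
Variable F : fieldType.
Implicit Types (N : {poly F}) (s : seq F).

(** The sign compensates that of a product of [m] linear factors under [y -> - y], so that the
    fraction with opposite poles is the original one evaluated at [- y]. *)
Definition reflect_poly (m : nat) N : {poly F} := ((-1) ^+ m) *: (N \Po (- 'X)).

Lemma size_reflect_poly m N : (size (reflect_poly m N) <= size N)%N.
Proof.
apply: leq_trans (size_scale_leq _ _) _.
by rewrite size_comp_poly2// size_polyN size_polyX.
Qed.

Lemma reflect_poly_frac s N y :
  (reflect_poly (size s) N).[y] / (\prod_(z <- [seq - x | x <- s]) ('X - z%:P)).[y] =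
  N.[- y] / (\prod_(z <- s) ('X - z%:P)).[- y].
Proof.
have sg : ((-1) ^+ size s : F) != 0 by rewrite signr_eq0.
have -> : (\prod_(z <- [seq - x | x <- s]) ('X - z%:P)).[y] =
    (-1) ^+ size s * (\prod_(z <- s) ('X - z%:P)).[- y].
  clear sg; rewrite !horner_prod big_map.
  elim: s => [|z s ih]; first by rewrite !big_nil mulr1.
  by rewrite !big_cons ih !hornerXsubC exprS; ring.
rewrite /reflect_poly hornerZ horner_comp hornerN hornerX.
by move: sg; move: ((-1) ^+ size s) => e e0; rewrite -mulf_div mulfV// mul1r.
Qed.

End PolynomialReflection.

Section ExponentialKernel.
Variables (R : realType) (n k p q : nat).
Local Notation C := R[i].
Variables (a b : R) (A B : 'M[C]_n) (UF VF : 'M[C]_(n, k)) (psi : seq R).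
Variables (U : 'M[C]_(n, p)) (V : 'M[C]_(n, q)).
Hypotheses (a0 : 0 < a) (hA : herm_between A a b) (hB : herm_between B (- b) (- a)).
Hypotheses (psiP : {in psi, forall y, - b <= y <= - a}).
Hypotheses (U1 : U ^t* *m U = 1%:M) (V1 : V ^t* *m V = 1%:M).
Hypothesis hU : (rat_krylov A UF (real_poles psi) <= U^T)%MS.
Hypothesis hV : (rat_krylov B^T VF (real_poles [seq - x | x <- psi])
                   <= (map_mx Num.conj V)^T)%MS.
Let F := UF *m VF^T.

Lemma prod_subr_neq0 (x : R) (s : seq R) : {in s, forall y, x - y != 0} ->
  (\prod_(y <- s) ('X - y%:P)).[x] != 0.
Proof.
move=> h; rewrite -/(root _ _) root_prod_XsubC.
by apply/negP => /h; rewrite subrr eqxx.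
Qed.

Lemma norm_expRM_le (x y t : R) : 0 <= t -> x <= y -> `|expR (x * t)| <= expR (y * t).
Proof. by move=> t0 xy; rewrite ger0_norm ?expR_ge0// ler_expR ler_wpM2r. Qed.

Lemma expR_kron_error (t c : R) (N : {poly R}) (x : 'cV[C]_n) :
  0 <= t -> 0 <= c -> (size N <= (size psi).+1)%N ->
  (forall y, a <= y <= b -> `|expR (- y * t) - N.[y] / \prod_(z <- psi) (y - z)| <= c) ->
  enorm ((hfun (fun y => expR (- y * t)) A *m F *m hfun (fun y => expR (y * t)) B
     - U *m (hfun (fun y => expR (- y * t)) (U ^t* *m A *m U) *m (U ^t* *m UF *m (VF^T *m V))
        *m hfun (fun y => expR (y * t)) (V ^t* *m B *m V)) *m V ^t*) *m x)
  <= 4 * c * spectral_norm F * expR (- a * t) * enorm x.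
Proof.
move=> t0 c0 sN Nc; have c2 : 0 <= 2 * c by rewrite mulr_ge0.
set f := fun y => expR (- y * t); set g := fun y => expR (y * t).
set Al := U ^t* *m A *m U; set Bl := V ^t* *m B *m V.
pose D : {poly R} := \prod_(y <- psi) ('X - y%:P).
have DE y : D.[y] = \prod_(z <- psi) (y - z).
  by rewrite /D horner_prod; apply: eq_bigr => z _; rewrite hornerXsubC.
pose r := fun y => f y - N.[y] / D.[y].
have hAl := herm_between_compress hA U1; have hBl := herm_between_compress hB V1.
have Dpos y : a <= y <= b -> D.[y] != 0.
  move=> /andP[ay _]; apply: prod_subr_neq0 => z /psiP /andP[_ za].
  by apply: lt0r_neq0; move: a0 ay za; lra.
have eU : (hfun f A - U *m hfun f Al *m U ^t*) *m UF =
    (hfun r A - U *m hfun r Al *m U ^t*) *m UF.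
  apply: (krylov_residual (proj1 hA) U1 _ _ hU f sN) => i.
  - by apply/Dpos/eigval_between.
  - by apply/Dpos/eigval_between.
(* The Krylov statement for [B] concerns [B^T] and the conjugate of [V]; it is applied there, with
   opposite poles, and then transposed. *)
pose V' := map_mx Num.conj V; pose psi' := [seq - x | x <- psi].
pose D' : {poly R} := \prod_(y <- psi') ('X - y%:P).
pose N' := reflect_poly (size psi) N.
pose r' := fun y => g y - N'.[y] / D'.[y].
have V'adj : V' ^t* = V^T by apply/matrixP => i j; rewrite !mxE conjCK.
have V'1 : V' ^t* *m V' = 1%:M.
  rewrite V'adj; apply: (can_inj (@trmxK _ _ _)); rewrite trmx_mul trmxK trmx1.
  by rewrite -adjmx_tr.
have BlT : V' ^t* *m B^T *m V' = Bl^T.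
  by rewrite V'adj /Bl !trmx_mul mulmxA adjmx_tr trmxK.
have hBT := herm_between_tr hB.
have hBlT : herm_between (V' ^t* *m B^T *m V') (- b) (- a).
  exact: herm_between_compress.
have D'neg y : - b <= y <= - a -> D'.[y] != 0.
  move=> /andP[_ ya]; apply: prod_subr_neq0 => z /mapP[u /psiP /andP[_ ua] ->].
  by apply: ltr0_neq0; move: a0 ya ua; lra.
have r'E y : r' y = r (- y).
  by rewrite /r' /r /g /f opprK reflect_poly_frac.
have r'c y : - b <= y <= - a -> `|r' y| <= c.
  by move=> hy; rewrite r'E /r /f DE; apply: Nc; lra.
have sN' : (size N' <= (size psi').+1)%N.
  by rewrite size_map; apply: leq_trans sN; exact: size_reflect_poly.
have [E EE] : exists E : (R -> R) -> 'M[C]_n, forall h,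
    E h = hfun h B^T - V' *m hfun h (V' ^t* *m B^T *m V') *m V' ^t*.
  by eexists => h; reflexivity.
have eV : E g *m VF = E r' *m VF.
  rewrite !EE; apply: (krylov_residual (proj1 hBT) V'1 _ _ hV g sN') => i.
  - by apply/D'neg/eigval_between.
  - by apply/D'neg/eigval_between.
have trE h : (E h)^T = hfun h B - V *m hfun h Bl *m V ^t*.
  rewrite EE BlT !hfun_tr; [|by case: hBl|by case: hB].
  rewrite V'adj raddfB/= !trmx_mul !trmxK mulmxA.
  by rewrite [V ^t*]adjmx_tr.
have eVT : VF^T *m (hfun g B - V *m hfun g Bl *m V ^t*) =
    VF^T *m (hfun r' B - V *m hfun r' Bl *m V ^t*).
  by rewrite -(trE g) -(trE r') -(trmx_mul (E g)) -(trmx_mul (E r')) eV.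
(* One side is projected at a time: first the left factor with the exact right one, then the right
   factor with the compressed left one. Each part costs [2 c], and the untouched factor supplies
   [exp (- a t)]. *)
have -> : hfun f A *m F *m hfun g B
     - U *m (hfun f Al *m (U ^t* *m UF *m (VF^T *m V)) *m hfun g Bl) *m V ^t*
   = (hfun f A - U *m hfun f Al *m U ^t*) *m UF *m VF^T *m hfun g B
     + U *m hfun f Al *m U ^t* *m UF *m (VF^T *m (hfun g B - V *m hfun g Bl *m V ^t*)).
  rewrite mulmxBr mulmxBr /F !mulmxBl !mulmxA.
  by rewrite subrKA.
rewrite eU eVT mulmxDl.
have EAc x' : enorm ((hfun r A - U *m hfun r Al *m U ^t*) *m x') <= 2 * c * enorm x'.
  by apply: compression_error hA U1 c0 _ => y hy; rewrite /r /f DE; exact: Nc.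
have EBc x' : enorm ((hfun r' B - V *m hfun r' Bl *m V ^t*) *m x') <= 2 * c * enorm x'.
  exact: compression_error hB V1 c0 r'c.
move: (hfun r A - _) EAc (hfun r' B - _) EBc => EA EAc EB EBc.
have fa y : a <= y <= b -> `|f y| <= expR (- a * t).
  by move=> /andP[ay _]; apply: (norm_expRM_le t0); rewrite lerN2.
have ga y : - b <= y <= - a -> `|g y| <= expR (- a * t).
  by move=> /andP[_ ay]; exact: (norm_expRM_le t0).
have e0 : 0 <= expR (- a * t) by exact: expR_ge0.
have F0 := spectral_norm_ge0 F.
have b1 : enorm (EA *m UF *m VF^T *m hfun g B *m x)
   <= 2 * c * (spectral_norm F * (expR (- a * t) * enorm x)).
  rewrite -!mulmxA; apply: le_trans (EAc _) _; apply: ler_wpM2l c2 _ _ _.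
  rewrite mulmxA -/F; apply: le_trans (spectral_norm_ge _ _) _.
  apply: ler_wpM2l F0 _ _ _.
  by apply: (enorm_hfun_le _ e0) => i; apply: ga; exact: eigval_between hB.
have b2 : enorm (U *m hfun f Al *m U ^t* *m UF *m (VF^T *m EB) *m x)
   <= expR (- a * t) * (spectral_norm F * (2 * c * enorm x)).
  rewrite -!mulmxA (enorm_isometry _ U1).
  apply: le_trans (_ : _ <= expR (- a * t) *
    enorm (U ^t* *m (UF *m (VF^T *m (EB *m x))))) _.
    by apply: (enorm_hfun_le _ e0) => i; apply: fa; exact: eigval_between hAl.
  apply: ler_wpM2l e0 _ _ _; apply: le_trans (enorm_coisometry _ U1) _.
  rewrite mulmxA -/F; apply: le_trans (spectral_norm_ge _ _) _.
  by apply: ler_wpM2l F0 _ _ _; exact: EBc.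
apply: le_trans (enormD _ _) _.
apply: le_trans (lerD b1 b2) _; rewrite le_eqVlt; apply/orP; left; apply/eqP; ring.
Qed.

End ExponentialKernel.

(** * From exponentials to Laplace-Stieltjes functions *)

Section LaplaceStieltjes.
Variables (R : realType) (mu : {measure set (measurableTypeR R) -> \bar R}) (f : R -> R).
Hypothesis fE : forall z : R, 0 < z ->
  (f z)%:E = (\int[mu]_(t in `[0%R, +oo[) (expR (- t * z))%:E)%E.
Let D : set (measurableTypeR R) := `[0%R, +oo[%classic.

Let mD : measurable D. Proof. exact: measurable_itv. Qed.

Let D_ge0 t : D t -> 0 <= t.
Proof. by rewrite /D/= in_itv/= andbT. Qed.

Lemma integrable_expRM (z : R) : 0 < z ->
  mu.-integrable D (EFin \o (fun t => expR (- t * z))).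
Proof.
move=> z0; apply/integrableP; split.
  apply/measurable_EFinP; apply: measurableT_comp => //.
  by apply: measurable_funM => //; exact: measurable_funN.
rewrite (eq_integral (fun t : measurableTypeR R => (expR (- t * z))%:E)).
  by rewrite -fE// ltry.
by move=> t _ /=; rewrite ger0_norm// expR_ge0.
Qed.

Lemma laplace_Rintegral (z : R) : 0 < z -> f z = \int[mu]_(t in D) expR (- t * z).
Proof. by move=> z0; rewrite /Rintegral -fE. Qed.

Lemma laplace_antimono (y z : R) : 0 < y -> y <= z -> f z <= f y.
Proof.
move=> y0 yz; have z0 : 0 < z by apply: lt_le_trans y0 yz.
rewrite !laplace_Rintegral//; apply: le_Rintegral mD _ _ _; try exact: integrable_expRM.
move=> t /D_ge0 t0.
by rewrite ler_expR ler_wnM2l// oppr_le0.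
Qed.

Lemma laplace_le_lim_at0 (z : R) : 0 < z -> ((f z)%:E <= lim_at0 f)%E.
Proof.
move=> z0; rewrite /lim_at0; apply: lime_ge.
  apply: nonincreasing_at_right_is_cvge; near=> x => u v.
  rewrite !in_itv/= => /andP[u0 _] /andP[v0 _] uv.
  by rewrite lee_fin laplace_antimono.
near=> y; rewrite lee_fin laplace_antimono//.
near: y; exact: nbhs_right_le.
Unshelve. all: by end_near. Qed.

(** The inequality between exponentials is integrated against [mu]. Comparing with [f a], and not
    with the limit at [0], keeps all integrals finite even when that limit is infinite. *)
Lemma laplace_sum_le (I : finType) (c lam : I -> R) (a K : R) :
  0 < a -> (forall i, 0 < lam i) ->
  (forall t, 0 <= t -> \sum_i c i * expR (- lam i * t) <= K * expR (- a * t)) ->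
  \sum_i c i * f (lam i) <= K * f a.
Proof.
move=> a0 lam0 h; rewrite -lee_fin -sumEFin.
rewrite (eq_bigr (fun i => \int[mu]_(t in D) ((c i)%:E * (expR (- t * lam i))%:E)))%E; last first.
  by move=> i _; rewrite integralZl//; [rewrite -fE//|exact: integrable_expRM].
rewrite -integral_sum//; last first.
  by move=> i; apply: integrableZl => //; exact: integrable_expRM.
rewrite EFinM fE// -integralZl//; last exact: integrable_expRM.
apply: le_integral => //.
- by apply: integrable_sum => // i _; apply: integrableZl => //; exact: integrable_expRM.
- by apply: integrableZl => //; exact: integrable_expRM.
move=> t; rewrite inE => /D_ge0 t0.
rewrite (eq_bigr (fun i => (c i * expR (- lam i * t))%:E)); last first.
  by move=> i _; rewrite EFinM; do 2 f_equal; rewrite !mulNr mulrC.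
rewrite sumEFin lee_fin.
by have := h t t0; rewrite !mulNr [a * t]mulrC.
Qed.

End LaplaceStieltjes.

Lemma big_pair_sumType (R : nmodType) (I1 J1 I2 J2 : finType)
    (F1 : I1 -> J1 -> R) (F2 : I2 -> J2 -> R) :
  \sum_i \sum_j F1 i j + \sum_i \sum_j F2 i j =
  \sum_(x : I1 * J1 + I2 * J2)
    match x with inl ij => F1 ij.1 ij.2 | inr ij => F2 ij.1 ij.2 end.
Proof. by rewrite big_sumType/= !pair_bigA. Qed.

Section ProjectionError.
Variables (R : realType) (n k p q : nat).
Local Notation C := R[i].
Variables (a b : R) (A B : 'M[C]_n) (UF VF : 'M[C]_(n, k)) (psi : seq R).
Variables (U : 'M[C]_(n, p)) (V : 'M[C]_(n, q)).
Hypotheses (a0 : 0 < a) (hA : herm_between A a b) (hB : herm_between B (- b) (- a)).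
Hypotheses (psiP : {in psi, forall y, - b <= y <= - a}).
Hypotheses (U1 : U ^t* *m U = 1%:M) (V1 : V ^t* *m V = 1%:M).
Hypothesis hU : (rat_krylov A UF (real_poles psi) <= U^T)%MS.
Hypothesis hV : (rat_krylov B^T VF (real_poles [seq - x | x <- psi])
                   <= (map_mx Num.conj V)^T)%MS.
Let F := UF *m VF^T.
Let exact_fun f : 'M[C]_n := unvec (mxfun f (kron_diff A B) *m vec F).

Lemma eigval_sub_ge (m l : nat) (A' : 'M[C]_m) (B' : 'M[C]_l) i j :
  herm_between A' a b -> herm_between B' (- b) (- a) ->
  0 < eigval A' i - eigval B' j.
Proof.
move=> hA' hB'; have /andP[ai _] := eigval_between i hA'.
have /andP[_ bj] := eigval_between j hB'.
by rewrite subr_gt0; apply: le_lt_trans bj _; apply: lt_le_trans ai; rewrite gtrN.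
Qed.

Lemma rdot_projection_error v x :
  exists (I : finType) (c lam : I -> R), (forall i, 0 < lam i) /\
    forall f, rdot v ((exact_fun f - tensor_projection f A B UF VF U V) *m x) =
      \sum_i c i * f (lam i).
Proof.
have hAl := herm_between_compress hA U1; have hBl := herm_between_compress hB V1.
have [c1 c1E] := rdot_eigkron (eigmx A) (eigmx B) (eigval A) (eigval B) F v x.
have [c2 c2E] := rdot_eigkron (eigmx (U ^t* *m A *m U)) (eigmx (V ^t* *m B *m V))
  (eigval (U ^t* *m A *m U)) (eigval (V ^t* *m B *m V))
  (U ^t* *m UF *m (VF^T *m V)) (U ^t* *m v) (V ^t* *m x).
exists ('I_n * 'I_n + 'I_p * 'I_q)%type.
exists (fun z => match z with inl ij => c1 ij.1 ij.2 | inr ij => - c2 ij.1 ij.2 end).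
exists (fun z => match z with
  | inl ij => eigval A ij.1 - eigval B ij.2
  | inr ij => eigval (U ^t* *m A *m U) ij.1 - eigval (V ^t* *m B *m V) ij.2 end).
split=> [[ij|ij]|f]; first exact: eigval_sub_ge.
  exact: eigval_sub_ge.
have e1 := unvec_hfun_kron (proj1 hA) (proj1 hB) f F.
have e2 := unvec_hfun_kron (proj1 hAl) (proj1 hBl) f (U ^t* *m UF *m (VF^T *m V)).
have e3 : rdot v (tensor_projection f A B UF VF U V *m x) =
    \sum_i \sum_j f (eigval (U ^t* *m A *m U) i - eigval (V ^t* *m B *m V) j) * c2 i j.
  rewrite /tensor_projection mxfun_hfun e2 -c2E; set Y := eigkron _ _ _ _ _ _.
  by rewrite -(mulmxA (U *m Y)) -(mulmxA U) rdot_adjr.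
rewrite mulmxBl rdotBr e3 /exact_fun mxfun_hfun e1 c1E -sumrN.
under [X in _ + X]eq_bigr do rewrite -sumrN.
rewrite big_pair_sumType; apply: eq_bigr => -[ij|ij] _; first exact: mulrC.
by rewrite mulNr mulrC.
Qed.

Lemma spectral_norm_projection_error (mu : {measure set (measurableTypeR R) -> \bar R})
    (f : R -> R) (c : R) :
  (forall z : R, 0 < z ->
    (f z)%:E = (\int[mu]_(t in `[0%R, +oo[) (expR (- t * z))%:E)%E) ->
  0 <= c ->
  (forall t, 0 <= t -> exists2 N : {poly R}, (size N <= (size psi).+1)%N &
    forall y, a <= y <= b ->
      `|expR (- y * t) - N.[y] / \prod_(z <- psi) (y - z)| <= c) ->
  spectral_norm (exact_fun f - tensor_projection f A B UF VF U V)
    <= 4 * c * spectral_norm F * f a.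
Proof.
move=> fE c0 fN.
have f0 : 0 <= f a by rewrite -lee_fin fE//; apply: integral_ge0 => t _; rewrite lee_fin expR_ge0.
have F0 := spectral_norm_ge0 F.
have K0 : 0 <= 4 * c * spectral_norm F * f a by rewrite !mulr_ge0.
apply: (spectral_norm_le K0) => x.
(* [v] is the error vector of [f] itself. Once it is frozen, pairing with it is linear in the
   function, so the coefficients obtained here may be tested on exponentials. *)
set v := (exact_fun f - _) *m x.
have [I [ci [lam [lam0 ciE]]]] := rdot_projection_error v x.
pose K := 4 * c * spectral_norm F * enorm v * enorm x.
have v2 : enorm v ^+ 2 <= K * f a.
  rewrite enorm_sqr {2}/v ciE; apply: (laplace_sum_le fE a0 lam0) => t t0.
  have [N sN Nc] := fN t t0.
  have := expR_kron_error a0 hA hB psiP U1 V1 hU hV x t0 c0 sN Nc.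
  have ciEt := ciE (fun z => expR (- z * t)).
  have expB (y z : R) : expR (- (y - z) * t) = expR (- y * t) * expR (z * t).
    by rewrite -expRD; congr expR; ring.
  have kronE (m l : nat) (A' : 'M[C]_m) (B' : 'M[C]_l) F' :
      A' \is hermsymmx -> B' \is hermsymmx ->
      unvec (mxfun (fun z => expR (- z * t)) (kron_diff A' B') *m vec F') =
      hfun (fun y => expR (- y * t)) A' *m F' *m hfun (fun y => expR (y * t)) B'.
    move=> hA' hB'; rewrite mxfun_hfun (unvec_hfun_kron hA' hB').
    by rewrite (eigkronM _ _ _ _ _ expB) !hfunE.
  have hAl := proj1 (herm_between_compress hA U1).
  have hBl := proj1 (herm_between_compress hB V1).
  move: ciEt; rewrite /exact_fun /tensor_projection (kronE _ _ _ _ _ (proj1 hA) (proj1 hB)).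
  rewrite (kronE _ _ _ _ _ hAl hBl) => <- Mx.
  apply: le_trans (rdot_le _ _) _; apply: le_trans (ler_wpM2l (enorm_ge0 v) Mx) _.
  by rewrite le_eqVlt; apply/orP; left; apply/eqP; rewrite /K /F; ring.
have := enorm_ge0 v; rewrite le_eqVlt => /orP[/eqP <-|vp].
  exact: mulr_ge0 K0 (enorm_ge0 x).
rewrite -(ler_pM2l vp) -expr2; apply: le_trans v2 _.
by rewrite le_eqVlt; apply/orP; left; apply/eqP; rewrite /K; ring.
Qed.

End ProjectionError.

(** * Numerical constants and conclusion *)

Section Constants.
Variable R : realType.
Implicit Types (h y a b kappa : R).

Lemma pi_lt_ratio : pi < 63 / 20 :> R.
Proof.
have p0 := pi_gt0 R; have := pi2_lt R.
move=> p2; rewrite ltNge; apply/negP => p3.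
have : 63 / 20 * (63 / 20) <= pi * pi :> R by apply: ler_pM.
lra.
Qed.

(** The logarithmic part of [gamma] is [pi^-1 * ln (l ^ 2 * kappa * (16 / pi))]; here [16 / pi >= 1]
    is dropped and [pi^-1 >= 0.31]. *)
Lemma gamma_ge (l : nat) kappa : (0 < l)%N -> 1 < kappa ->
  223 / 100 + (31 / 100) * ln (l%:R ^+ 2 * kappa) <= gamma l kappa.
Proof.
move=> l0 k1; have p0 := pi_gt0 R; have p1 := pi_lt_ratio.
have k0 : 0 < kappa by lra.
have lR : 1 <= l%:R :> R by rewrite ler1n.
have lk1 : 1 <= l%:R ^+ 2 * kappa.
  by apply: mulr_ege1; [exact: exprn_ege1|exact: ltW].
have kp : 0 < kappa / pi by rewrite divr_gt0.
have s0 : 0 < Num.sqrt (kappa / pi) by rewrite sqrtr_gt0.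
have x0 : 0 < 4 * l%:R * Num.sqrt (kappa / pi) by rewrite !mulr_gt0// (lt_le_trans ltr01 lR).
rewrite /gamma lerD2l.
have ln2E : ln (l%:R ^+ 2 * kappa) <= 2 * ln (4 * l%:R * Num.sqrt (kappa / pi)).
  have lk0 : 0 < l%:R ^+ 2 * kappa := lt_le_trans ltr01 lk1.
  rewrite mulr_natl -lnXn// ler_ln ?posrE ?exprn_gt0//.
  rewrite !exprMn (sqr_sqrtr (ltW kp)).
  have -> : 4 ^+ 2 * l%:R ^+ 2 * (kappa / pi) = l%:R ^+ 2 * kappa * (16 / pi).
    by rewrite (_ : 4 ^+ 2 = 16)//; [ring|rewrite expr2; ring].
  by rewrite ler_peMr ?(le_trans _ lk1)// ler_pdivlMr// mul1r; lra.
have ln0 : 0 <= ln (l%:R ^+ 2 * kappa) by apply: ln_ge0.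
have p3 : 31 / 100 <= pi^-1 :> R.
  by rewrite -[_ / _]invrK lef_pV2 ?posrE ?invr_gt0 ?divr_gt0//; rewrite invf_div; lra.
apply: le_trans (_ : pi^-1 * ln (l%:R ^+ 2 * kappa) <= _).
  exact: ler_wpM2r.
have pi0 : 0 <= pi^-1 :> R by rewrite invr_ge0 ltW.
apply: le_trans (ler_wpM2l pi0 ln2E) _.
by rewrite le_eqVlt; apply/orP; left; apply/eqP; ring.
Qed.

Lemma expR_092_le : expR (92 / 100) <= 26 / 10 :> R.
Proof.
have h : expR (2 * (23 / 100)) <= 16 / 10 :> R.
  apply: le_trans (expR_le_ratio _) _; first by lra.
  by rewrite ler_pdivrMr; lra.
have -> : 92 / 100 = 2 * (23 / 100) + 2 * (23 / 100) :> R by field.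
rewrite expRD; apply: le_trans (ler_pM _ _ h h) _; rewrite ?expR_ge0//.
lra.
Qed.

(** The convex function [y / 6 + 1 / y] is at most [0.92] at both ends of [[1.6, 4]], and a step
    below [2.39] cannot jump over this interval. *)
Lemma multiple_between h : 0 < h -> h < 239 / 100 ->
  exists2 K : nat, (0 < K)%N & K%:R * h / 6 + (K%:R * h)^-1 <= 92 / 100.
Proof.
move=> h0 h1; exists (Num.truncn ((16 / 10) / h)).+1 => //.
set y := _%:R * h.
have /andP[t1 t2] : (Num.truncn ((16 / 10) / h))%:R <= (16 / 10) / h < (Num.truncn ((16 / 10) / h)).+1%:R.
  by apply: Num.Theory.truncn_itv; rewrite divr_ge0 ?ltW//; lra.
have y1 : 16 / 10 < y by rewrite -ltr_pdivrMr.
have y2 : y <= 4.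
  rewrite /y -natr1 mulrDl mul1r.
  have : (Num.truncn ((16 / 10) / h))%:R * h <= 16 / 10 by rewrite -ler_pdivlMr.
  lra.
move: y y1 y2 => y y1 y2; have y0 : 0 < y by lra.
rewrite -(ler_pM2r y0) mulrDl mulVf ?gt_eqF//.
have : 0 <= (y - 16 / 10) * (4 - y) by rewrite mulr_ge0//; lra.
lra.
Qed.

(** From [3 * ln 2 >= 2.07] and [pi ^ 2 <= 9.889], the quotient [9.889 / 4.14] is below [2.39]. *)
Lemma lt_of_expR_lt h : 0 < h -> expR (- (pi ^+ 2 / (2 * h))) < 1 / 8 :> R -> h < 239 / 100.
Proof.
move=> h0; have -> : 1 / 8 = expR (- (3 * ln 2)) :> R.
  have e8 : expR (3 * ln 2) = 8 :> R.
    rewrite (_ : 3 * ln 2 = ln 2 + ln 2 + ln 2 :> R); last by ring.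
    by rewrite !expRD lnK ?posrE//; ring.
  by rewrite expRN e8 div1r.
rewrite ltr_expR ltrN2 => hp; have l2 := ln2_ge R; have p2 := pi2_lt R.
have : 207 / 100 < pi ^+ 2 / (2 * h) by apply: le_lt_trans hp; lra.
rewrite ltr_pdivlMr ?mulr_gt0//; lra.
Qed.

End Constants.

Lemma expR_zolotarev_approx (R : realType) (a b t : R) (l : nat) (psi : l.-tuple R) :
  0 < a -> a < b -> (0 < l)%N -> zolotarev_poles a b psi -> 0 <= t ->
  exists2 N : {poly R}, (size N <= (size psi).+1)%N &
    forall y, a <= y <= b ->
      `|expR (- y * t) - N.[y] / \prod_(z <- psi) (y - z)|
      <= 4 * gamma l (b / a) * rho a b `^ (l%:R / 2).
Proof.
move=> a0 ab l0 zp t0.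
have ba1 : 1 < b / a by rewrite ltr_pdivlMr// mul1r.
have L0 : 0 < ln (4 * b / a).
  by apply: ln_gt0; rewrite -mulrA; lra.
have lR : 0 < l%:R :> R by rewrite ltr0n.
set h := ln (4 * b / a) / l%:R; have h0 : 0 < h by rewrite divr_gt0.
have -> : rho a b `^ (l%:R / 2) = expR (- (pi ^+ 2 / (2 * h))).
  rewrite /rho -expRM; congr expR; rewrite /h; field.
  by rewrite !gt_eqF.
have g0 := gamma_ge l0 ba1.
have ln0 : 0 <= ln (l%:R ^+ 2 * (b / a)).
  apply: ln_ge0; apply: mulr_ege1; [by rewrite exprn_ege1// ler1n|exact: ltW].
set r := expR _; have r0 : 0 < r by exact: expR_gt0.
set g := gamma _ _ in g0 *; set lk := ln _ in g0 ln0.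
(* If the claimed bound is at least [1], the zero approximant works. Otherwise [g >= 2] forces
   [r < 1 / 8], which bounds [h]. *)
have [gr|gr] := leP 1 (4 * g * r).
  exists 0; first by rewrite size_poly0.
  move=> y /andP[ay _]; rewrite horner0 mul0r subr0 ger0_norm ?expR_ge0//.
  apply: le_trans gr; rewrite -[leRHS]expR0 ler_expR mulNr oppr_le0 mulr_ge0//.
  by apply: le_trans ay; exact: ltW.
have h1 : h < 239 / 100.
  apply: lt_of_expR_lt => //; rewrite -/r ltr_pdivlMr// mulrC.
  apply: le_lt_trans gr; rewrite ler_wpM2r ?ltW//; lra.
have [K K0 hK] := multiple_between h0 h1.
have [psi_ab _] := zp.
have s0 : {in [seq - z | z <- psi], forall p, 0 < p <= b}.
  by move=> _ /mapP[z /psi_ab /andP[z1 z2] ->]; apply/andP; split; lra.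
have sz : size [seq - z | z <- psi] = l by rewrite size_map size_tuple.
have [N sN NE] := @expR_rational_approx R [seq - z | z <- psi] t
  (fun p hp => proj1 (andP (s0 p hp))).
exists N; first by rewrite (leq_trans sN)// sz size_tuple.
move=> y yab; have /andP[ay _] := yab; have y0 : 0 < y by apply: lt_le_trans ay.
have := NE y y0; rewrite !big_map => ->.
have -> : \prod_(z <- psi) ((y - - z) / (y + - z)) = \prod_(z <- psi) ((y + z) / (y - z)).
  by apply: eq_bigr => z _; rewrite opprK.
rewrite normrM.
have b1 : `|\prod_(z <- psi) ((y + z) / (y - z))| <= r * (26 / 10).
  apply: le_trans (half_grid_prod_bound h0 K0 (fun M => zolotarev_poles_bound M a0 ab l0 zp yab)) _.
  rewrite -addrA expRD -/r; apply: (ler_wpM2l (ltW r0)).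
  by apply: le_trans _ (expR_092_le R); rewrite ler_expR.
have b2 : `|allpasses [seq - z | z <- psi] (fun t => expR (- y * t)) t| <= 329 / 100 + 47 / 100 * lk.
  have := @allpasses_bound R [seq - z | z <- psi] a b y t.
  by rewrite sz; apply.
apply: le_trans (ler_pM (normr_ge0 _) (normr_ge0 _) b1 b2) _.
(* Here [2.6 * (3.29 + 0.47 * lk) = 8.554 + 1.222 * lk] is compared with [4 * (2.23 + 0.31 * lk) =
   8.92 + 1.24 * lk]. *)
rewrite -(mulrA r) (mulrC (4 * g)); apply: (ler_wpM2l (ltW r0)); lra.
Qed.

Lemma herm_between_opp (R : realType) (n : nat) (A : 'M[R[i]]_n) (a b : R) :
  herm_between (- A) a b -> herm_between A (- b) (- a).
Proof.
move=> [/hermsymP hA Aab]; split=> [|x].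
  apply/hermsymP/eqP; rewrite -eqr_opp -[X in _ == X]hA; apply/eqP/matrixP => i j.
  by rewrite !mxE rmorphN.
by have := Aab x; rewrite mulNmx rdotNr; lra.
Qed.

Lemma adjmx_conj_isometry (R : realType) (m n : nat) (V : 'M[R[i]]_(m, n)) :
  (map_mx Num.conj V) ^t* *m map_mx Num.conj V = 1%:M -> V ^t* *m V = 1%:M.
Proof.
have -> : (map_mx Num.conj V) ^t* = V^T by apply/matrixP => i j; rewrite !mxE conjCK.
by move=> /(congr1 trmx); rewrite trmx_mul trmxK trmx1 -adjmx_tr.
Qed.

Local Close Scope classical_set_scope.
Local Close Scope sesquilinear_scope.
Local Close Scope complex_scope.

Theorem corollary4p1 (R : realType) (n k l p q : nat) (a b : R)
    (A B : 'M[R[i]]_n) (UF VF : 'M[R[i]]_(n, k)) (f : R -> R)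
    (psi : l.-tuple R) (U : 'M[R[i]]_(n, p)) (V : 'M[R[i]]_(n, q)) :
  0 < a -> a < b ->
  hermitian_posdef A -> hermitian_posdef (- B) ->
  spectrum_in A a b -> spectrum_in (- B) a b ->
  laplace_stieltjes f ->
  (1 <= l)%N ->
  zolotarev_poles a b psi ->
  orthonormal_basis U (rat_krylov A UF (real_poles psi)) ->
  orthonormal_basis (map_mx Num.conj V)
    (rat_krylov B^T VF (real_poles [seq - x | x <- psi])) ->
  let F : 'M[R[i]]_n := UF *m VF^T in
  let M := kron_diff A B in
  let X : 'M[R[i]]_n := unvec (mxfun f M *m vec F) in
  let Xl := tensor_projection f A B UF VF U V in
  ((spectral_norm (X - Xl))%:E
   <= (16 * gamma l (b / a))%:E * lim_at0 f
      * (rho a b `^ (l%:R / 2) * spectral_norm F)%:E)%E.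
Proof.
move=> a0 ab [hA _] [hB _] sA sB [mu fE] l0 zp [U1 UE] [V1 VE]; lazy zeta.
have hAb := herm_between_spectrum hA sA.
have hBb := herm_between_opp (herm_between_spectrum hB sB).
have [psi_ab _] := zp.
have V1' := adjmx_conj_isometry V1.
have hU : (rat_krylov A UF (real_poles psi) <= U^T)%MS by rewrite (eqmxP UE).
have hV : (rat_krylov B^T VF (real_poles [seq - x | x <- psi]) <= (map_mx Num.conj V)^T)%MS.
  by rewrite (eqmxP VE).
have g0 : 0 <= gamma l (b / a).
  have ba1 : 1 < b / a by rewrite ltr_pdivlMr// mul1r.
  apply: le_trans (gamma_ge l0 ba1); apply: addr_ge0; first by lra.
  apply: mulr_ge0; first by lra.
  by apply: ln_ge0; apply: mulr_ege1; [rewrite exprn_ege1// ler1n|exact: ltW].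
have r0 : 0 <= rho a b `^ (l%:R / 2) by exact: powR_ge0.
have F0 := spectral_norm_ge0 (UF *m VF^T).
have c0 : 0 <= 4 * gamma l (b / a) * rho a b `^ (l%:R / 2) by rewrite !mulr_ge0.
have := spectral_norm_projection_error a0 hAb hBb psi_ab U1 V1' hU hV fE c0
  (fun t t0 => expR_zolotarev_approx a0 ab l0 zp t0).
move=> err.
apply: (@le_trans _ _ ((16 * gamma l (b / a))%:E * (f a)%:E *
  (rho a b `^ (l%:R / 2) * spectral_norm (UF *m VF^T))%:E)%E).
  rewrite -!EFinM lee_fin; apply: le_trans err _.
  by rewrite le_eqVlt; apply/orP; left; apply/eqP; ring.
apply: lee_wpmul2r; first by rewrite lee_fin mulr_ge0.
apply: lee_wpmul2l; first by rewrite lee_fin mulr_ge0.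
exact: (laplace_le_lim_at0 fE a0).
Qed.
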